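(* Let $\mathcal{A}$ be an irreducible $TF_2$ arrangement of rank $r\ge3$ and $\mathbf{m}$ a multiplicity on $\mathcal{A}$. Then $\mathrm{coker}(\iota)\cong S^\kappa$ (up to graded shifts) with $\kappa=\big(\sum_{X\in L_2^{\mathrm{trip}}}|\mathcal{A}_X|\big)-|\mathcal{A}|$, and $$H^2(\mathcal{J}^\bullet(\mathcal{A},\mathbf{m}))\cong\mathrm{coker}\Big(\bigoplus_{X\in L_2^{\mathrm{trip}}}D(\mathcal{A}_X,\mathbf{m}_X)\xrightarrow{\ \sum\overline{\psi_X}\ }\mathrm{coker}(\iota)\Big).$$ Moreover: (1) $(\mathcal{A},\mathbf{m})$ is free if and only if $\sum\overline{\psi_X}$ is surjective. (2) $\kappa>0$, i.e. $|\mathcal{A}|<\sum_{X\in L_2^{\mathrm{trip}}}|\mathcal{A}_X|$. (3) If $|\mathcal{A}|<\sum_{X\in L_2^{\mathrm{trip}}}(|\mathcal{A}_X|-1)$, or equivalently $r<\#L_2^{\mathrm{trip}}$, then $\mathcal{A}$ is totally non-free. Furthermore, in this case every arrangement $\mathcal{A}'\in\mathcal{M}(L(\mathcal{A}))$ is totally non-free.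
   Context: Let $\mathbb{K}$ be a field, $V$ a $\mathbb{K}$-vector space of dimension $\ell$, $S=\mathrm{Sym}(V^* )\cong\mathbb{K}[x_1,\dots,x_\ell]$. An arrangement $\mathcal{A}$ in $V$ is a finite set of linear hyperplanes $H=\ker\alpha_H$. $L=L(\mathcal{A})$ is the intersection lattice (including $V$), ordered by reverse inclusion and ranked by codimension; $L_k$: rank $k$ flats; $r(\mathcal{A})$: codimension of $T(\mathcal{A})=\bigcap_{H}H$; $\mathcal{A}_X=\{H:X\subseteq H\}$; $L_2^{\mathrm{trip}}$: the $X\in L_2$ with $|\mathcal{A}_X|\ge3$. A multiplicity is $\mathbf{m}:\mathcal{A}\to\mathbb{Z}_{>0}$; $\mathbf{m}_X=\mathbf{m}|_{\mathcal{A}_X}$; $D(\mathcal{A},\mathbf{m})=\{\theta\in\mathrm{Der}_{\mathbb{K}}(S):\theta(\alpha_H)\in\langle\alpha_H^{\mathbf{m}(H)}\rangle\ \forall H\}$; $(\mathcal{A},\mathbf{m})$ is free if this is a free $S$-module; $\mathcal{A}$ is totally non-free if $(\mathcal{A},\mathbf{m})$ is free for no $\mathbf{m}$. $\mathcal{A}$ is irreducible if it is not a product of arrangements in nonzero spaces (a factor may be empty; so irreducible implies essential). $\mathcal{M}(L)$ is the moduli space of arrangements in $\mathbb{K}^\ell$ whose intersection lattice is isomorphic to $L$, taken up to linear change of coordinates. Complexes. $D_0(\mathcal{A},\mathbf{m})=D(\mathcal{A},\mathbf{m})$; for $1\le k\le r(\mathcal{A})$, $D_k(\mathcal{A},\mathbf{m})$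 is the cokernel of $\tau_{k-1}:D_{k-1}(\mathcal{A},\mathbf{m})\to\bigoplus_{X\in L_{k-1}}D_{k-1}(\mathcal{A}_X,\mathbf{m}_X)$ with components $\phi_{k-1}(X)$, where for $r(Y)\ge k$ the map $\phi_k(Y):D_k(\mathcal{A},\mathbf{m})\to D_k(\mathcal{A}_Y,\mathbf{m}_Y)$ is the inclusion if $k=0$ and otherwise is induced on cokernels by $\phi_{k-1}(Y)$ and projection to the summands with $X\le Y$. $\mathcal{D}^k=\bigoplus_{X\in L_k}D_k(\mathcal{A}_X,\mathbf{m}_X)$, with differential $\mathcal{D}^k\to D_{k+1}(\mathcal{A},\mathbf{m})\xrightarrow{\tau_{k+1}}\mathcal{D}^{k+1}$. With $\partial/\partial x_i$ in degree $0$, each $\mathcal{D}^k$ is graded and generated in degree $0$. $\mathcal{S}^\bullet(\mathcal{A})=\mathcal{D}^\bullet(\mathcal{A},\mathbf{m})_0\otimes_{\mathbb{K}}S$ (independent of $\mathbf{m}$), and $\mathcal{J}^\bullet(\mathcal{A},\mathbf{m})=\ker(\mathcal{S}^\bullet(\mathcal{A})\to\mathcal{D}^\bullet(\mathcal{A},\mathbf{m}))$. In particular $\mathcal{J}^1=\bigoplus_{H\in\mathcal{A}}J(H)$, $J(H)=\langle\alpha_H^{\mathbf{m}(H)}\rangle$. $TF_2$: let $R_0(\mathcal{A})=T(\mathcal{A})^*$ and, for $1\le k\le r$, $R_k(\mathcal{A})=\ker(\pi_{k-1}:\bigoplus_{X\in L_{k-1}}R_{k-1}(\mathcal{A}_X)\to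 R_{k-1}(\mathcal{A}))$, $\pi_k$ being the sum of the natural maps $R_k(\mathcal{A}_X)\to R_k(\mathcal{A})$ (restriction of functionals for $k=0$, inclusions induced on kernels for $k\ge1$). $\mathcal{A}$ is $2$-formal if $\pi_2$ is surjective, and $k$-formal ($k\ge3$) if $(k-1)$-formal and $\pi_k$ is surjective (automatic for $k=r$); totally formal if $\mathcal{A}_X$ is $k$-formal for all $2\le k\le r(X)$, $X\in L$. $\mathcal{A}$ is $TF_2$ if it is totally formal and $\mathcal{S}^i(\mathcal{A})=0$ for all $i>2$. Maps. Let $[H]$ denote the generator $\alpha_H^{\mathbf{m}(H)}$ of $J(H)$ in $\bigoplus_{H\in\mathcal{A}}J(H)$, and, for $X\in L_2^{\mathrm{trip}}$ and $H<X$ (i.e. $H\in\mathcal{A}_X$), let $[X,H]$ denote the generator of the copy of $J(H)$ indexed by $(X,H)$ in $\bigoplus_{X\in L_2^{\mathrm{trip}}}\bigoplus_{H<X}J(H)$. Then $\iota:\bigoplus_{H\in\mathcal{A}}J(H)\to\bigoplus_{X\in L_2^{\mathrm{trip}}}\bigoplus_{H<X}J(H)$ is $S$-linear with $\iota([H])=\sum_{X\in L_2^{\mathrm{trip}},\,H<X}[X,H]$; $\psi_X(\theta)=\sum_{H<X}\frac{\theta(\alpha_H)}{\alpha_H^{\mathbf{m}(H)}}[X,H]$ for $\theta\in D(\mathcal{A}_X,\mathbf{m}_X)$; and $\sum\overline{\psi_X}$ is the composition of $\sum\psi_X$ with the quotient map onto $\mathrm{coker}(\iota)$. *)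

(* Defs.v *)
From HB Require Import structures.
From mathcomp Require Import all_boot all_order all_algebra.
From mathcomp Require Export mpoly.

Set Implicit Arguments.
Unset Strict Implicit.
Unset Printing Implicit Defensive.

Import GRing.Theory.
Local Open Scope ring_scope.

(* [Subquot Z B] stands for the module Z / B, where B <= Z <= W are
   submodules. All modules below are subquotients of explicit free modules,
   and a map between two of them is given by a function on representatives. *)
Record subquot (R : nzRingType) (W : lmodType R) := Subquot {
  sq_num : W -> Prop;
  sq_den : W -> Prop
}.

Section Subquot.
Context {R : nzRingType}.

Definition sq_zero (W : lmodType R) (M : subquot W) : Prop :=
  forall x, sq_num M x -> sq_den M x.

Definition sq_sum (I : finType) (W : lmodType R) (P : {set I})
    (M : I -> subquot W) : subquot {ffun I -> W} :=
  Subquot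
    (fun f : {ffun I -> W} =>
       forall i, if i \in P then sq_num (M i) (f i) else f i = 0)
    (fun f : {ffun I -> W} =>
       forall i, if i \in P then sq_den (M i) (f i) else f i = 0).

Definition sq_ker (W W' : lmodType R) (M : subquot W) (N : subquot W')
    (f : W -> W') : subquot W :=
  Subquot (fun x => sq_num M x /\ sq_den N (f x)) (sq_den M).

Definition sq_coker (W W' : lmodType R) (M : subquot W) (N : subquot W')
    (f : W -> W') : subquot W' :=
  Subquot (sq_num N)
          (fun y => sq_num N y /\ exists2 x, sq_num M x & sq_den N (y - f x)).

(* ker g / im f for M --f--> N --g--> P *)
Definition sq_homology (W W' W'' : lmodType R) (M : subquot W)
    (N : subquot W') (P : subquot W'') (f : W -> W') (g : W' -> W'')
    : subquot W' :=
  sq_coker M (sq_ker N P g) f.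

Definition sq_surj (W W' : lmodType R) (M : subquot W) (N : subquot W')
    (f : W -> W') : Prop :=
  forall y, sq_num N y -> exists2 x, sq_num M x & sq_den N (y - f x).

(* Isomorphism of graded modules. [degW d x] says that x is homogeneous of
   degree d; the degree d part of Z / B is the image of the degree d part of
   Z. *)
Definition sq_iso (W W' : lmodType R) (degW : nat -> W -> Prop)
    (degW' : nat -> W' -> Prop) (M : subquot W) (N : subquot W') : Prop :=
  exists f : W -> W',
    [/\ forall x, sq_num M x -> sq_num N (f x),
        forall a x y, sq_num M x -> sq_num M y ->
          sq_den N (f (a *: x + y) - (a *: f x + f y)),
        forall x, sq_num M x -> (sq_den N (f x) <-> sq_den M x),
        sq_surj M N f
      & forall d x, sq_num M x -> degW d x ->
          exists y, [/\ sq_num N y, degW' d y & sq_den N (f x - y)]].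

(* Existence of a basis, which is finite for the submodules of a free module
   of finite rank over a commutative domain to which this is applied. *)
Definition sq_free (W : lmodType R) (M : subquot W) : Prop :=
  exists (n : nat) (b : 'I_n -> W),
    [/\ forall i, sq_num M (b i),
        forall x, sq_num M x ->
          exists c : 'I_n -> R, sq_den M (x - \sum_i c i *: b i)
      & forall c : 'I_n -> R, sq_den M (\sum_i c i *: b i) ->
          forall i, c i = 0].

Definition full_sq (W : lmodType R) : subquot W :=
  Subquot (fun=> True) (fun x => x = 0).

Definition rspan (W : lmodType R) (P : W -> Prop) (w : W) : Prop :=
  exists (n : nat) (c : 'I_n -> R) (z : 'I_n -> W),
    (forall i, P (z i)) /\ w = \sum_i c i *: z i.

(* M_0 tensored over the base field with the polynomial ring R, where M_0 is
   the degree 0 part of M. The ambient W is R (x) W_0 with W_0 the vector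
   space of its degree 0 elements, so for subspaces B_0 <= Z_0 of W_0 the
   R-module R (x) (Z_0 / B_0) is (R Z_0) / (R B_0). *)
Definition sq_ext0 (W : lmodType R) (degW : nat -> W -> Prop)
    (M : subquot W) : subquot W :=
  Subquot (rspan (fun x => sq_num M x /\ degW 0%N x))
          (rspan (fun x => sq_den M x /\ degW 0%N x)).

End Subquot.

(* Hyperplanes are given by linear forms on V = K^l (columns), a form being
   the row of its coefficients. *)
Definition hyperplane (K : fieldType) (l : nat) (a : 'rV[K]_l) :
    {vspace 'cV[K]_l} :=
  lker (linfun (mulmx a : 'cV[K]_l -> 'M[K]_1)).

Record arrangement (K : fieldType) (l : nat) := Arrangement {
  nhyp : nat;
  form : 'I_nhyp -> 'rV[K]_l;
  form_neq0 : forall i, form i != 0;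
  form_inj : injective (fun i => hyperplane (form i))
}.

Section Arrangement.
Context {K : fieldType} {l : nat}.

Definition codim (X : {vspace 'cV[K]_l}) : nat := (l - \dim X)%N.

Context (A : arrangement K l).

Definition hyp (i : 'I_(nhyp A)) : {vspace 'cV[K]_l} := hyperplane (form i).

(* A set [B : {set 'I_(nhyp A)}] is viewed as the subarrangement of A formed
   by the hyperplanes in B; [setT] is A itself. *)
Definition center (B : {set 'I_(nhyp A)}) : {vspace 'cV[K]_l} :=
  (\bigcap_(i in B) hyp i)%VS.

Definition arr_rank (B : {set 'I_(nhyp A)}) : nat := codim (center B).

(* The intersection lattice of A; it contains V = center set0. *)
Definition flat : finType :=
  seq_sub [seq center B | B <- enum {set 'I_(nhyp A)}].

Definition flat_le (X Y : flat) : bool := (val Y <= val X)%VS.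

(* L_k(B), as a set of flats of A. *)
Definition flats (B : {set 'I_(nhyp A)}) (k : nat) : {set flat} :=
  [set X : flat | (codim (val X) == k)
     && [exists C : {set 'I_(nhyp A)}, (C \subset B) && (val X == center C)]].

Definition loc (B : {set 'I_(nhyp A)}) (X : flat) : {set 'I_(nhyp A)} :=
  [set i in B | (val X <= hyp i)%VS].

Definition locn (X : flat) : nat := #|loc setT X|.

Definition L2trip : {set flat} :=
  [set X in flats setT 2 | (3 <= locn X)%N].

(* A is not a product of arrangements in nonzero spaces V1, V2, where
   V = V1 (+) V2 and the hyperplanes of the product are the H1 (+) V2 and the
   V1 (+) H2. *)
Definition irreducible_arr : Prop :=
  ~ exists V1 V2 : {vspace 'cV[K]_l},
      [/\ V1 != 0%VS, V2 != 0%VS, (V1 :&: V2 = 0)%VS, (V1 + V2 = fullv)%VS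
        & forall i,
            (exists H1 : {vspace 'cV[K]_l},
               [/\ (H1 <= V1)%VS, (\dim H1).+1 = \dim V1
                 & hyp i = (H1 + V2)%VS])
         \/ (exists H2 : {vspace 'cV[K]_l},
               [/\ (H2 <= V2)%VS, (\dim H2).+1 = \dim V2
                 & hyp i = (V1 + H2)%VS])].

Fixpoint rcarr (k : nat) : lmodType K :=
  if k is k'.+1 then {ffun flat -> rcarr k'} else 'rV[K]_l.

(* The natural maps R_k(B_X) -> R_k(B) are the identity on representatives:
   T(B)^* is V^* modulo the functionals vanishing on T(B), and for k > 0
   families indexed by L_{k-1}(B_X) are extended by zero. *)
Definition rpi (k : nat) (f : rcarr k.+1) : rcarr k :=
  \sum_(X : flat) (f : {ffun flat -> rcarr k}) X.

Fixpoint Rsp (k : nat) (B : {set 'I_(nhyp A)}) : subquot (rcarr k) :=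
  match k return subquot (rcarr k) with
  | 0 => Subquot (fun=> True)
           (fun a : 'rV[K]_l =>
              forall v : 'cV[K]_l, v \in center B -> a *m v = 0)
  | k'.+1 => sq_ker (sq_sum (flats B k') (fun X => Rsp k' (loc B X)))
                    (Rsp k' B) (@rpi k')
  end.

Definition rpi_surj (k : nat) (B : {set 'I_(nhyp A)}) : Prop :=
  sq_surj (sq_sum (flats B k) (fun X => Rsp k (loc B X))) (Rsp k B) (@rpi k).

Definition kformal (k : nat) (B : {set 'I_(nhyp A)}) : Prop :=
  forall j, (2 <= j <= k)%N -> rpi_surj j B.

Definition totally_formal : Prop :=
  forall (X : flat) (k : nat), (2 <= k <= arr_rank (loc setT X))%N ->
    kformal k (loc setT X).

Local Notation S := {mpoly K[l]}.

Definition formp (i : 'I_(nhyp A)) : {mpoly K[l]} :=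
  \sum_(j < l) form i 0 j *: 'X_j.

(* The row t is the derivation \sum_j t_j d/dx_j of S. *)
Definition der_app (t : 'rV[{mpoly K[l]}]_l) (p : {mpoly K[l]}) :
    {mpoly K[l]} :=
  \sum_(j < l) t 0 j * p^`M(j).

Definition multiplicity (m : 'I_(nhyp A) -> nat) : Prop :=
  forall i, (0 < m i)%N.

Context (m : 'I_(nhyp A) -> nat).

Definition Der (B : {set 'I_(nhyp A)}) : subquot 'rV[{mpoly K[l]}]_l :=
  Subquot (fun t => forall i, i \in B ->
             exists q : {mpoly K[l]}, der_app t (formp i) = q * formp i ^+ m i)
          (fun t => t = 0).

Fixpoint carr (k : nat) : lmodType S :=
  if k is k'.+1 then {ffun flat -> carr k'} else 'rV[S]_l.

(* The partial derivatives have degree 0. *)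
Fixpoint cdeg (k : nat) (d : nat) : carr k -> Prop :=
  match k return carr k -> Prop with
  | 0 => fun t : 'rV[S]_l => forall j, (t 0 j : {mpoly K[l]}) \is d.-homog
  | k'.+1 => fun f : {ffun flat -> carr k'} => forall X, cdeg d (f X)
  end.

(* phi_k(Y) : D_k(B) -> D_k(B_Y) *)
Definition phi (k : nat) (Y : flat) : carr k -> carr k :=
  match k return carr k -> carr k with
  | 0 => id
  | k'.+1 => fun f : {ffun flat -> carr k'} =>
               [ffun X => if flat_le X Y then f X else 0]
  end.

(* tau_k : D_k(B) -> \bigoplus_{Y in L_k(B)} D_k(B_Y) *)
Definition tau (k : nat) (B : {set 'I_(nhyp A)}) (x : carr k) : carr k.+1 :=
  [ffun Y => if Y \in flats B k then phi Y x else 0].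

Fixpoint Dmod (k : nat) (B : {set 'I_(nhyp A)}) : subquot (carr k) :=
  match k return subquot (carr k) with
  | 0 => Der B
  | k'.+1 => sq_coker (Dmod k' B)
               (sq_sum (flats B k') (fun X => Dmod k' (loc B X)))
               (@tau k' B)
  end.

Definition Dcx (k : nat) : subquot (carr k.+1) :=
  sq_sum (flats setT k) (fun X => Dmod k (loc setT X)).

(* D^k -> D_{k+1}(A, m) -> D^{k+1}, the first map being the identity on
   representatives. *)
Definition dcx (k : nat) : carr k.+1 -> carr k.+2 := @tau k.+1 setT.

Definition Scx (k : nat) : subquot (carr k.+1) :=
  sq_ext0 (@cdeg k.+1) (Dcx k).

(* S^k -> D^k sends p (x) x to p x, hence is the identity on
   representatives. *)
Definition Jcx (k : nat) : subquot (carr k.+1) :=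
  sq_ker (Scx k) (Dcx k) id.

Definition H2J : subquot (carr 3) :=
  sq_homology (Jcx 1) (Jcx 2) (Jcx 3) (@dcx 1) (@dcx 2).

Definition free_multi : Prop := sq_free (Der setT).

(* J(H) is the ideal <alpha_H^m(H)> inside the S-module S; its generator [H]
   is the element alpha_H^m(H). *)
Definition Jid (i : 'I_(nhyp A)) : @subquot S S^o :=
  Subquot (W := S^o)
    (fun g : S => exists q : S, g = q * formp i ^+ m i)
    (fun g : S => g = 0).

Definition hcarr : lmodType S := {ffun 'I_(nhyp A) -> S^o}.
Definition xcarr : lmodType S := {ffun flat -> hcarr}.

Definition JH : subquot hcarr := sq_sum setT Jid.

Definition JXH : subquot xcarr := sq_sum L2trip (fun X => sq_sum (loc setT X) Jid).

Definition xdeg (d : nat) (f : xcarr) : Prop :=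
  forall (X : flat) (i : 'I_(nhyp A)),
    (((f : {ffun flat -> hcarr}) X : {ffun 'I_(nhyp A) -> S^o}) i
       : {mpoly K[l]}) \is d.-homog.

(* The element of the direct sum whose component in the copy of J(H_i)
   indexed by (X, H_i) is g; thus [X, H_i] = inXH X i (alpha_i^m(i)). *)
Definition inXH (X : flat) (i : 'I_(nhyp A)) (g : S) : xcarr :=
  [ffun Y => [ffun j => if (Y == X) && (j == i) then (g : S^o) else 0] : hcarr].

Definition iota_J (g : hcarr) : xcarr :=
  \sum_(X in L2trip) \sum_(i in loc setT X)
     inXH X i ((g : {ffun 'I_(nhyp A) -> S^o}) i).

(* (theta(alpha_i) / alpha_i^m(i)) [X, H_i] = inXH X i (theta(alpha_i)) *)
Definition psi (X : flat) (t : 'rV[S]_l) : xcarr :=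
  \sum_(i in loc setT X) inXH X i (der_app t (formp i)).

Definition DX : subquot ({ffun flat -> 'rV[S]_l} : lmodType S) :=
  sq_sum L2trip (fun X => Der (loc setT X)).

Definition coker_iota : subquot xcarr := sq_coker JH JXH iota_J.

(* As a map into coker_iota, this is the sum of the \overline{psi_X}. *)
Definition sum_psi (t : {ffun flat -> 'rV[S]_l}) : xcarr :=
  \sum_(X in L2trip) psi X (t X).

Definition coker_psi : subquot xcarr := sq_coker DX coker_iota sum_psi.

End Arrangement.

Section Invariants.
Context {K : fieldType} {l : nat}.

(* S^k(A) does not depend on the multiplicity; it is computed here with the
   constant multiplicity 1. *)
Definition TF2 (A : arrangement K l) : Prop :=
  totally_formal A
  /\ forall k, (2 < k)%N -> sq_zero (Scx (fun _ : 'I_(nhyp A) => 1%N) k).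

Definition totally_nonfree (A : arrangement K l) : Prop :=
  forall m : 'I_(nhyp A) -> nat, multiplicity m -> ~ free_multi m.

Definition lattice_iso (A A' : arrangement K l) : Prop :=
  exists f : flat A -> flat A',
    bijective f /\ forall X Y, flat_le (f X) (f Y) = flat_le X Y.

(* Homogeneous elements of degree d in \bigoplus_j S(- e_j). *)
Definition shift_deg (n : nat) (e : 'I_n -> nat) (d : nat)
    (x : 'rV[{mpoly K[l]}]_n) : Prop :=
  forall j, if (e j <= d)%N then x 0 j \is (d - e j).-homog else x 0 j == 0.

End Invariants.

(* Main.v *)
Require Import Defs.
From mathcomp Require Import all_boot all_order all_algebra.
From mathcomp Require Import mpoly ring zify perm.
From Stdlib Require Import ClassicalEpsilon.
Local Open Scope nat_scope.

(** The complex S of a TF2 arrangement vanishes above degree two and is exact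
    in positive degrees.  In concrete terms, the linear relations between the
    forms of the hyperplanes have a basis consisting of relations between the
    forms through single triple flats ([TF2_triple_formal],
    [TF2_row_free]).  That the local relations span is 2-formality.  That they
    are independent means R_3(A) = 0: by 3-formality this can be checked at
    the flats of rank three, where it is dual to the vanishing of S^3
    ([R3_local_zero]).  Comparing dimensions, the sum over the triple flats of
    |A_X| - 2 equals |A| - r, which makes the two inequalities equivalent.

    Irreducibility enters through 2-formality: a set of hyperplanes not met
    properly by any triple flat splits off as a factor
    ([irreducible_block]).  So A is essential, every hyperplane lies on a
    triple flat, and kappa > 0.  Choosing a triple flat through each hyperplane
    gives coordinates on the cokernel of iota ([coker_iota_iso]).  An element
    of J^2 is a family of vector fields which near each triple flat agrees with
    one vector field up to elements of the ideals J(H); the difference is an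
    element of the sum of the J(H), well defined up to the image of D(A_X), and
    this identifies H^2(J) with the cokernel of the sum of the psi_X
    ([H2J_iso]).

    Freeness is equivalent to surjectivity for the following reasons.

    If D(A, m) is free, then prescribed values on the forms modulo their powers
    are attained by a global vector field as soon as they are near every
    codimension two intersection ([free_gluing]).  Multiplication by Q times
    the inverse of the matrix of a basis turns this into a Chinese remainder
    theorem for polynomials ([crt_codim2]), which rests on the fact that a
    linear form is regular modulo an ideal all of whose generators are constant
    along a vector where the form does not vanish ([lf_regular]).  Gluing
    constants proves 2-formality again, so by the dimension count the relations
    are independent, and surjectivity follows ([free_psi_onto]).

    Conversely, by formality D(A, m) is the kernel of the map from the sum of
    the D(A_X) to the cokernel of iota.  Modulo the derivations that kill the
    forms through X, each D(A_X) has a homogeneous basis with two elements,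
    constructed by raising the multiplicities one by one
    ([rank2_basis_exists]).  A surjective graded map between free modules has a
    maximal minor which is a nonzero constant, so its kernel is free
    ([graded_kernel_free], [psi_onto_free]).

    As for total non-freeness, surjectivity at the origin requires that the
    number of pairs (X, H) be at most |A| plus the number of triple flats: as
    |A_X| is at least 3, the leading constants of the derivations in D(A_X)
    span at most a line ([minor_cst], [psi_onto_bound]).  Freeness implies
    surjectivity for every essential arrangement with the dimension count
    above, and that is a property of the lattice ([nonfree_count]). *)

Section Multiarrangements.
Set Implicit Arguments.
Unset Strict Implicit.
Import GRing.Theory.
Local Open Scope ring_scope.

(** * Linear forms, divisibility and vector fields *)

Section LinearForms.

Context {K : fieldType} {l : nat}.
Notation S := {mpoly K[l]}.

Lemma choice_fun (T U : Type) (P : T -> U -> Prop) :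
  (forall x, exists y, P x y) -> exists f, forall x, P x (f x).
Proof.
move=> H; exists (fun x => proj1_sig (constructive_indefinite_description _ (H x))) => x.
exact: proj2_sig.
Qed.

Lemma choice_on (T U : Type) (D : T -> bool) (u0 : U) (P : T -> U -> Prop) :
  (forall x, D x -> exists y, P x y) -> exists f, forall x, D x -> P x (f x).
Proof.
move=> H; apply: (choice_fun (P := fun x y => D x -> P x y)) => x; have [/H[y Hy]|_] := boolP (D x).
  by exists y.
by exists u0.
Qed.

Definition lf (a : 'rV[K]_l) : S := \sum_(j < l) a 0 j *: 'X_j.

Definition pdvd (d p : S) : Prop := exists q : S, p = q * d.

Lemma pdvd0 d : pdvd d 0. Proof. by exists 0; rewrite mul0r. Qed.
Lemma pdvdD d p q : pdvd d p -> pdvd d q -> pdvd d (p + q).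
Proof. by move=> [a ->] [b ->]; exists (a + b); rewrite mulrDl. Qed.
Lemma pdvdM d p q : pdvd d q -> pdvd d (p * q).
Proof. by move=> [a ->]; exists (p * a); rewrite mulrA. Qed.
Lemma pdvdN d p : pdvd d p -> pdvd d (- p).
Proof. by move=> [a ->]; exists (- a); rewrite mulNr. Qed.
Lemma pdvdB d p q : pdvd d p -> pdvd d q -> pdvd d (p - q).
Proof. by move=> Hp Hq; apply: pdvdD => //; apply: pdvdN. Qed.
Lemma pdvdZ d c p : pdvd d p -> pdvd d (c *: p).
Proof. by move=> H; rewrite -mul_mpolyC; apply: pdvdM. Qed.
Lemma pdvd_sum d (I : Type) (r : seq I) (P : pred I) (F : I -> S) :
  (forall i, P i -> pdvd d (F i)) -> pdvd d (\sum_(i <- r | P i) F i).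
Proof. by move=> H; apply: big_ind => //; [apply: pdvd0 | apply: pdvdD]. Qed.

Lemma lfD a b : lf (a + b) = lf a + lf b.
Proof. by rewrite /lf -big_split; apply: eq_bigr => j _; rewrite mxE scalerDl. Qed.
Lemma lfZ c a : lf (c *: a) = c *: lf a.
Proof. by rewrite /lf scaler_sumr; apply: eq_bigr => j _; rewrite mxE scalerA. Qed.
Lemma lfB a b : lf (a - b) = lf a - lf b.
Proof. by rewrite -scaleN1r lfD lfZ scaleN1r. Qed.

Lemma lf_homog a : lf a \is 1.-homog.
Proof. by apply: rpred_sum => j _; apply: rpredZ; rewrite dhomogX; apply/eqP; apply: mdeg1. Qed.

Lemma lfX_homog a n : lf a ^+ n \is n.-homog.
Proof.
elim: n => [|n IH]; first by rewrite expr0 dhomog1.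
by rewrite exprS -add1n; apply: dhomogM IH; apply: lf_homog.
Qed.

Lemma coef_lf a j : (lf a)@_U_(j) = a 0 j.
Proof.
rewrite /lf raddf_sum (bigD1 j) //= mcoeffZ mcoeffX eqxx mulr1 big1 ?addr0 //.
by move=> k nkj; rewrite mcoeffZ mcoeffX eq_mnm1 (negbTE nkj) mulr0.
Qed.

Lemma lf_eq0 a : lf a = 0 -> a = 0.
Proof. by move=> H; apply/rowP => j; rewrite -coef_lf H mcoeff0 mxE. Qed.

(** For b(w) = 1 this is the composition with the projection along w onto the
    hyperplane b = 0.  It is a ring morphism to a domain whose kernel is the
    ideal of b, which makes divisibility by b testable and shows that b is
    prime. *)
Definition shear (w : 'cV[K]_l) (b : 'rV[K]_l) (p : S) : S :=
  p \mPo [tuple 'X_j - w j 0 *: lf b | j < l].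

Lemma shearD w b p q : shear w b (p + q) = shear w b p + shear w b q.
Proof. exact: comp_mpolyD. Qed.
Lemma shearM w b p q : shear w b (p * q) = shear w b p * shear w b q.
Proof. exact: rmorphM. Qed.
Lemma shearX w b p n : shear w b (p ^+ n) = shear w b p ^+ n.
Proof. exact: rmorphXn. Qed.
Lemma shear_prod w b (I : Type) (r : seq I) (P : pred I) (F : I -> S) :
  shear w b (\prod_(i <- r | P i) F i) = \prod_(i <- r | P i) shear w b (F i).
Proof. exact: rmorph_prod. Qed.

Lemma shear_lf w b a : shear w b (lf a) = lf a - (a *m w) 0 0 *: lf b.
Proof.
rewrite /shear /lf raddf_sum /= mxE scaler_suml -sumrB.
apply: eq_bigr => j _; rewrite comp_mpolyZ comp_mpolyXU -tnth_nth tnth_mktuple.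
by rewrite scalerBr scalerA.
Qed.

Lemma shear_cong w b p : pdvd (lf b) (p - shear w b p).
Proof.
have HM p1 p2 : pdvd (lf b) (p1 - shear w b p1) ->
    pdvd (lf b) (p2 - shear w b p2) ->
    pdvd (lf b) (p1 * p2 - shear w b (p1 * p2)).
  move=> H1 H2; rewrite shearM.
  have -> : p1 * p2 - shear w b p1 * shear w b p2 =
     p1 * (p2 - shear w b p2) + shear w b p2 * (p1 - shear w b p1) by ring.
  by apply: pdvdD; apply: pdvdM.
have H1 : pdvd (lf b) (1 - shear w b 1).
  by rewrite /shear comp_mpoly1 subrr; apply: pdvd0.
elim/mpolyind: p => [|c mu p _ _ IH].
  by rewrite /shear comp_mpoly0 subrr; apply: pdvd0.
rewrite shearD opprD addrACA; apply: pdvdD; last exact: IH.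
rewrite /shear comp_mpolyZ -scalerBr; apply: pdvdZ.
rewrite -/(shear w b _) mpolyXE_id.
apply: (big_ind (fun p => pdvd (lf b) (p - shear w b p))); [exact: H1 | exact: HM | move=> j _].
elim: (mu j) => [|n IHn]; first by rewrite expr0.
rewrite exprS; apply: HM; last exact: IHn.
rewrite /shear comp_mpolyXU -tnth_nth tnth_mktuple opprB addrC subrK.
by apply: pdvdZ; exists 1; rewrite mul1r.
Qed.

Lemma shear_self w b : (b *m w) 0 0 = 1 -> shear w b (lf b) = 0.
Proof. by move=> H; rewrite shear_lf H scale1r subrr. Qed.

Lemma pdvd_shear w b p : (b *m w) 0 0 = 1 -> pdvd (lf b) p <-> shear w b p = 0.
Proof.
move=> H; split=> [[q ->]|H0]; first by rewrite shearM shear_self // mulr0.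
by rewrite -[p]subr0 -H0; apply: shear_cong.
Qed.

Lemma dual_vector (b : 'rV[K]_l) : b != 0 -> exists w : 'cV[K]_l, (b *m w) 0 0 = 1.
Proof.
case/rV0Pn => j nz; exists ((b 0 j)^-1 *: delta_mx j 0).
rewrite mxE (bigD1 j) //= !mxE !eqxx mulr1 mulfV // big1 ?addr0 // => k nkj.
by rewrite !mxE (negbTE nkj) mulr0 mulr0.
Qed.

Lemma lf_prime b p q : b != 0 ->
  pdvd (lf b) (p * q) -> pdvd (lf b) p \/ pdvd (lf b) q.
Proof.
move=> /dual_vector [w Hw]; rewrite !(pdvd_shear _ Hw) shearM => /eqP.
by rewrite mulf_eq0 => /orP[] /eqP ->; [left|right].
Qed.

Lemma lf_dvd_lf a b : b != 0 -> pdvd (lf b) (lf a) -> exists c, a = c *: b.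
Proof.
move=> /dual_vector [w Hw]; rewrite (pdvd_shear _ Hw) shear_lf -lfZ -lfB.
by move/lf_eq0/subr0_eq => H; exists ((a *m w) 0 0).
Qed.

Lemma lfX_coprime b n p q : b != 0 -> ~ pdvd (lf b) p ->
  pdvd (lf b ^+ n) (p * q) -> pdvd (lf b ^+ n) q.
Proof.
move=> nb np; elim: n q => [|n IH] q; first by exists q; rewrite expr0 mulr1.
move=> [r E].
have Hq : pdvd (lf b) q.
  have : pdvd (lf b) (p * q) by rewrite E exprSr mulrA; exists (r * lf b ^+ n).
  by case/(lf_prime nb).
case: Hq E => q' ->; rewrite exprSr !mulrA => /mulIf E.
have {}E : p * q' = r * lf b ^+ n.
  by apply: E; apply/eqP => /lf_eq0 /eqP; apply/negP.
by have [s ->] := IH q' (ex_intro _ r E); exists s; rewrite mulrA.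
Qed.

Lemma prodX_coprime (I : finType) (a : I -> 'rV[K]_l) (n : I -> nat)
    (P : pred I) b : b != 0 ->
  (forall i, P i -> ~ pdvd (lf b) (lf (a i))) ->
  ~ pdvd (lf b) (\prod_(i | P i) lf (a i) ^+ n i).
Proof.
move=> nb H; have [w Hw] := dual_vector nb.
rewrite (pdvd_shear _ Hw) shear_prod => /eqP; rewrite prodf_seq_eq0.
case/hasP => i _ /andP[Pi]; rewrite shearX expf_eq0 => /andP[_ /eqP].
by rewrite -pdvd_shear //; apply: H.
Qed.

(** Pairwise non-proportional linear forms are non-associated primes. *)
Lemma prodX_dvd (I : finType) (a : I -> 'rV[K]_l) (n : I -> nat)
    (P : pred I) p :
  (forall i, a i != 0) -> (forall i j, pdvd (lf (a i)) (lf (a j)) -> i = j) ->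
  (forall i, P i -> pdvd (lf (a i) ^+ n i) p) ->
  pdvd (\prod_(i | P i) lf (a i) ^+ n i) p.
Proof.
move=> nz inj H.
have: forall s : seq I, uniq s -> pdvd (\prod_(i <- s | P i) lf (a i) ^+ n i) p.
  elim=> [_|i s IH /= /andP[nis us]]; first by rewrite big_nil; exists p; rewrite mulr1.
  rewrite big_cons; case: ifP => [Pi|_]; last exact: IH.
  have [q Eq] := IH us; case: (H i Pi) => r Er.
  have : pdvd (lf (a i) ^+ n i) q.
    apply: (@lfX_coprime _ _ (\prod_(i <- s | P i) lf (a i) ^+ n i)) => //;
      last by rewrite mulrC -Eq; exists r.
    have [w Hw] := dual_vector (nz i).
    rewrite (pdvd_shear _ Hw) shear_prod => /eqP; rewrite prodf_seq_eq0.
    case/hasP => j js /andP[Pj]; rewrite shearX expf_eq0 => /andP[_ /eqP].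
    by rewrite -pdvd_shear // => /inj Eij; rewrite Eij js in nis.
  by case=> t Et; exists t; rewrite Eq Et mulrA.
by move/(_ (index_enum I) (index_enum_uniq I)).
Qed.

(** The projection along w fixes the ideal (P, Q) and kills b; subtracting the
    projected equation, b u lies in b (P, Q). *)
Lemma lf_regular w b P Q u : (b *m w) 0 0 = 1 ->
  shear w b P = P -> shear w b Q = Q ->
  (exists x y, lf b * u = x * P + y * Q) -> exists x y, u = x * P + y * Q.
Proof.
move=> Hw EP EQ [x [y E]].
have [x' Ex] := shear_cong w b x; have [y' Ey] := shear_cong w b y.
exists x', y'; have nb : lf b != 0.
  apply/eqP => /lf_eq0 b0; move: Hw; rewrite b0 mul0mx mxE => /eqP.
  by rewrite eq_sym oner_eq0.
apply: (mulfI nb); rewrite E.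
have := congr1 (shear w b) E; rewrite !(shearM, shearD) shear_self // mul0r EP EQ.
move=> E0; have -> : x * P + y * Q = (x - shear w b x) * P + (y - shear w b y) * Q.
  by rewrite !mulrBl addrACA -opprD -E0 subr0.
by rewrite Ex Ey; ring.
Qed.

Lemma lf_fixed w b a : (a *m w) 0 0 = 0 -> shear w b (lf a) = lf a.
Proof. by move=> H; rewrite shear_lf H scale0r subr0. Qed.

(** The value on the form a of the derivation with coefficients t; unlike in
    [der_app], the linearity in the form is visible here. *)
Definition ev (a : 'rV[K]_l) (t : 'rV[S]_l) : S := \sum_(j < l) a 0 j *: t 0 j.

Lemma evDl a b t : ev (a + b) t = ev a t + ev b t.
Proof. by rewrite /ev -big_split; apply: eq_bigr => j _; rewrite mxE scalerDl. Qed.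
Lemma evZl c a t : ev (c *: a) t = c *: ev a t.
Proof. by rewrite /ev scaler_sumr; apply: eq_bigr => j _; rewrite mxE scalerA. Qed.
Lemma evD a s t : ev a (s + t) = ev a s + ev a t.
Proof. by rewrite /ev -big_split; apply: eq_bigr => j _; rewrite mxE scalerDr. Qed.
Lemma evZ a p t : ev a (p *: t) = p * ev a t.
Proof. by rewrite /ev mulr_sumr; apply: eq_bigr => j _; rewrite mxE scalerAr. Qed.
Lemma ev0 a : ev a 0 = 0.
Proof. by rewrite /ev big1 // => j _; rewrite mxE scaler0. Qed.
Lemma evN a t : ev a (- t) = - ev a t.
Proof. by rewrite -scaleN1r evZ mulN1r. Qed.
Lemma evB a s t : ev a (s - t) = ev a s - ev a t.
Proof. by rewrite evD evN. Qed.
Lemma ev_sum a (I : Type) (r : seq I) (P : pred I) (F : I -> 'rV[S]_l) :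
  ev a (\sum_(i <- r | P i) F i) = \sum_(i <- r | P i) ev a (F i).
Proof. exact: (big_morph (ev a) (evD a) (ev0 a)). Qed.
Lemma ev_suml t (I : Type) (r : seq I) (P : pred I) (F : I -> 'rV[K]_l) :
  ev (\sum_(i <- r | P i) F i) t = \sum_(i <- r | P i) ev (F i) t.
Proof.
apply: (big_morph (ev^~ t) (fun a b => evDl a b t)).
by rewrite /ev big1 // => j _; rewrite mxE scale0r.
Qed.

Lemma der_app_lf t a : der_app t (lf a) = ev a t.
Proof.
rewrite /der_app /ev; apply: eq_bigr => j _.
rewrite /lf raddf_sum (bigD1 j) //= mderivZ mderivX mnm1E eqxx /=.
rewrite big1 => [|k nkj].
  have -> : (U_(j) - U_(j) = 0)%MM by apply/mnmP => i; rewrite mnmBE subnn mnm0E.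
  by rewrite mpolyX0 scale1r addr0 -scalerAr mulr1.
by rewrite mderivZ mderivX mnm1E (negbTE nkj) scale0r scaler0.
Qed.

Definition vfield (w : 'cV[K]_l) (p : S) : 'rV[S]_l := \row_j (w j 0 *: p).

Lemma ev_vfield a w p : ev a (vfield w p) = (a *m w) 0 0 *: p.
Proof.
by rewrite /ev mxE scaler_suml; apply: eq_bigr => j _; rewrite mxE scalerA.
Qed.

Definition vcoef (mu : 'X_{1..l}) (t : 'rV[S]_l) : 'rV[S]_l :=
  \row_j ((t 0 j)@_mu)%:MP.

Lemma ev_vcoef a mu t : ev a (vcoef mu t) = ((ev a t)@_mu)%:MP.
Proof.
rewrite /ev raddf_sum raddf_sum; apply: eq_bigr => j _.
by rewrite mxE /= mcoeffZ mpolyCM mul_mpolyC.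
Qed.

Definition vhom (d : nat) (t : 'rV[S]_l) : 'rV[S]_l :=
  \row_j pihomog mdeg d (t 0 j).

Lemma ev_vhom a d t : ev a (vhom d t) = pihomog mdeg d (ev a t).
Proof.
rewrite /ev raddf_sum; apply: eq_bigr => j _.
by rewrite mxE /= linearZ.
Qed.

Lemma pihomogM d e (p h : S) : h \is e.-homog ->
  pihomog mdeg d (p * h) = if (e <= d)%N then pihomog mdeg (d - e) p * h else 0.
Proof.
move=> hh; pose k := maxn (mmeasure mdeg p) d.+1.
have Hk : (mmeasure mdeg p <= k)%N by apply: leq_maxl.
rewrite {1}(pihomog_partitionE Hk) mulr_suml raddf_sum /=.
have Hi (i : 'I_k) : pihomog mdeg d (pihomog mdeg i p * h) =
    if (i + e == d)%N then pihomog mdeg i p * h else 0.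
  have hm : pihomog mdeg i p * h \is (i + e).-homog by apply: dhomogM => //; apply: pihomogP.
  by case: eqP => [<-|/eqP ne]; [apply: pihomog_dE | apply: (pihomog_ne0 ne)].
rewrite (eq_bigr _ (fun i _ => Hi i)) -big_mkcond /=.
case: leqP => ed.
  have dk : (d - e < k)%N by apply: leq_ltn_trans (leq_subr _ _) _; apply: leq_maxr.
  rewrite (big_pred1 (Ordinal dk)) // => i /=.
  by rewrite -{1}(subnK ed) eqn_add2r.
by rewrite big_pred0 // => i; apply/negbTE; rewrite neq_ltn (leq_trans ed) ?orbT ?leq_addl.
Qed.

Lemma dhomog_quot d e (p h : S) : h \is e.-homog -> h != 0 -> p * h \is d.-homog ->
  if (e <= d)%N then p \is (d - e).-homog else p == 0.
Proof.
move=> hh nh /pihomog_dE; rewrite (pihomogM _ _ hh); case: leqP => _ E.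
  by rewrite -(mulIf nh E); apply: pihomogP.
by move: E => /esym/eqP; rewrite mulf_eq0 (negbTE nh) orbF.
Qed.

End LinearForms.

(** * Gluing derivations of a free multiarrangement *)

Section Gluing.

Context {K : fieldType} {l : nat} (A : arrangement K l).
Notation S := {mpoly K[l]}.
Notation I := (ordinal (nhyp A)).
Notation form := (@Defs.form K l A).
Notation hyp := (@Defs.hyp K l A).
Notation al i := (lf (form i)).

Lemma mem_hyp (i : I) v : (v \in hyp i) = (form i *m v == 0).
Proof. by rewrite /hyp /hyperplane memv_ker lfunE. Qed.

Lemma hyp_inj : injective (hyp).
Proof. exact: form_inj. Qed.

Lemma form_dual (i : I) : exists w : 'cV[K]_l, (form i *m w) 0 0 = 1.
Proof. exact/dual_vector/form_neq0. Qed.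

Lemma mx11_eq0 (M : 'M[K]_1) : (M == 0) = (M 0 0 == 0).
Proof.
by apply/eqP/eqP => [->|H]; [rewrite mxE | apply/matrixP => i j; rewrite !ord1 H mxE].
Qed.

Lemma scale_rowI n (p : S) (u v : 'rV[S]_n) : p != 0 -> p *: u = p *: v -> u = v.
Proof.
by move=> np /rowP E; apply/rowP => j; have := E j; rewrite !mxE => /(mulfI np).
Qed.

Lemma al_neq0 (i : I) : al i != 0.
Proof. by apply/eqP => /lf_eq0 /eqP; apply/negP/form_neq0. Qed.

Lemma alX_neq0 (i : I) n : al i ^+ n != 0.
Proof. by rewrite expf_neq0 // al_neq0. Qed.

Lemma form_colinear (i j : I) c : form j = c *: form i -> i = j.
Proof.
move=> E; have nc : c != 0.
  by apply/eqP => c0; move: (form_neq0 j); rewrite E c0 scale0r eqxx.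
apply: hyp_inj; apply/vspaceP => v; rewrite !mem_hyp E -scalemxAl scaler_eq0.
by rewrite (negbTE nc).
Qed.

Lemma al_dvd (i j : I) : pdvd (al i) (al j) -> i = j.
Proof.
by move=> /(lf_dvd_lf (form_neq0 _)) [c]; apply: form_colinear.
Qed.

Lemma dim_hyp (i : I) : (\dim (hyp i)).+1 = l.
Proof.
have [w Hw] := form_dual i.
have := limg_ker_dim (linfun (mulmx (form i) : 'cV[K]_l -> 'M[K]_1)) fullv.
rewrite capfv -/(hyperplane (form i)) -/(hyp i) dimvf /dim /= muln1 => H.
suff E : \dim (limg (linfun (mulmx (form i) : 'cV[K]_l -> 'M[K]_1))) = 1%N.
  by rewrite E addn1 in H.
apply/eqP; rewrite eqn_leq; apply/andP; split.
  by apply: leq_trans (dimvS (subvf _)) _; rewrite dimvf.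
rewrite lt0n dimv_eq0; apply/eqP => E0.
have : linfun (mulmx (form i) : 'cV[K]_l -> 'M[K]_1) w \in (0%VS : {vspace 'M[K]_1}).
  by rewrite -E0 memv_img // memvf.
by rewrite memv0 lfunE /= mx11_eq0 Hw oner_eq0.
Qed.

Lemma dim_hyp2 (i j : I) : i != j -> (\dim (hyp i :&: hyp j)).+2 = l.
Proof.
move=> nij; have := dimv_sum_cap (hyp i) (hyp j).
have [Hi Hj] := (dim_hyp i, dim_hyp j).
have E : \dim (hyp i + hyp j) = l.
  apply/eqP; rewrite eqn_leq; apply/andP; split.
    by apply: leq_trans (dimvS (subvf _)) _; rewrite dimvf /dim /= muln1.
  rewrite -{1}Hi ltn_neqAle dimvS ?addvSl // andbT.
  apply/negP => /eqP E; case/negP: nij; apply/eqP/hyp_inj/esym/eqP.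
  rewrite eqEdim; apply/andP; split; last by rewrite -ltnS Hi Hj.
  have /eqP -> : hyp i == (hyp i + hyp j)%VS by rewrite eqEdim addvSl E leqnn.
  exact: addvSr.
by rewrite E; lia.
Qed.

Context (m : I -> nat).

Lemma al_prodX_dvd (P : pred I) p :
  (forall i, P i -> pdvd (al i ^+ m i) p) -> pdvd (\prod_(i | P i) al i ^+ m i) p.
Proof.
by apply: prodX_dvd => [i | i j]; [apply: form_neq0 | apply: al_dvd].
Qed.

(** A Chinese remainder theorem in codimension two.  The hyperplanes are added
    one by one.  The new form a has to satisfy D in (P, a^m), where P is the
    product of the old powers and D the error to be corrected.  Group the old
    hyperplanes by their intersection v with ker a: for each group the local
    solution gives D in (P_v, a^m), and the forms of the other groups are
    regular modulo (P_v, a^m), because some vector of v is not killed by them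
    but is killed by a and the forms of the group. *)
Lemma crt_codim2 (F : I -> S) :
  (forall i j, i != j -> exists G, forall k, (hyp i :&: hyp j <= hyp k)%VS ->
     pdvd (al k ^+ m k) (G - F k)) ->
  exists G, forall k, pdvd (al k ^+ m k) (G - F k).
Proof.
move=> Hloc.
suff: forall s : seq I, uniq s ->
    exists G, forall k, k \in s -> pdvd (al k ^+ m k) (G - F k).
  case/(_ (enum I) (enum_uniq I)) => G HG; exists G => k.
  by apply: HG; rewrite mem_enum.
elim=> [_|i s IHs /= /andP[nis us]]; first by exists 0.
have [G0 HG0] := IHs us; pose D := F i - G0; pose f j := (hyp i :&: hyp j)%VS.
suff [x [y E]] : exists x y, D = x * \prod_(j | j \in s) al j ^+ m j + y * al i ^+ m i.
  exists (G0 + x * \prod_(j | j \in s) al j ^+ m j) => k.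
  rewrite inE => /predU1P[->|ks].
    exists (- y); rewrite mulNr -[RHS]addr0 -(subrr D) {1}E /D; ring.
  rewrite addrAC; apply: pdvdD; first exact: HG0.
  rewrite (bigD1 k) //=; exists (x * \prod_(j | (j \in s) && (j != k)) al j ^+ m j).
  by ring.
have Hin (vs : seq {vspace 'cV[K]_l}) : uniq vs -> exists x y,
    D = x * \prod_(j | (j \in s) && (f j \in vs)) al j ^+ m j + y * al i ^+ m i.
  elim: vs => [_|v vs IH /= /andP[nv uvs]].
    by exists D, 0; rewrite big_pred0 ?mulr1 ?mul0r ?addr0 // => j; rewrite andbF.
  have [x [y E]] := IH uvs.
  have [/existsP[j0 /andP[j0s /eqP fj0]]|] :=
      boolP [exists j, (j \in s) && (f j == v)]; last first.
    move/existsPn => none; exists x, y; rewrite E; congr (_ * _ + _).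
    apply: eq_bigl => j; rewrite inE; have := none j.
    by case: (j \in s) => //= /negbTE ->.
  pose Pv := \prod_(j | (j \in s) && (f j == v)) al j ^+ m j.
  have nij j : j \in s -> i != j by move=> js; apply: contraNneq nis => ->.
  have [x' [y' E']] : exists x' y', D = x' * Pv + y' * al i ^+ m i.
    have [G HG] := Hloc i j0 (nij _ j0s).
    have [a Ea] : pdvd (al i ^+ m i) (G - F i) by apply/HG/capvSl.
    have [b Eb] : pdvd Pv (G - G0).
      apply: al_prodX_dvd => j /andP[js /eqP fj].
      have -> : G - G0 = (G - F j) - (G0 - F j) by ring.
      apply: pdvdB; last exact: HG0.
      by apply: HG; rewrite -/(f j0) fj0 -fj capvSr.
    by exists b, (- a); rewrite mulNr -Ea -Eb /D; ring.
  (* The product of the other groups is regular modulo (Pv, a^m): cancel its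
     linear factors one at a time. *)
  have [a [b Ex]] : exists a b, x = a * Pv + b * al i ^+ m i.
    have : exists a b,
        \prod_(j | (j \in s) && (f j \in vs)) al j ^+ m j * x = a * Pv + b * al i ^+ m i.
      by exists x', (y' - y); rewrite mulrBl addrA -E' E; ring.
    apply: (big_ind (fun p => forall u, (exists a b, p * u = a * Pv + b * al i ^+ m i) ->
        exists a b, u = a * Pv + b * al i ^+ m i)).
    - by move=> u; rewrite mul1r.
    - by move=> p q Hp Hq u; rewrite -mulrA => /Hp /Hq.
    move=> j /andP[js fjs].
    have [w wv Hw] : exists2 w, w \in v & (form j *m w) 0 0 = 1.
      have : ~~ (v <= hyp j)%VS.
        apply/negP => vj; case/negP: nv; suff -> : v = f j by [].
        have vi : (v <= hyp i)%VS by rewrite -fj0 capvSl.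
        apply/eqP; rewrite eqEdim {1}/f subv_cap vi vj /=.
        have := dim_hyp2 (nij _ js); have := dim_hyp2 (nij _ j0s).
        by rewrite -/(f j0) -/(f j) fj0; lia.
      case/subvPn => w wv; rewrite mem_hyp mx11_eq0 => nz.
      exists (((form j *m w) 0 0)^-1 *: w); first exact: memvZ.
      by rewrite -scalemxAr mxE mulVf.
    have fix_ k : (v <= hyp k)%VS -> shear w (form j) (al k ^+ m k) = al k ^+ m k.
      move=> vk; rewrite shearX lf_fixed //; apply/eqP.
      by rewrite -mx11_eq0 -mem_hyp; apply: (subvP vk).
    elim: (m j) => [|n IHn] u; first by rewrite expr0 mul1r.
    rewrite exprSr -mulrA => /IHn; apply: (lf_regular Hw).
      rewrite /Pv shear_prod; apply: eq_bigr => k /andP[_ /eqP fk].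
      by apply: fix_; rewrite -fk capvSr.
    by apply: fix_; rewrite -fj0 capvSl.
  exists a, (b * \prod_(j | (j \in s) && (f j \in vs)) al j ^+ m j + y).
  have -> : \prod_(j | (j \in s) && (f j \in v :: vs)) al j ^+ m j =
      Pv * \prod_(j | (j \in s) && (f j \in vs)) al j ^+ m j.
    rewrite (bigID (fun j => f j == v)) /=; congr (_ * _); apply: eq_bigl => j.
      by rewrite inE; case: eqP; rewrite ?andbT ?andbF.
    rewrite inE; case: eqP => [->|_]; last by rewrite andbT.
    by rewrite (negbTE nv) !andbF.
  by rewrite E Ex; ring.
(* The values of f on s exhaust the groups. *)
have [x [y E]] := Hin _ (undup_uniq [seq f j | j <- s]).
exists x, y; rewrite E; congr (_ * _ + _); apply: eq_bigl => j.
by rewrite mem_undup; case js: (j \in s) => //=; rewrite map_f.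
Qed.

(** If D(A, m) has a basis M, then NM = MN = Q for some N, where Q is the
    defining polynomial, and t |-> tN carries the derivations tangent to one
    hyperplane k into multiples of the power of its form.  So it turns the
    gluing problem for derivations into the one that [crt_codim2] solves for
    polynomials. *)
Lemma free_gluing (g : I -> S) : free_multi m ->
  (forall i j, i != j -> exists t, forall k, (hyp i :&: hyp j <= hyp k)%VS ->
     pdvd (al k ^+ m k) (ev (form k) t - g k)) ->
  exists t, forall k, pdvd (al k ^+ m k) (ev (form k) t - g k).
Proof.
move=> [n [b [bD bgen bfree]]] Hloc.
pose M : 'M[S]_(n, l) := \matrix_i b i.
have sumE (c : 'rV[S]_n) : \sum_i c 0 i *: b i = c *m M.
  by rewrite mulmx_sum_row; apply: eq_bigr => i _; rewrite rowK.
have gen x : (forall i, pdvd (al i ^+ m i) (ev (form i) x)) ->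
    exists c : 'rV_n, x = c *m M.
  move=> Hx; have /bgen[c] : sq_num (Der m setT) x.
    by move=> i _; have [q Hq] := Hx i; exists q; rewrite /formp der_app_lf.
  move=> /= /subr0_eq E; exists (\row_i c i); rewrite E -sumE.
  by apply: eq_bigr => i _; rewrite mxE.
have MD i (c : 'rV_n) : pdvd (al i ^+ m i) (ev (form i) (c *m M)).
  rewrite -sumE ev_sum; apply: pdvd_sum => k _; rewrite evZ; apply: pdvdM.
  by have [q Hq] := bD k i (in_setT i); exists q; rewrite -der_app_lf.
have free0 (c : 'rV_n) : c *m M = 0 -> c = 0.
  rewrite -sumE => E; apply/rowP => i; rewrite mxE.
  exact: (bfree (fun i => c 0 i) E).
pose Q : S := \prod_i al i ^+ m i.
pose Qc k : S := \prod_(i | i != k) al i ^+ m i.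
have QE k : Q = Qc k * al k ^+ m k by rewrite /Q (bigD1 k) //= mulrC.
have nzQc k : Qc k != 0 by apply/prodf_neq0 => i _; apply: alX_neq0.
(* Q times each partial derivative lies in D(A, m). *)
have [N NM] : exists N : 'M[S]_(l, n), N *m M = Q%:M.
  have H (j : 'I_l) : exists c : 'rV_n, row j Q%:M = c *m M.
    apply: gen => i; rewrite -scalemx1 linearZ /= row1 evZ mulrC; apply: pdvdM.
    by exists (Qc i); apply: QE.
  have [c Hc] := choice_fun H; exists (\matrix_j c j); apply/row_matrixP => j.
  by rewrite row_mul rowK -Hc.
have MN : M *m N = Q%:M.
  apply/eqP; rewrite -subr_eq0; apply/eqP/row_matrixP => i; rewrite row0; apply: free0.
  by rewrite -row_mul mulmxBl -mulmxA NM -scalar_mxC subrr row0.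
have divN k (t : 'rV[S]_l) : pdvd (al k ^+ m k) (ev (form k) t) ->
    exists s : 'rV_n, t *m N = al k ^+ m k *: s.
  move=> Hk; have [s Es] : exists s : 'rV_n, Qc k *: t = s *m M.
    apply: gen => i; rewrite evZ; have [->|nik] := eqVneq i k; first exact: pdvdM.
    rewrite mulrC; apply: pdvdM; rewrite /Qc (bigD1 i) //= mulrC.
    by exists (\prod_(j | (j != k) && (j != i)) al j ^+ m j).
  exists s; apply: (scale_rowI (nzQc k)).
  by rewrite scalerA -QE scalemxAl Es -mulmxA MN mul_mx_scalar.
have [w Hw] := choice_fun form_dual.
pose eta k := vfield (w k) (g k).
have evE k : ev (form k) (eta k) = g k by rewrite ev_vfield Hw scale1r.
have HF (c : 'I_n) : exists F, forall k, pdvd (al k ^+ m k) (F - (eta k *m N) 0 c).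
  apply: crt_codim2 => i j nij; have [t Ht] := Hloc i j nij.
  exists ((t *m N) 0 c) => k /Ht; rewrite -evE -evB => /divN [s].
  rewrite mulmxBl => /rowP/(_ c); rewrite !mxE => ->.
  by exists (s 0 c); rewrite mulrC.
have [F0 HF0] := choice_fun HF; pose F : 'rV[S]_n := \row_c F0 c.
have HFk k : exists s : 'rV_n, F = eta k *m N + al k ^+ m k *: s.
  have [s Hs] := choice_fun (fun c => HF0 c k); exists (\row_c s c).
  apply/rowP => c; rewrite [LHS]mxE [RHS]mxE [X in _ = _ + X]mxE [X in _ = _ + _ * X]mxE.
  by rewrite mulrC -Hs addrC subrK.
have FM k s : F = eta k *m N + al k ^+ m k *: s ->
    F *m M = Q *: eta k + al k ^+ m k *: (s *m M).
  by move->; rewrite mulmxDl -mulmxA NM mul_mx_scalar scalemxAl.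
have [t Et] : exists t, F *m M = Q *: t.
  have Hj (j : 'I_l) : pdvd Q ((F *m M) 0 j).
    apply: al_prodX_dvd => k _; have [s /FM ->] := HFk k.
    rewrite mxE [X in X + _]mxE [X in _ + X]mxE (QE k).
    apply: pdvdD; first by exists (Qc k * eta k 0 j); ring.
    by exists ((s *m M) 0 j); rewrite mulrC.
  have [t Ht] := choice_fun Hj; exists (\row_j t j); apply/rowP => j.
  by rewrite Ht mulrC [RHS]mxE; congr (_ * _); rewrite mxE.
exists t => k; rewrite -evE -evB; have [s /FM] := HFk k; rewrite Et => E.
apply: (@lfX_coprime _ _ _ _ (Qc k)); first exact: form_neq0.
  apply: prodX_coprime => [|i nik]; first exact: form_neq0.
  by move/al_dvd => E'; rewrite E' eqxx in nik.
rewrite -evZ; suff -> : Qc k *: (t - eta k) = s *m M by apply: MD.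
apply: (scale_rowI (alX_neq0 k (m k))); rewrite scalerA mulrC -QE scalerBr E.
by rewrite addrAC subrr add0r.
Qed.

End Gluing.

(** * Triple flats and their linear relations *)

Section TripleRelations.

Context {K : fieldType} {l : nat} (A : arrangement K l).
Notation S := {mpoly K[l]}.
Notation I := (ordinal (nhyp A)).
Notation form := (@Defs.form K l A).
Notation hyp := (@Defs.hyp K l A).
Notation flat := (Defs.flat A).
Notation loc := (@Defs.loc K l A).
Notation trip := (L2trip A).

Lemma center_in (C : {set I}) :
  center C \in [seq center B | B <- enum {set 'I_(nhyp A)}].
Proof. by apply: map_f; rewrite mem_enum. Qed.

Definition flat_of (C : {set I}) : flat := SeqSub (center_in C).

Lemma val_flat_of C : val (flat_of C) = center C. Proof. by []. Qed.

Lemma flat_ofP (X : flat) : exists C, X = flat_of C.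
Proof. by have /mapP[C _ E] := valP X; exists C; apply: val_inj. Qed.

Lemma mem_loc B X (i : I) : (i \in loc B X) = (i \in B) && (val X <= hyp i)%VS.
Proof. by rewrite inE. Qed.

Lemma mem_locT X (i : I) : (i \in loc setT X) = (val X <= hyp i)%VS.
Proof. by rewrite mem_loc inE. Qed.

Lemma center_sub (C : {set I}) i : i \in C -> (center C <= hyp i)%VS.
Proof. by move=> iC; rewrite /center (bigD1 i) //= capvSl. Qed.

Lemma sub_center (C : {set I}) U :
  (forall i, i \in C -> (U <= hyp i)%VS) -> (U <= center C)%VS.
Proof. by move=> H; apply/subv_bigcapP. Qed.

Lemma mem_center (C : {set I}) v :
  reflect (forall i, i \in C -> form i *m v = 0) (v \in center C).
Proof.
apply: (iffP idP) => [vC i iC|H].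
  by apply/eqP; rewrite -mem_hyp; apply: (subvP (center_sub iC)).
rewrite memvE; apply: sub_center => i iC; rewrite -memvE mem_hyp.
by apply/eqP/H.
Qed.

Lemma mem_flatsT k (X : flat) : (X \in flats setT k) = (codim (val X) == k).
Proof.
rewrite inE; case: eqP => //= _; apply/existsP; have [C ->] := flat_ofP X.
by exists C; rewrite subsetT eqxx.
Qed.

Lemma mem_trip (X : flat) :
  (X \in trip) = (codim (val X) == 2%N) && (3 <= #|loc setT X|)%N.
Proof. by rewrite inE mem_flatsT. Qed.

Lemma dual_pair (i j : I) : i != j ->
  exists w : 'cV[K]_l, (form i *m w) 0 0 = 1 /\ (form j *m w) 0 0 = 0.
Proof.
move=> nij; have : ~~ (hyp j <= hyp i)%VS.
  apply: contraNN nij => sji; apply/eqP/(@hyp_inj K l A)/eqP; rewrite eq_sym eqEdim sji.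
  by rewrite -ltnS !dim_hyp leqnn.
case/subvPn => w; rewrite !mem_hyp !mx11_eq0 => /eqP wj nz.
exists (((form i *m w) 0 0)^-1 *: w); rewrite -!scalemxAr.
by split; rewrite mxE ?mulVf // wj mulr0.
Qed.

Lemma span_pair (i j k : I) (v w : 'cV[K]_l) :
  (form i *m v) 0 0 = 1 -> (form j *m v) 0 0 = 0 ->
  (form i *m w) 0 0 = 0 -> (form j *m w) 0 0 = 1 ->
  (hyp i :&: hyp j <= hyp k)%VS ->
  form k = (form k *m v) 0 0 *: form i + (form k *m w) 0 0 *: form j.
Proof.
move=> Eiv Ejv Eiw Ejw sk; apply/rowP => h; pose x : 'cV[K]_l := delta_mx h 0.
have Ev (a : 'rV[K]_l) : a 0 h = (a *m x) 0 0 :> K.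
  rewrite mxE (bigD1 h) //= big1 ?addr0 => [|n nhn]; first by rewrite mxE !eqxx mulr1.
  by rewrite mxE (negbTE nhn) mulr0.
pose u := x - (form i *m x) 0 0 *: v - (form j *m x) 0 0 *: w.
have EB a : (form a *m u) 0 0 = (form a *m x) 0 0
      - (form i *m x) 0 0 * (form a *m v) 0 0
      - (form j *m x) 0 0 * (form a *m w) 0 0.
  by rewrite /u !mulmxBr -!scalemxAr !mxE.
have : u \in hyp k.
  apply: (subvP sk); rewrite memv_cap !mem_hyp !mx11_eq0.
  by rewrite !EB Eiv Ejv Eiw Ejw !mulr1 !mulr0 subrr !subr0 subrr eqxx.
rewrite mem_hyp mx11_eq0 EB => /eqP E.
have -> (a b : K) (y z : 'rV[K]_l) : (a *: y + b *: z) 0 h = a * y 0 h + b * z 0 h.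
  by rewrite !mxE.
rewrite !Ev; apply/eqP; rewrite -subr_eq0; apply/eqP.
by rewrite -[RHS]E; ring.
Qed.

Lemma flat2_cap (X : flat) (i j : I) : codim (val X) = 2%N -> i != j ->
  i \in loc setT X -> j \in loc setT X -> val X = (hyp i :&: hyp j)%VS.
Proof.
rewrite !mem_locT /codim => cX nij Xi Xj; apply/eqP; rewrite eqEdim subv_cap Xi Xj /=.
have H a b : (l - a = 2 -> b.+2 = l -> b <= a)%N by lia.
exact: H cX (dim_hyp2 nij).
Qed.

Lemma cap_flat2 (i j : I) : i != j ->
  val (flat_of [set i; j]) = (hyp i :&: hyp j)%VS /\ codim (val (flat_of [set i; j])) = 2%N.
Proof.
move=> nij; have E : val (flat_of [set i; j]) = (hyp i :&: hyp j)%VS.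
  rewrite val_flat_of; apply/eqP; rewrite eqEsubv subv_cap !center_sub ?set21 ?set22 //=.
  by apply: sub_center => k; rewrite !inE => /orP[] /eqP ->; rewrite ?capvSl ?capvSr.
by split=> //; rewrite E /codim; have := dim_hyp2 nij; lia.
Qed.

(** Two different hyperplanes have independent forms. *)
Lemma small_flat_field (X : flat) (h : I -> S) : (#|loc setT X| <= 2)%N ->
  exists t, forall k, k \in loc setT X -> ev (form k) t = h k.
Proof.
move=> card2; have [E|[i iX]] := set_0Vmem (loc setT X).
  by exists 0 => k; rewrite E in_set0.
have [E|[j]] := set_0Vmem (loc setT X :\ i).
  have [w Hw] := form_dual i; exists (vfield w (h i)) => k kX.
  have [->|nk] := eqVneq k i; first by rewrite ev_vfield Hw scale1r.
  by have := in_set0 k; rewrite -E in_setD1 nk kX.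
rewrite in_setD1 => /andP[nji jX]; have [w [wj wi]] := dual_pair nji.
have [v [vi vj]] : exists v : 'cV[K]_l, (form i *m v) 0 0 = 1 /\ (form j *m v) 0 0 = 0.
  by apply: dual_pair; rewrite eq_sym.
exists (vfield v (h i) + vfield w (h j)) => k kX; rewrite evD !ev_vfield.
have [->|nki] := eqVneq k i; first by rewrite vi wi scale1r scale0r addr0.
have [->|nkj] := eqVneq k j; first by rewrite vj wj scale1r scale0r add0r.
move: card2; rewrite (cardsD1 i) iX (cardsD1 j) in_setD1 nji jX.
by rewrite (cardsD1 k) !in_setD1 nkj nki kX.
Qed.

(** A codimension two intersection which is not a triple flat lies on two
    hyperplanes only, where values can be prescribed. *)
Lemma local_trip (P : I -> S -> Prop) :
  (forall k, exists p, P k p) ->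
  (forall X, X \in trip -> exists t, forall k, k \in loc setT X -> P k (ev (form k) t)) ->
  forall i j : I, i != j ->
  exists t, forall k : I, (hyp i :&: hyp j <= hyp k)%VS -> P k (ev (form k) t).
Proof.
move=> HP Htrip i j nij; have [EX cX] := cap_flat2 nij.
have [/Htrip[t Ht]|] := boolP (flat_of [set i; j] \in trip).
  by exists t => k; rewrite -EX -mem_locT; apply: Ht.
rewrite mem_trip cX eqxx /= -leqNgt => card2.
have [h Ph] := choice_fun HP.
have [t Ht] := small_flat_field h card2; exists t => k.
by rewrite -EX -mem_locT => /Ht ->.
Qed.

Definition trip_pairs : {set flat * I} :=
  [set p | (p.1 \in trip) && (p.2 \in loc setT p.1)].

Lemma card_trip_pairs : #|trip_pairs| = (\sum_(X in trip) locn X)%N.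
Proof.
rewrite -sum1_card (partition_big (fun p : flat * I => p.1) (mem trip)) /=; last first.
  by move=> p; rewrite inE => /andP[].
apply: eq_bigr => X XT; rewrite /locn -sum1_card.
rewrite (reindex_onto (fun k => (X, k)) (fun p => p.2)) /=; last first.
  by move=> [Y k] /= /andP[_ /eqP ->].
by apply: eq_bigl => k; rewrite [_ \in trip_pairs]inE /= XT !eqxx !andbT.
Qed.

(** The cokernel of iota has a basis indexed by the pairs (X, k) other than
    the chosen ones (x0 k, k), one for each hyperplane k. *)
Definition coord_set (x0 : I -> flat) : {set flat * I} :=
  [set p in trip_pairs | p.1 != x0 p.2].

Definition form_mx : 'M[K]_(nhyp A, l) := \matrix_i form i.

Definition essential_arr := forall v : 'cV[K]_l, (forall i, form i *m v = 0) -> v = 0.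

Lemma essential_rank : essential_arr -> \rank form_mx = l.
Proof.
move=> ess; apply/eqP; rewrite -mxrank_tr -[_ == _]/(row_free _) -kermx_eq0.
apply/eqP/row_matrixP => j; rewrite row0; apply: trmx_inj; rewrite trmx0; apply: ess => i.
have : form_mx *m (row j (kermx form_mx^T))^T = 0.
  apply: trmx_inj; rewrite trmx_mul trmxK trmx0.
  by apply/sub_kermxP; apply: row_sub.
by move/(congr1 (row i)); rewrite row_mul rowK row0.
Qed.

(** The forms of b1 and b2 are a basis of the span of the forms through a
    triple flat, with dual vectors w1 and w2; the other hyperplanes through
    the flat then index a basis of the linear relations between its forms. *)
Definition is_frame (b1 b2 : flat -> I) (w1 w2 : flat -> 'cV[K]_l) : Prop :=
  forall X, X \in trip ->
    [/\ b1 X \in loc setT X, b2 X \in loc setT X,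
        (form (b1 X) *m w1 X) 0 0 = 1 /\ (form (b2 X) *m w1 X) 0 0 = 0
      & (form (b1 X) *m w2 X) 0 0 = 0 /\ (form (b2 X) *m w2 X) 0 0 = 1].

Lemma trip_frame (X : flat) : X \in trip -> exists (b1 b2 : I) (w1 w2 : 'cV[K]_l),
    [/\ b1 \in loc setT X, b2 \in loc setT X,
        (form b1 *m w1) 0 0 = 1 /\ (form b2 *m w1) 0 0 = 0
      & (form b1 *m w2) 0 0 = 0 /\ (form b2 *m w2) 0 0 = 1].
Proof.
rewrite mem_trip => /andP[_ c3].
have /card_gt1P[i [j [iX jX nij]]] : (1 < #|loc setT X|)%N by apply: ltnW.
have [w1 [? ?]] := dual_pair nij; rewrite eq_sym in nij.
by have [w2 [? ?]] := dual_pair nij; exists i, j, w1, w2.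
Qed.

Lemma frame_exists : (0 < nhyp A)%N ->
  exists (b1 b2 : flat -> I) (w1 w2 : flat -> 'cV[K]_l), is_frame b1 b2 w1 w2.
Proof.
move=> n0; pose i0 := Ordinal n0.
pose Q (X : flat) (q : (I * I) * ('cV[K]_l * 'cV[K]_l)) :=
  [/\ q.1.1 \in loc setT X, q.1.2 \in loc setT X,
      (form q.1.1 *m q.2.1) 0 0 = 1 /\ (form q.1.2 *m q.2.1) 0 0 = 0
    & (form q.1.1 *m q.2.2) 0 0 = 0 /\ (form q.1.2 *m q.2.2) 0 0 = 1].
have [X XT|q Hq] := @choice_on _ _ (mem trip) ((i0, i0), (0, 0)) Q.
  by have [b1 [b2 [w1 [w2 Hq]]]] := trip_frame XT; exists ((b1, b2), (w1, w2)).
by exists (fun X => (q X).1.1), (fun X => (q X).1.2), (fun X => (q X).2.1), (fun X => (q X).2.2).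
Qed.

Section Frame.
Context (b1 b2 : flat -> I) (w1 w2 : flat -> 'cV[K]_l) (Hb : is_frame b1 b2 w1 w2).
Notation c1 X k := ((form k *m w1 X) 0 0).
Notation c2 X k := ((form k *m w2 X) 0 0).

Lemma frame_neq X : X \in trip -> b1 X != b2 X.
Proof.
case/Hb => _ _ [E1 E2] _; apply/eqP => E; rewrite E E2 in E1.
by move/eqP: E1; rewrite eq_sym oner_eq0.
Qed.

Lemma frame_span X k : X \in trip -> k \in loc setT X ->
  form k = c1 X k *: form (b1 X) + c2 X k *: form (b2 X).
Proof.
move=> XT kX; have [b1X b2X [E11 E21] [E12 E22]] := Hb XT.
have cX : codim (val X) = 2%N by move: XT; rewrite mem_trip => /andP[/eqP].
apply: span_pair => //.
by rewrite -(flat2_cap cX (frame_neq XT) b1X b2X) -mem_locT.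
Qed.

(** Zero for the values of a linear function at the forms through X.  Numbers,
    polynomials and the forms themselves occur as values. *)
Definition frame_defect {V : lmodType K} (X : flat) (k : I) (g : I -> V) : V :=
  g k - c1 X k *: g (b1 X) - c2 X k *: g (b2 X).

Definition rel_index : {set flat * I} :=
  [set p | [&& p.1 \in trip, p.2 \in loc setT p.1, p.2 != b1 p.1 & p.2 != b2 p.1]].

Notation N := #|rel_index|.
Notation rX p := (enum_val p).1.
Notation rk p := (enum_val p).2.

Lemma card_rel_index : (N + 2 * #|trip| = \sum_(X in trip) locn X)%N.
Proof.
rewrite mulnC -sum_nat_const -sum1_card.
rewrite (partition_big (fun p : flat * I => p.1) (mem trip)) /=; last first.
  by move=> p; rewrite inE => /and4P[].
rewrite -big_split; apply: eq_bigr => X XT /=.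
have [b1X b2X _ _] := Hb XT.
rewrite /locn (cardsD1 (b1 X)) b1X (cardsD1 (b2 X)) in_setD1 b2X eq_sym (frame_neq XT) /=.
rewrite -sum1_card addn2 !add1n; congr _.+2.
rewrite (reindex_onto (fun k => (X, k)) (fun p => p.2)) /=; last first.
  by move=> [Y k] /= /andP[_ /eqP ->].
by apply: eq_bigl => k; rewrite !in_setD1 [_ \in rel_index]inE /= XT !eqxx !andbT;
  case: (k \in _); case: (k != b1 X); case: (k != b2 X).
Qed.

Definition relation_mx : 'M[K]_(N, nhyp A) := \matrix_(p, i)
  ((i == rk p)%:R - c1 (rX p) (rk p) *+ (i == b1 (rX p)) - c2 (rX p) (rk p) *+ (i == b2 (rX p))).

Lemma relation_mx_defect (V : lmodType K) (g : I -> V) (p : 'I_N) :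
  \sum_i relation_mx p i *: g i = frame_defect (rX p) (rk p) g.
Proof.
have sum_delta c (h : I) : \sum_i (c *+ (i == h)) *: g i = c *: g h.
  rewrite (bigD1 h) //= eqxx big1 ?addr0 // => i nih.
  by rewrite (negbTE nih) scale0r.
rewrite /frame_defect -[g (rk p)]scale1r -!sum_delta -!sumrB; apply: eq_bigr => i _.
by rewrite mxE !scalerBl.
Qed.

Lemma frame_defect_form X k : X \in trip -> k \in loc setT X -> frame_defect X k form = 0.
Proof. by move=> XT kX; rewrite /frame_defect {1}(frame_span XT kX) addrAC addrK subrr. Qed.

Lemma rel_indexP (p : 'I_N) : [/\ rX p \in trip, rk p \in loc setT (rX p), 
  rk p != b1 (rX p) & rk p != b2 (rX p)].
Proof. by apply/and4P; have := enum_valP p; rewrite inE. Qed.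

Lemma rel_sum (c : 'rV[K]_(nhyp A)) : c *m form_mx = \sum_i c 0 i *: form i.
Proof. by rewrite mulmx_sum_row; apply: eq_bigr => i _; rewrite rowK. Qed.

Lemma relation_mx_form_mx : relation_mx *m form_mx = 0.
Proof.
apply/row_matrixP => p; rewrite row_mul row0 rel_sum.
have [XT kX _ _] := rel_indexP p; rewrite -[RHS](frame_defect_form XT kX).
rewrite -(relation_mx_defect form); by apply: eq_bigr => i _; rewrite [row p relation_mx 0 i]mxE.
Qed.

Lemma frame_defect_ev X k t : X \in trip -> k \in loc setT X ->
  frame_defect X k (fun i => ev (form i) t) = 0.
Proof.
move=> XT kX; rewrite /frame_defect {1}(frame_span XT kX) evDl !evZl.
by rewrite addrAC addrK subrr.
Qed.

Lemma frame_defect0_eq (V : lmodType K) (X : flat) (g : I -> V) : X \in trip ->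
  (forall p : 'I_N, rX p = X -> frame_defect X (rk p) g = 0) ->
  forall k, k \in loc setT X -> g k = c1 X k *: g (b1 X) + c2 X k *: g (b2 X).
Proof.
move=> XT H k kX; have [_ _ [E11 E21] [E12 E22]] := Hb XT.
have [->|n1] := eqVneq k (b1 X); first by rewrite E11 E12 scale1r scale0r addr0.
have [->|n2] := eqVneq k (b2 X); first by rewrite E21 E22 scale1r scale0r add0r.
have pI : (X, k) \in rel_index by rewrite inE /= XT kX n1 n2.
have := H (enum_rank_in pI (X, k)); rewrite enum_rankK_in //= => /(_ erefl) /eqP.
by rewrite /frame_defect -addrA -opprD subr_eq0 => /eqP.
Qed.

Lemma frame_defect0_field (X : flat) (g : I -> S) : X \in trip ->
  (forall p : 'I_N, rX p = X -> frame_defect X (rk p) g = 0) ->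
  exists t, forall k, k \in loc setT X -> ev (form k) t = g k.
Proof.
move=> XT H; exists (vfield (w1 X) (g (b1 X)) + vfield (w2 X) (g (b2 X))) => k kX.
by rewrite evD !ev_vfield (frame_defect0_eq XT H kX).
Qed.

(** 2-formality: the row kernel of [form_mx] is the space of linear relations
    between the forms. *)
Definition triple_formal : Prop := (kermx form_mx <= relation_mx)%MS.

(** The dual form of 2-formality.  A left inverse [Psi] of [form_mx] yields v,
    because the rows of 1 minus their product are linear relations, hence
    combinations of relations that g satisfies. *)
Lemma formal_extend (V : lmodType K) (g : I -> V) :
  essential_arr -> triple_formal ->
  (forall p : 'I_N, frame_defect (rX p) (rk p) g = 0) ->
  exists v : 'I_l -> V, forall k, g k = \sum_j form k 0 j *: v j.
Proof.
move=> /essential_rank rank_form_mx formal Hg.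
have full : row_full form_mx by rewrite /row_full rank_form_mx.
pose Psi := pinvmx form_mx; have PsiPhi : Psi *m form_mx = 1%:M by apply: mulVpmx.
have /submxP[C EC] : (1%:M - form_mx *m Psi <= relation_mx)%MS.
  apply: submx_trans formal; apply/sub_kermxP.
  by rewrite mulmxBl mul1mx -mulmxA PsiPhi mulmx1 subrr.
exists (fun j => \sum_i Psi j i *: g i) => k; apply/eqP; rewrite -subr_eq0; apply/eqP.
under [X in _ - X]eq_bigr => j _ do rewrite scaler_sumr.
rewrite exchange_big /=.
have -> : g k = \sum_i (1%:M : 'M[K]_(nhyp A)) k i *: g i.
  rewrite (bigD1 k) //= mxE eqxx scale1r big1 ?addr0 // => i nik.
  by rewrite mxE eq_sym (negbTE nik) scale0r.
rewrite -sumrB.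
transitivity (\sum_i (C *m relation_mx) k i *: g i).
  rewrite -EC; apply: eq_bigr => i _.
  have -> : (1%:M - form_mx *m Psi) k i = (1%:M : 'M_(nhyp A)) k i - \sum_j form k 0 j * Psi j i.
    rewrite mxE [X in _ + X]mxE [(form_mx *m Psi) k i]mxE.
    by congr (_ - _); apply: eq_bigr => j _; rewrite mxE.
  rewrite scalerBl scaler_suml; congr (_ - _); apply: eq_bigr => j _.
  by rewrite scalerA.
under eq_bigr => i _ do rewrite mxE scaler_suml.
rewrite exchange_big big1 //= => p _.
under eq_bigr => i _ do rewrite -scalerA.
by rewrite -scaler_sumr relation_mx_defect Hg scaler0.
Qed.

(** The rows of [relation_mx] are then a basis of the space of linear
    relations. *)
Lemma formal_count : essential_arr -> triple_formal -> row_free relation_mx ->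
  (N + l = nhyp A)%N.
Proof.
move=> /essential_rank rank_form_mx formal free_.
have le_l : (l <= nhyp A)%N by have := rank_leq_row form_mx; rewrite rank_form_mx.
have E : (relation_mx :=: kermx form_mx)%MS.
  by apply/eqmxP; rewrite formal andbT; apply/sub_kermxP/relation_mx_form_mx.
move: free_; rewrite /row_free E mxrank_ker rank_form_mx => /eqP <-.
by rewrite subnK.
Qed.

(** The hypothesis puts the column kernel of [relation_mx] into the column space of
    [form_mx], which has dimension l; so the rank of [relation_mx] is at least the number
    of its rows. *)
Lemma extend_row_free : essential_arr -> (N + l = nhyp A)%N ->
  (forall g : I -> K^o, (forall p : 'I_N, frame_defect (rX p) (rk p) g = 0) ->
     exists v : 'cV[K]_l, forall k, g k = (form k *m v) 0 0) ->
  row_free relation_mx.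
Proof.
move=> ess count ext.
have sub : (kermx relation_mx^T <= form_mx^T)%MS.
  apply/row_subP => j; set c := row j _.
  have cR : c *m relation_mx^T = 0 by apply/sub_kermxP; apply: row_sub.
  have [p|v Ev] := ext (fun i => c 0 i).
    rewrite -relation_mx_defect; move/rowP/(_ p): cR; rewrite !mxE => E; rewrite -[RHS]E.
    by apply: eq_bigr => i _; rewrite [relation_mx^T _ _]mxE [RHS]mulrC.
  apply/submxP; exists v^T; rewrite -trmx_mul; apply: trmx_inj; rewrite trmxK.
  by apply/colP => k; rewrite mxE Ev [LHS]mxE [RHS]mxE; apply: eq_bigr => i _; rewrite mxE.
have := mxrankS sub; rewrite mxrank_ker !mxrank_tr (essential_rank ess).
rewrite /row_free => H; have := rank_leq_row relation_mx; move: H; lia.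
Qed.

(** A right inverse of [relation_mx] yields a function g with the same
    defects as z; then z_X - g satisfies the relations of X, so it is given by
    a vector field. *)
Lemma row_free_split (z : flat -> I -> S) : row_free relation_mx ->
  exists g : I -> S, forall X, X \in trip ->
    exists t, forall k, k \in loc setT X -> z X k = g k + ev (form k) t.
Proof.
move=> /row_freeP[Ri ERi].
pose g i := \sum_p Ri i p *: frame_defect (rX p) (rk p) (z (rX p)).
have Hg (p : 'I_N) : frame_defect (rX p) (rk p) g = frame_defect (rX p) (rk p) (z (rX p)).
  rewrite -relation_mx_defect /g; under eq_bigr => i _ do rewrite scaler_sumr.
  rewrite exchange_big (bigD1 p) //= [X in _ + X]big1 => [|q nqp].
    under eq_bigr => i _ do rewrite scalerA.
    rewrite -scaler_suml addr0; move/matrixP/(_ p p): ERi; rewrite !mxE eqxx => ->.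
    by rewrite scale1r.
  under eq_bigr => i _ do rewrite scalerA.
  rewrite -scaler_suml; move/matrixP/(_ p q): ERi.
  by rewrite !mxE eq_sym (negbTE nqp) => ->; rewrite scale0r.
exists g => X XT.
have [|t Ht] := @frame_defect0_field X (fun i => z X i - g i) XT.
  move=> p EX; have := Hg p; rewrite EX /frame_defect => E.
  by rewrite !scalerBr -[RHS](subrr (frame_defect X (rk p) g)) {1}/frame_defect E /frame_defect; ring.
by exists t => k kX; rewrite Ht // addrC subrK.
Qed.

End Frame.
End TripleRelations.

(** * Freeness implies surjectivity; a necessary inequality *)

Section Freeness.

Context {K : fieldType} {l : nat} (A : arrangement K l).
Notation S := {mpoly K[l]}.
Notation I := (ordinal (nhyp A)).
Notation form := (@Defs.form K l A).
Notation al i := (lf (form (i : I))).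
Notation flat := (Defs.flat A).
Notation loc := (@Defs.loc K l A).
Notation trip := (L2trip A).

Definition cst (p : S) : K := p@_0%MM.

Lemma cstM p q : cst (p * q) = cst p * cst q. Proof. exact: rmorphM. Qed.
Lemma cstD p q : cst (p + q) = cst p + cst q. Proof. exact: raddfD. Qed.
Lemma cstB p q : cst (p - q) = cst p - cst q. Proof. exact: raddfB. Qed.
Lemma cstC c : cst c%:MP = c. Proof. by rewrite /cst mcoeffC eqxx mulr1. Qed.
Lemma cst_sum (J : Type) (r : seq J) (P : pred J) (F : J -> S) :
  cst (\sum_(i <- r | P i) F i) = \sum_(i <- r | P i) cst (F i).
Proof. exact: raddf_sum. Qed.

Lemma cst_lf (a : 'rV[K]_l) : cst (lf a) = 0.
Proof.
rewrite /cst /lf raddf_sum big1 // => j _ /=; rewrite mcoeffZ mcoeffX.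
by rewrite -[_ == _]/(U_(j)%MM == 0%MM) mnm1_eq0 mulr0.
Qed.

Lemma cst_dvd a n p : (0 < n)%N -> pdvd (lf a ^+ n) p -> cst p = 0.
Proof.
case: n => // n _ [q ->]; rewrite cstM [cst (lf a ^+ n.+1)]rmorphXn /=.
by rewrite -/(cst (lf a)) cst_lf expr0n mulr0.
Qed.

Lemma cst_ev a t : cst (ev a t) = \sum_j a 0 j * cst (t 0 j).
Proof. by rewrite /ev cst_sum; apply: eq_bigr => j _; rewrite /cst mcoeffZ. Qed.

Context (m : I -> nat) (m_gt0 : multiplicity m).

(** Surjectivity of the map from the local derivation modules to the cokernel
    of iota, in terms of the components z_(X, H) themselves: each z_X agrees
    with g up to the values on the forms of a vector field t_X, which is then
    automatically tangent to the hyperplanes through X. *)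
Definition psi_onto : Prop :=
  forall z : flat -> I -> S,
  (forall X k, X \in trip -> k \in loc setT X -> pdvd (al k ^+ m k) (z X k)) ->
  exists (g : I -> S) (t : flat -> 'rV[S]_l),
    (forall k, pdvd (al k ^+ m k) (g k)) /\
    forall X k, X \in trip -> k \in loc setT X -> z X k = g k + ev (form k) (t X).

Section Frame.
Context (b1 b2 : flat -> I) (w1 w2 : flat -> 'cV[K]_l).
Context (Hb : is_frame b1 b2 w1 w2).
Notation N := #|rel_index b1 b2|.

(** Freeness yields gluing.  On constants, gluing gives formality, so the triple
    relations are independent for dimension reasons.  Splitting z accordingly,
    the function g that comes out is glued by a global vector field, which
    is then subtracted. *)
Lemma free_psi_onto : essential_arr A -> (N + l = nhyp A)%N ->
  free_multi m -> psi_onto.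
Proof.
move=> ess count free z Hz.
have ind : row_free (relation_mx b1 b2 w1 w2).
  apply: (extend_row_free ess count) => g Hg.
  have [t Ht] : exists t, forall k, pdvd (al k ^+ m k) (ev (form k) t - (g k)%:MP).
    apply: (free_gluing free).
    apply: (@local_trip _ _ _ (fun k p => pdvd (al k ^+ m k) (p - (g k)%:MP))).
      by move=> k; exists (g k)%:MP; rewrite subrr; apply: pdvd0.
    move=> X XT; have [|t Ht] := frame_defect0_field Hb (g := fun k => (g k)%:MP) XT.
      move=> p EX; rewrite /frame_defect -!mul_mpolyC -!mpolyCM -!mpolyCB.
      by have := Hg p; rewrite EX /frame_defect => ->.
    by exists t => k kX; rewrite Ht // subrr; apply: pdvd0.
  exists (\col_j cst (t 0 j)) => k; have := cst_dvd (m_gt0 k) (Ht k).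
  rewrite cstB cst_ev cstC => /subr0_eq <-; rewrite mxE.
  by apply: eq_bigr => j _; rewrite mxE.
have [g Hg] := row_free_split Hb z ind.
have [t Ht] : exists t, forall k, pdvd (al k ^+ m k) (ev (form k) t - (- g k)).
  apply: (free_gluing free).
  apply: (@local_trip _ _ _ (fun k p => pdvd (al k ^+ m k) (p - (- g k)))).
    by move=> k; exists (- g k); rewrite subrr; apply: pdvd0.
  move=> X XT; have [t Ht] := Hg X XT; exists t => k kX.
  by rewrite opprK addrC -Ht //; apply: Hz.
have [s Hs] := choice_on (D := mem trip) 0 Hg.
exists (fun k => ev (form k) t + g k), (fun X => s X - t); split.
  by move=> k; have := Ht k; rewrite opprK.
by move=> X k XT kX; rewrite evB (Hs X XT k kX); ring.
Qed.

End Frame.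

(** The minor of the values of two derivations at two hyperplanes through X is
    divisible by the full powers of the forms of these two, and also by the
    form of a third hyperplane through X; so its leading constant vanishes. *)
Lemma minor_cst (X : flat) (t t' : 'rV[S]_l) (k h : I) q1 q2 q1' q2' :
  X \in trip ->
  (forall i, i \in loc setT X -> pdvd (al i ^+ m i) (ev (form i) t)) ->
  (forall i, i \in loc setT X -> pdvd (al i ^+ m i) (ev (form i) t')) ->
  k \in loc setT X -> h \in loc setT X ->
  ev (form k) t = q1 * al k ^+ m k -> ev (form h) t = q2 * al h ^+ m h ->
  ev (form k) t' = q1' * al k ^+ m k -> ev (form h) t' = q2' * al h ^+ m h ->
  cst q1 * cst q2' = cst q2 * cst q1'.
Proof.
move=> XT Ht Ht' kX hX E1 E2 E1' E2'.
have [Ekh|nkh] := eqVneq k h.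
  move: E2 E2'; rewrite -Ekh E1 E1'.
  by move=> /(mulIf (alX_neq0 k (m k))) -> /(mulIf (alX_neq0 k (m k))) ->.
move: (XT); rewrite mem_trip => /andP[/eqP cX c3].
have [i iX /andP[nik nih]] : exists2 i, i \in loc setT X & (i != k) && (i != h).
  have : (0 < #|loc setT X :\ k :\ h|)%N.
    rewrite (cardsD1 k) kX (cardsD1 h) in_setD1 hX eq_sym nkh in c3.
    by move: c3; rewrite /= !add1n !ltnS.
  by case/card_gt0P => i; rewrite !in_setD1 => /and3P[? ? ?]; exists i => //; apply/andP.
have [v [kv hv]] := dual_pair nkh; have nhk : h != k by rewrite eq_sym.
have [w [hw kw]] := dual_pair nhk.
have Ei := span_pair kv hv kw hw.
have {}Ei := Ei i; rewrite -(flat2_cap cX nkh kX hX) -mem_locT in Ei.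
have {}Ei := Ei iX; move: Ei.
(* The form of i is a combination of those of k and h with coefficients a and b,
   not both zero, so it divides both a D and b D. *)
set a := (form i *m v) 0 0; set b := (form i *m w) 0 0 => Ei.
pose D := ev (form k) t * ev (form h) t' - ev (form h) t * ev (form k) t'.
have dvd1 u : pdvd (al i ^+ m i) u -> pdvd (al i) u.
  move=> [q ->]; have := m_gt0 i; case: (m i) => // n _.
  by rewrite exprSr mulrA; exists (q * al i ^+ n).
have Da : pdvd (al i) (a *: D).
  have -> : a *: D = ev (form i) t * ev (form h) t' - ev (form h) t * ev (form i) t'.
    by rewrite Ei !evDl !evZl /D -!mul_mpolyC; ring.
  apply: dvd1; apply: pdvdB; last by apply/pdvdM/Ht'.
  by rewrite mulrC; apply/pdvdM/Ht.
have Db : pdvd (al i) (b *: D).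
  have -> : b *: D = ev (form k) t * ev (form i) t' - ev (form i) t * ev (form k) t'.
    by rewrite Ei !evDl !evZl /D -!mul_mpolyC; ring.
  apply: dvd1; apply: pdvdB; first by apply/pdvdM/Ht'.
  by rewrite mulrC; apply/pdvdM/Ht.
have DD : pdvd (al i) D.
  have [a0|na] := eqVneq a 0; last first.
    by rewrite -[D]scale1r -(mulVf na) -scalerA; apply: pdvdZ.
  have [b0|nb] := eqVneq b 0; last first.
    by rewrite -[D]scale1r -(mulVf nb) -scalerA; apply: pdvdZ.
  by move: (form_neq0 i); rewrite Ei a0 b0 !scale0r addr0 eqxx.
have ED : D = al k ^+ m k * (al h ^+ m h * (q1 * q2' - q2 * q1')).
  by rewrite /D E1 E2 E1' E2'; ring.
have ndvd j n : i != j -> ~ pdvd (al i) (al j ^+ n).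
  move=> nij; elim: n => [|n IH].
    move=> [q /(congr1 cst)]; rewrite expr0 cstM cst_lf mulr0 -mpolyC1 cstC => /eqP.
    by rewrite oner_eq0.
  rewrite exprS => /(lf_prime (form_neq0 i))[/al_dvd E|]; last exact: IH.
  by rewrite E eqxx in nij.
move: DD; rewrite ED => /(lf_prime (form_neq0 i))[/(ndvd _ _ nik) []|].
move=> /(lf_prime (form_neq0 i))[/(ndvd _ _ nih) []|[q /(congr1 cst)]].
by rewrite cstB !cstM cst_lf mulr0 => /subr0_eq.
Qed.

(** The fibre at the origin of the cokernel of iota has dimension at least the
    number of pairs (X, H) minus the number of hyperplanes, and by
    [minor_cst] each triple flat contributes at most one dimension to the
    image: the leading constants of all derivations tangent near X are
    multiples of one vector r_X. *)
Lemma psi_onto_bound : psi_onto ->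
  (\sum_(X in trip) locn X <= nhyp A + #|trip|)%N.
Proof.
move=> onto.
pose tangent (X : flat) t := forall i, i \in loc setT X -> pdvd (al i ^+ m i) (ev (form i) t).
pose Q (X : flat) (r : I -> K) := forall t, tangent X t ->
  exists c, forall k q, k \in loc setT X -> ev (form k) t = q * al k ^+ m k ->
  cst q = c * r k.
have [X XT|r Hr] := @choice_on _ _ (mem trip) (fun=> 0) Q.
  have [[t0 [k0 [q0 [Ht0 kX0 E0 nq0]]]]|none] := classic (exists t k q,
      [/\ tangent X t, k \in loc setT X, ev (form k) t = q * al k ^+ m k & cst q != 0]).
    have [r Hr] := choice_on (D := mem (loc setT X)) 0 Ht0.
    exists (fun k => cst (r k)) => t Ht.
    have [q1 Eq1] := Ht _ kX0; exists (cst q1 / cst q0) => k q kX Eq.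
    have := minor_cst XT Ht0 Ht kX0 kX E0 (Hr k kX) Eq1 Eq.
    rewrite mulrAC [cst q1 * _]mulrC => <-.
    by rewrite mulrAC mulfV // mul1r.
  exists (fun=> 0) => t Ht; exists 0 => k q kX Eq; rewrite mulr0; apply/eqP.
  by apply: contraPT (none) => nq; case; exists t, k, q.
pose P := trip_pairs A.
pose pX (p : 'I_#|P|) := (enum_val p).1; pose pk (p : 'I_#|P|) := (enum_val p).2.
have HP p : (pX p \in trip) * (pk p \in loc setT (pX p)).
  by have := enum_valP p; rewrite inE => /andP[-> ->].
have eqP_pair p p' : (p == p') = (pX p == pX p') && (pk p == pk p').
  rewrite -(inj_eq enum_val_inj) /pX /pk.
  by case: (enum_val p) => X k; case: (enum_val p') => Y h; rewrite xpair_eqE.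
(* Lifting a generator [X, H] expresses a unit vector as a combination of the
   r_X and of the images of the hyperplanes. *)
have H p : exists u : ('I_(nhyp A) -> K) * (flat -> K), forall p',
    (p == p')%:R = u.1 (pk p') + u.2 (pX p') * r (pX p') (pk p').
  have [|g [t [Hg Ht]]] := onto (fun X k => if (X == pX p) && (k == pk p) then al k ^+ m k else 0).
    by move=> X k _ _; case: ifP => _; [exists 1; rewrite mul1r | apply: pdvd0].
  have [gq Egq] := choice_fun Hg.
  have Htan X : X \in trip -> tangent X (t X).
    move=> XT k kX; rewrite -[ev _ _](addKr (g k)) -(Ht X k XT kX) addrC.
    apply: pdvdB; last by exists (gq k).
    by case: ifP => _; [exists 1; rewrite mul1r | apply: pdvd0].
  have [c Hc] := choice_on (D := mem trip) 0 (fun X XT => Hr X XT _ (Htan X XT)).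
  exists (fun k => cst (gq k), c) => p' /=; have [XT kX] := HP p'.
  have [q Eq] := Htan _ XT _ kX; rewrite -(Hc _ XT _ _ kX Eq) -cstD.
  have := Ht _ _ XT kX; rewrite Egq Eq -mulrDl.
  have -> : (pX p' == pX p) && (pk p' == pk p) = (p == p').
    by rewrite [RHS]eq_sym eqP_pair.
  case: (p == p') => [E|/esym/eqP].
    have := mulIf (alX_neq0 (pk p') (m (pk p'))) (etrans (mul1r _) E).
    by move=> <-; rewrite -mpolyC1 cstC.
  rewrite mulf_eq0 (negbTE (alX_neq0 _ _)) orbF => /eqP ->.
  by rewrite -mpolyC0 cstC.
have [u Hu] := choice_fun H.
pose U : 'M[K]_(#|P|, nhyp A + #|trip|) :=
  row_mx (\matrix_(p, k) (u p).1 k) (\matrix_(p, x) (u p).2 (enum_val x)).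
pose W : 'M[K]_(nhyp A + #|trip|, #|P|) :=
  col_mx (\matrix_(k, p) (k == pk p)%:R)
    (\matrix_(x, p) (r (pX p) (pk p) *+ (enum_val x == pX p))).
rewrite -card_trip_pairs; apply: (@mulmx1_min _ _ _ U W).
rewrite mul_row_col; apply/matrixP => p p'; rewrite mxE !(mxE, Hu).
congr (_ + _).
  rewrite (bigD1 (pk p')) //= !mxE eqxx mulr1 big1 ?addr0 // => k nk.
  by rewrite !mxE (negbTE nk) mulr0.
have [XT _] := HP p'; pose x := enum_rank_in XT (pX p').
have Ex : enum_val x = pX p' by rewrite enum_rankK_in.
rewrite (bigD1 x) //= !mxE Ex eqxx mulr1n big1 ?addr0 // => y ny.
rewrite !mxE -Ex (inj_eq enum_val_inj) (negbTE ny) mulr0n mulr0 //.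
Qed.

End Freeness.

(** * Homogeneous bases in rank two *)

Section BinaryForms.

Context {K : fieldType} {l : nat}.
Notation S := {mpoly K[l]}.

(** Homogeneous polynomials of degree d in the two linear forms x and y.  The
    recursion makes the independence of the basis (x, y) of their span
    immediate. *)
Fixpoint binary (x y : 'rV[K]_l) (d : nat) (p : S) : Prop :=
  if d is d'.+1 then
    exists p1 p2, [/\ binary x y d' p1, binary x y d' p2 & p = lf x * p1 + lf y * p2]
  else exists c : K, p = c%:MP.

Lemma binaryD x y d p q : binary x y d p -> binary x y d q -> binary x y d (p + q).
Proof.
elim: d p q => [|d IH] p q /= => [[a ->] [b ->]|].
  by exists (a + b); rewrite mpolyCD.
move=> [p1 [p2 [H1 H2 ->]]] [q1 [q2 [G1 G2 ->]]].
by exists (p1 + q1), (p2 + q2); split; [exact: IH | exact: IH | ring].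
Qed.

Lemma binaryZ x y d c p : binary x y d p -> binary x y d (c *: p).
Proof.
elim: d p => [|d IH] p /= => [[a ->]|[p1 [p2 [H1 H2 ->]]]].
  by exists (c * a); rewrite mpolyCM mul_mpolyC.
by exists (c *: p1), (c *: p2); split; [exact: IH | exact: IH | rewrite scalerDr !scalerAr].
Qed.

Lemma binary_mul x y d a b p : binary x y d p ->
  binary x y d.+1 (lf (a *: x + b *: y) * p).
Proof.
move=> Hp; exists (a *: p), (b *: p); split; [exact: binaryZ | exact: binaryZ |].
by rewrite lfD !lfZ mulrDl -!scalerAl -!scalerAr.
Qed.

Lemma binary_change x y x' y' a b c e d p : x = a *: x' + b *: y' ->
  y = c *: x' + e *: y' -> binary x y d p -> binary x' y' d p.
Proof.
move=> Ex Ey; elim: d p => [|d IH] p //= [p1 [p2 [/IH H1 /IH H2 ->]]].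
by apply: (@binaryD _ _ d.+1); rewrite ?Ex ?Ey; apply: binary_mul.
Qed.

Lemma binary_homog x y d p : binary x y d p -> p \is d.-homog.
Proof.
elim: d p => [|d IH] p /= => [[c ->]|[p1 [p2 [/IH H1 /IH H2 ->]]]].
  by rewrite -[c%:MP]mulr1 mul_mpolyC; apply: rpredZ; apply: dhomog1.
by apply: rpredD; rewrite -add1n; apply: dhomogM => //; apply: lf_homog.
Qed.

Lemma binary_split x y d p : binary x y d p -> exists c p',
  [/\ p = c *: lf y ^+ d + lf x * p', binary x y d.-1 p' & d = 0%N -> p' = 0].
Proof.
elim: d p => [|d IH] p /= => [[c ->]|[p1 [p2 [H1 H2 ->]]]].
  exists c, 0; split=> //; last by exists 0; rewrite mpolyC0.
  by rewrite expr0 mulr0 addr0 -mul_mpolyC mulr1.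
have [c [p' [-> Hp' H0]]] := IH _ H2.
exists c, (p1 + lf y * p'); split=> //.
  by rewrite exprS -!mul_mpolyC; ring.
apply: binaryD; first exact: H1.
case: d H0 Hp' {IH H1 H2} => [/(_ erefl) -> _|d _ Hp'].
  by rewrite mulr0; exists 0; rewrite mpolyC0.
have -> : lf y = lf (0 *: x + 1 *: y) by rewrite scale0r add0r scale1r.
exact: binary_mul.
Qed.

(** Expand p in powers of x and y: if x divides p, the coefficient of y^d
    vanishes. *)
Lemma binary_quot x y d n p q : x != 0 -> ~ pdvd (lf x) (lf y) ->
  binary x y d p -> p = q * lf x ^+ n ->
  if (n <= d)%N then binary x y (d - n) q else q = 0.
Proof.
move=> nx nxy; have nlx : lf x != 0 by apply: contraNneq nx => /lf_eq0 ->.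
elim: n p q => [|n IH] p q Hp E; first by rewrite expr0 mulr1 in E; rewrite leq0n subn0 -E.
have {}IH := IH p (q * lf x) Hp; rewrite -mulrA -exprS E in IH; have {}IH := IH erefl.
move: IH; case: (leqP n d) => nd IH; last first.
  rewrite ltnNge (ltnW nd) /=; move: IH => /eqP.
  by rewrite mulf_eq0 (negbTE nlx) orbF => /eqP.
have [c [p' [E' Hp' H0]]] := binary_split IH.
have c0 : c = 0.
  apply/eqP; apply: contra_notT nxy => nc.
  have : pdvd (lf x) (lf y ^+ (d - n)).
    rewrite -[_ ^+ _]scale1r -(mulVf nc) -scalerA; apply: pdvdZ.
    by exists (q - p'); rewrite mulrBl E' [p' * _]mulrC addrK.
  elim: (d - n)%N => [[s Es]|k IHk]; last first.
    by rewrite exprS => /(lf_prime nx)[].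
  by exists (lf y * s); rewrite -mulrA -Es expr0 mulr1.
have Eq : q = p'.
  by apply: (mulIf nlx); rewrite E' c0 scale0r add0r mulrC.
rewrite Eq subnS; case: ltnP => // dn; apply: H0.
by apply/eqP; rewrite subn_eq0.
Qed.

End BinaryForms.

Section RankTwo.

Context {K : fieldType} {l : nat} (A : arrangement K l).
Notation S := {mpoly K[l]}.
Notation I := (ordinal (nhyp A)).
Notation form := (@Defs.form K l A).
Notation hyp := (@Defs.hyp K l A).
Notation al i := (lf (form (i : I))).
Notation flat := (Defs.flat A).
Notation loc := (@Defs.loc K l A).
Notation trip := (L2trip A).
Context (b1 b2 : flat -> I) (w1 w2 : flat -> 'cV[K]_l).
Context (Hb : is_frame b1 b2 w1 w2).
Context (X : flat) (XT : X \in trip).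
Notation locX := (loc setT X).
Notation bin := (binary (form (b1 X)) (form (b2 X))).

Definition tangent (n : I -> nat) (t : 'rV[S]_l) : Prop :=
  forall i, i \in locX -> pdvd (al i ^+ n i) (ev (form i) t).

(** A homogeneous basis of the derivations tangent to the hyperplanes through
    X, up to the derivations that kill all their forms. *)
Definition rank2_basis (n : I -> nat) (t1 t2 : 'rV[S]_l) (d1 d2 : nat) : Prop :=
  [/\ tangent n t1 /\ tangent n t2,
      forall i, i \in locX -> bin d1 (ev (form i) t1) /\ bin d2 (ev (form i) t2),
      forall t, tangent n t -> exists f1 f2, forall i, i \in locX ->
        ev (form i) t = f1 * ev (form i) t1 + f2 * ev (form i) t2
    & forall f1 f2, (forall i, i \in locX ->
        f1 * ev (form i) t1 + f2 * ev (form i) t2 = 0) -> f1 = 0 /\ f2 = 0].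

Lemma rank2_basis_swap n t1 t2 d1 d2 :
  rank2_basis n t1 t2 d1 d2 -> rank2_basis n t2 t1 d2 d1.
Proof.
move=> [[T1 T2] H G F]; split=> //.
- by move=> i /H [].
- by move=> t /G [f1 [f2 E]]; exists f2, f1 => i iX; rewrite addrC E.
by move=> f1 f2 E; have [|-> ->] := F f2 f1; [move=> i iX; rewrite addrC E | ].
Qed.

Lemma locX_cap i j k : i != j -> i \in locX -> j \in locX -> k \in locX ->
  (hyp i :&: hyp j <= hyp k)%VS.
Proof.
move=> nij iX jX kX; move: XT; rewrite mem_trip => /andP[/eqP cX _].
by rewrite -(flat2_cap cX nij iX jX) -mem_locT.
Qed.

Lemma locX_span i j k : i != j -> i \in locX -> j \in locX -> k \in locX ->
  exists a b, form k = a *: form i + b *: form j.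
Proof.
move=> nij iX jX kX; have [v [vi vj]] := dual_pair nij.
have [w [wj wi]] : exists w : 'cV[K]_l, (form j *m w) 0 0 = 1 /\ (form i *m w) 0 0 = 0.
  by apply: dual_pair; rewrite eq_sym.
by do 2 eexists; apply: (span_pair vi vj wi wj); apply: locX_cap.
Qed.

(** Modulo the form of h, the quotients of the two values at h are multiples of
    powers of another form through X.  If the basis vector of smaller degree
    has nonzero quotient, subtract a multiple of it from the other one to kill
    the quotient of the latter, and multiply it by the form of h; otherwise at
    most the other one has to be multiplied. *)
Lemma rank2_step n h t1 t2 d1 d2 : h \in locX -> (d1 <= d2)%N ->
  rank2_basis n t1 t2 d1 d2 ->
  exists t1' t2' d1' d2', rank2_basis (fun i => n i + (i == h))%N t1' t2' d1' d2'.
Proof.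
move=> hX d12 [[T1 T2] hom gen indep].
have [j jX nhj] : exists2 j, j \in locX & h != j.
  have [b1X b2X _ _] := Hb XT; have [E|] := eqVneq h (b1 X); last by exists (b1 X).
  by exists (b2 X); rewrite // E (frame_neq Hb).
have nalh : al h != 0 by apply: al_neq0.
have nxy : ~ pdvd (al h) (al j) by move/al_dvd => E; rewrite E eqxx in nhj.
have nj k : ~ pdvd (al h) (al j ^+ k).
  elim: k => [[u /(congr1 cst)]|k IH]; last first.
    by rewrite exprS => /(lf_prime (form_neq0 h))[].
  by rewrite expr0 cstM cst_lf mulr0 -mpolyC1 cstC => /eqP; rewrite oner_eq0.
have quot t d q : bin d (ev (form h) t) -> ev (form h) t = q * al h ^+ n h ->
    exists c r, q = c *: al j ^+ (d - n h) + al h * r /\ (c != 0 -> (n h <= d)%N).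
  have [b1X b2X _ _] := Hb XT.
  have [a [b E1]] := locX_span nhj hX jX b1X; have [a' [b' E2]] := locX_span nhj hX jX b2X.
  move=> /(binary_change E1 E2) Ht /(binary_quot (form_neq0 h) nxy Ht).
  case: leqP => [_ /binary_split[c [r [E _ _]]]|_ ->]; first by exists c, r.
  by exists 0, 0; rewrite mulr0 scale0r addr0 eqxx.
have tangent_add t q : tangent n t -> ev (form h) t = q * al h ^+ n h ->
    pdvd (al h) q -> tangent (fun i => n i + (i == h))%N t.
  move=> Tt E [r Er] i iX; case: eqP => [->|_]; last by rewrite addn0; apply: Tt.
  by exists r; rewrite E Er addn1 exprS mulrA.
have tangent_mul t : tangent n t -> tangent (fun i => n i + (i == h))%N (al h *: t).
  move=> Tt i iX; rewrite evZ; have [q ->] := Tt i iX.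
  case: eqP => [->|_]; first by exists q; rewrite addn1 exprS; ring.
  by exists (al h * q); rewrite addn0; ring.
have tangent_sub t : tangent (fun i => n i + (i == h))%N t -> tangent n t.
  by move=> Tt i iX; have [q ->] := Tt i iX; exists (q * al i ^+ (i == h)); rewrite exprD; ring.
have tangent_h t q : tangent (fun i => n i + (i == h))%N t ->
    ev (form h) t = q * al h ^+ n h -> pdvd (al h) q.
  move=> Tt; have [r ->] := Tt h hX; rewrite eqxx addn1 exprS mulrA.
  by move=> /(mulIf (alX_neq0 h (n h))) <-; exists r.
have bin_mulh i k t d : i \in locX -> k \in locX -> bin d (ev (form i) t) ->
    bin d.+1 (al k * ev (form i) t).
  by move=> iX kX; rewrite (frame_span Hb XT kX); apply: binary_mul.
have [q1 E1] := T1 h hX; have [q2 E2] := T2 h hX.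
have [c1 [r1 [Eq1 dc1]]] := quot _ _ _ (hom h hX).1 E1.
have [c2 [r2 [Eq2 dc2]]] := quot _ _ _ (hom h hX).2 E2.
have [c10|nc1] := eqVneq c1 0.
  have q1h : pdvd (al h) q1 by exists r1; rewrite Eq1 c10 scale0r add0r mulrC.
  have [c20|nc2] := eqVneq c2 0.
    have q2h : pdvd (al h) q2 by exists r2; rewrite Eq2 c20 scale0r add0r mulrC.
    exists t1, t2, d1, d2; split=> //.
      by split; [apply: tangent_add q1h | apply: tangent_add q2h].
    by move=> t /tangent_sub; apply: gen.
  exists t1, (al h *: t2), d1, d2.+1; split.
  - by split; [apply: tangent_add q1h | apply: tangent_mul].
  - move=> i iX; have [H1 H2] := hom i iX; split=> //.
    by rewrite evZ; apply: bin_mulh.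
  - move=> t Tt; have [f1 [f2 E]] := gen t (tangent_sub _ Tt).
    have : pdvd (al h) (f1 * q1 + f2 * q2).
      by apply: (tangent_h t _ Tt); rewrite (E h hX) E1 E2; ring.
    move=> Hd; have : pdvd (al h) (al j ^+ (d2 - n h) * f2).
      rewrite -[_ * _]scale1r -(mulVf nc2) -scalerA; apply: pdvdZ.
      have -> : c2 *: (al j ^+ (d2 - n h) * f2) =
          (f1 * q1 + f2 * q2) - (f1 * q1 + (f2 * r2) * al h).
        by rewrite Eq2 -!mul_mpolyC; ring.
      apply: pdvdB => //; apply: pdvdD; first exact: pdvdM.
      by exists (f2 * r2).
    case/(lf_prime (form_neq0 h)) => [/nj []|[g Eg]].
    by exists f1, g => i iX; rewrite (E i iX) Eg evZ; ring.
  move=> f1 f2 E; have [|-> /eqP] := indep f1 (f2 * al h).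
    by move=> i iX; rewrite -(E i iX) evZ; ring.
  by rewrite mulf_eq0 (negbTE nalh) orbF => /eqP.
pose c := c2 / c1; pose s := c *: al j ^+ (d2 - d1).
(* c is chosen so that the powers of the form of j cancel. *)
have Es : q2 - s * q1 = (r2 - s * r1) * al h.
  rewrite Eq1 Eq2 /s; have [c20|nc2] := eqVneq c2 0.
    by rewrite /c c20 mul0r !scale0r !mul0r !subr0 add0r mulrC.
  have -> : (d2 - n h = (d2 - d1) + (d1 - n h))%N.
    by have := dc1 nc1; move: d12; clear; lia.
  have -> : c2 = c * c1 by rewrite /c mulfVK.
  by rewrite exprD -!mul_mpolyC mpolyCM; ring.
have evs i : ev (form i) (t2 - s *: t1) = ev (form i) t2 - s * ev (form i) t1.
  by rewrite evB evZ.
exists (al h *: t1), (t2 - s *: t1), d1.+1, d2; split.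
- split; first exact: tangent_mul.
  apply: (tangent_add _ (q2 - s * q1)); last by rewrite Es; exists (r2 - s * r1).
    by move=> i iX; rewrite evs; apply: pdvdB; [apply: T2 | apply/pdvdM/T1].
  by rewrite evs E1 E2; ring.
- move=> i iX; have [H1 H2] := hom i iX; split; first by rewrite evZ; apply: bin_mulh.
  rewrite evs; apply: binaryD => //; rewrite -scaleN1r /s -scalerAl; do 2 apply: binaryZ.
  rewrite -{1}(subnK d12); elim: (d2 - d1)%N => [|k IH]; first by rewrite expr0 mul1r.
  by rewrite exprS -mulrA addSn {1}(frame_span Hb XT jX); apply: binary_mul.
- move=> t Tt; have [f1 [f2 E]] := gen t (tangent_sub _ Tt).
  have Hd : pdvd (al h) (f1 * q1 + f2 * q2).
    by apply: (tangent_h t _ Tt); rewrite (E h hX) E1 E2; ring.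
  have : pdvd (al h) (al j ^+ (d1 - n h) * (f1 + s * f2)).
    rewrite -[_ * _]scale1r -(mulVf nc1) -scalerA; apply: pdvdZ.
    have -> : c1 *: (al j ^+ (d1 - n h) * (f1 + s * f2)) =
        (f1 * q1 + f2 * q2) - ((f1 + s * f2) * r1 + f2 * (r2 - s * r1)) * al h.
      have -> : f1 * q1 + f2 * q2 = (f1 + s * f2) * q1 + f2 * (q2 - s * q1) by ring.
      by rewrite Es Eq1 -!mul_mpolyC; ring.
    apply: pdvdB => //; by eexists.
  case/(lf_prime (form_neq0 h)) => [/nj []|[g Eg]].
  exists g, f2 => i iX; rewrite (E i iX) evs evZ.
  have -> : f1 = g * al h - s * f2 by rewrite -Eg addrK.
  by ring.
move=> f1 f2 E; have [i iX|/eqP E0 f20] := indep (f1 * al h - f2 * s) f2.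
  by rewrite -(E i iX) evs evZ; ring.
move: E0; rewrite f20 mul0r subr0 mulf_eq0 (negbTE nalh) orbF => /eqP -> //.
Qed.

Lemma rank2_basis_ext n n' t1 t2 d1 d2 : (forall i, i \in locX -> n i = n' i) ->
  rank2_basis n t1 t2 d1 d2 -> rank2_basis n' t1 t2 d1 d2.
Proof.
move=> En; have T t : tangent n t <-> tangent n' t.
  by split=> H i iX; have := H i iX; rewrite En.
by move=> [[/T T1 /T T2] H G F]; split=> // t /T; apply: G.
Qed.

(** The derivations dual to the frame are a basis when all multiplicities
    vanish. *)
Lemma rank2_basis_exists n : exists t1 t2 d1 d2, rank2_basis n t1 t2 d1 d2.
Proof.
move E: (\sum_(i in locX) n i)%N => s; elim: s n E => [|s IH] n E.
  have n0 i : i \in locX -> n i = 0%N.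
    by move=> iX; apply/eqP; move/eqP: E; rewrite sum_nat_eq0 => /forall_inP; apply.
  have [b1X b2X [E11 E21] [E12 E22]] := Hb XT.
  have ev1 i := ev_vfield (form i) (w1 X) 1; have ev2 i := ev_vfield (form i) (w2 X) 1.
  exists (vfield (w1 X) 1), (vfield (w2 X) 1), 0%N, 0%N; split.
  - by split=> i iX; rewrite (n0 i iX); eexists; rewrite expr0 mulr1.
  - move=> i iX; rewrite ev1 ev2; split; eexists; rewrite -mul_mpolyC mulr1; reflexivity.
  - move=> t _; exists (ev (form (b1 X)) t), (ev (form (b2 X)) t) => i iX.
    by rewrite ev1 ev2 {1}(frame_span Hb XT iX) evDl !evZl -!mul_mpolyC; ring.
  move=> f1 f2 H; have := H _ b1X; have := H _ b2X.
  by rewrite !ev1 !ev2 E11 E21 E12 E22 !scale1r !scale0r !mulr0 !mulr1 addr0 add0r.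
have [h hX nh] : exists2 h, h \in locX & (0 < n h)%N.
  have : (\sum_(i in locX) n i != 0)%N by rewrite E.
  rewrite sum_nat_eq0 negb_forall => /existsP[h]; rewrite negb_imply -lt0n => /andP[? ?].
  by exists h.
have [|t1 [t2 [d1 [d2 B]]]] := IH (fun i => n i - (i == h))%N.
  rewrite (bigD1 h) //= eqxx; move: E; rewrite (bigD1 h) //= => E.
  rewrite (eq_bigr n) => [|i /andP[_ /negbTE ->]]; last by rewrite subn0.
  by move: E nh; lia.
have En i : i \in locX -> (n i - (i == h) + (i == h) = n i)%N.
  by move=> _; case: eqP => [->|_]; rewrite ?subn0 ?addn0 // subnK.
have [d12|/ltnW d21] := leqP d1 d2.
  have [t1' [t2' [d1' [d2' B']]]] := rank2_step hX d12 B.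
  by exists t1', t2', d1', d2'; apply: rank2_basis_ext B'.
have [t1' [t2' [d1' [d2' B']]]] := rank2_step hX d21 (rank2_basis_swap B).
by exists t1', t2', d1', d2'; apply: rank2_basis_ext B'.
Qed.

End RankTwo.

(** * Surjectivity implies freeness *)

Section GradedKernel.

Context {K : fieldType} {l : nat}.
Notation S := {mpoly K[l]}.

(** Homogeneous of degree d - e; in particular zero when d < e. *)
Definition ghomog (d e : nat) (p : S) : Prop :=
  forall mu, mu \in msupp p -> (mdeg mu + e)%N = d.

Lemma ghomog0 d e : ghomog d e 0.
Proof. by move=> mu; rewrite msupp0. Qed.

Lemma ghomogD d e p q : ghomog d e p -> ghomog d e q -> ghomog d e (p + q).
Proof.
by move=> Hp Hq mu /msuppD_le; rewrite mem_cat => /orP[/Hp|/Hq].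
Qed.

Lemma ghomogN d e p : ghomog d e p -> ghomog d e (- p).
Proof. by move=> Hp mu; rewrite (perm_mem (msuppN p)) => /Hp. Qed.

Lemma ghomogM d e d' e' p q : ghomog d e p -> ghomog d' e' q ->
  ghomog (d + d') (e + e') (p * q).
Proof.
move=> Hp Hq mu /msuppM_le /allpairsP[[m1 m2] /= [/Hp H1 /Hq H2 ->]].
by rewrite mdegD -H1 -H2; lia.
Qed.

Lemma ghomog1 : ghomog 0 0 1.
Proof. by move=> mu; rewrite msupp1 inE => /eqP ->; rewrite mdeg0. Qed.

Lemma ghomog_prod (J : finType) (d e : J -> nat) (F : J -> S) :
  (forall j, ghomog (d j) (e j) (F j)) ->
  ghomog (\sum_j d j) (\sum_j e j) (\prod_j F j).
Proof.
move=> H; apply: (big_rec3 (fun a b p => ghomog a b p)); first exact: ghomog1.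
by move=> j a b p _; apply: ghomogM.
Qed.

Lemma ghomog_det n (B : 'M[S]_n) (d e : 'I_n -> nat) :
  (forall i j, ghomog (d i) (e j) (B i j)) ->
  ghomog (\sum_i d i) (\sum_j e j) (\det B).
Proof.
move=> H; rewrite /determinant.
apply: (big_ind (ghomog _ _)) => [||s _]; [exact: ghomog0 | exact: ghomogD |].
have Hs : ghomog (\sum_i d i) (\sum_j e j) (\prod_i B i (s i)).
  have -> : (\sum_j e j = \sum_j e (s j))%N by rewrite (reindex_inj (@perm_inj _ s)).
  exact: ghomog_prod.
by case: (odd_perm s); rewrite ?expr1 ?expr0 ?mulN1r ?mul1r //; apply: ghomogN.
Qed.

Lemma ghomog_unit d e p : ghomog d e p -> cst p != 0 -> p \is a GRing.unit.
Proof.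
move=> H nz; have in0 : 0%MM \in msupp p by rewrite mcoeff_msupp.
have Ed := H _ in0; rewrite mdeg0 add0n in Ed.
have -> : p = (cst p)%:MP.
  apply: msize1_polyC; rewrite msizeE; apply/bigmax_leqP_seq => mu Hmu _.
  by have := H mu Hmu; rewrite -Ed; case: (mdeg mu) => // k; lia.
by apply/unitrP; exists ((cst p)^-1)%:MP; rewrite -!mpolyCM mulVf // mulfV // mpolyC1.
Qed.

(** A degree-preserving surjection of graded free modules has a free kernel.
    At the origin some maximal minor does not vanish; being homogeneous, it
    is a nonzero constant, so the corresponding square block is invertible and
    the other rows project to a basis of the kernel. *)
Lemma graded_kernel_free N k (P : 'M[S]_(N, k)) (L : 'M[S]_(k, N))
    (d : 'I_N -> nat) (e : 'I_k -> nat) :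
  (forall i j, ghomog (d i) (e j) (P i j)) -> L *m P = 1%:M ->
  exists n (b : 'I_n -> 'rV[S]_N),
    [/\ forall i, b i *m P = 0,
        forall s, s *m P = 0 -> exists c : 'I_n -> S, s = \sum_i c i *: b i
      & forall c : 'I_n -> S, \sum_i c i *: b i = 0 -> forall i, c i = 0].
Proof.
move=> HP LP; pose P0 := map_mx cst P; pose L0 := map_mx cst L.
have LP0 : L0 *m P0 = 1%:M.
  apply/matrixP => i j; move/matrixP/(_ i j): LP => /(congr1 cst).
  rewrite !mxE cst_sum => E; transitivity (cst ((i == j)%:R : S)).
    by rewrite -E; apply: eq_bigr => h _; rewrite !mxE cstM.
  by rewrite /cst rmorph_nat.
have full : row_full P0 by apply/row_fullP; exists L0.
pose f := fullrankfun full; pose B := rowsub f P.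
have Bunit : B \in unitmx.
  apply: (ghomog_unit (ghomog_det (d := d \o f) (e := e) _)).
    by move=> i j; rewrite !mxE; apply: HP.
  have -> : cst (\det B) = \det (rowsub f P0).
    rewrite -[LHS](det_map_mx (mcoeff 0%MM)); congr (\det _).
    by apply/matrixP => i j; rewrite !mxE.
  by rewrite -unitfE -[_ \is a _]/(_ \in unitmx) -row_full_unit; apply: fullrowsub_full.
(* R is a left inverse of P, so 1 - P R projects onto the kernel; its rows with
   index in the image of f vanish. *)
pose R := invmx B *m rowsub f 1%:M.
have RP : R *m P = 1%:M by rewrite -mulmxA mul_rowsub_mx mul1mx mulVmx.
pose E := 1%:M - P *m R.
have Ef i : row (f i) E = 0.
  rewrite linearB /= row_mul mulmxA.
  have -> : row (f i) P = row i B by rewrite row_rowsub.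
  by rewrite -row_mul mulmxV // !row1 -rowE row_rowsub row1 subrr.
pose C := [set i | i \notin codom f].
pose g (i : 'I_#|C|) := enum_val i.
have Eg (s : 'rV[S]_N) : s *m P = 0 -> s = \sum_i s 0 (g i) *: row (g i) E.
  move=> sP; have {1}-> : s = s *m E by rewrite mulmxBr mulmx1 mulmxA sP mul0mx subr0.
  rewrite mulmx_sum_row (bigID (mem C)) /= [X in _ + X]big1 ?addr0 => [|i].
    by rewrite big_enum_val.
  by rewrite inE negbK => /codomP[j ->]; rewrite Ef scaler0.
exists #|C|, (fun i => row (g i) E); split.
- by move=> i; rewrite -row_mul mulmxBl mul1mx -mulmxA RP mulmx1 subrr row0.
- by move=> s /Eg ->; eexists.
move=> c Hc i; have gi : g i \notin codom f by have := enum_valP i; rewrite inE.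
have Rg h : R h (g i) = 0.
  rewrite mxE big1 // => j _; rewrite !mxE; case: eqP => [Ej|]; rewrite ?mulr0 //.
  by case/negP: gi; rewrite -Ej codom_f.
have Ejg j : E (g j) (g i) = (j == i)%:R.
  rewrite !mxE (inj_eq enum_val_inj) big1 ?subr0 // => h _.
  by rewrite Rg mulr0.
have Et j : (c j *: row (g j) E) 0 (g i) = c j * (j == i)%:R.
  by rewrite -Ejg mxE [row _ _ _ _]mxE.
move/rowP/(_ (g i)): Hc; rewrite summxE (bigD1 i) //= big1 => [|j nji].
  by rewrite addr0 Et eqxx mulr1 mxE.
by rewrite Et (negbTE nji) mulr0.
Qed.

End GradedKernel.

Section SurjectiveFree.

Context {K : fieldType} {l : nat} (A : arrangement K l).
Notation S := {mpoly K[l]}.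
Notation I := (ordinal (nhyp A)).
Notation form := (@Defs.form K l A).
Notation al i := (lf (form (i : I))).
Notation flat := (Defs.flat A).
Notation loc := (@Defs.loc K l A).
Notation trip := (L2trip A).
Context (b1 b2 : flat -> I) (w1 w2 : flat -> 'cV[K]_l).
Context (Hb : is_frame b1 b2 w1 w2).
Context (m : I -> nat).

Lemma essential_ev t : essential_arr A -> (forall k, ev (form k) t = 0) -> t = 0.
Proof.
move=> ess Ht; apply/rowP => j; rewrite mxE; apply/mpolyP => mu; rewrite mcoeff0.
have : \col_j (t 0 j)@_mu = 0 :> 'cV[K]_l.
  apply: ess => k; apply/eqP; rewrite mx11_eq0; apply/eqP.
  rewrite mxE -[RHS](mcoeff0 _ mu) -(Ht k) /ev raddf_sum.
  by apply: eq_bigr => h _; rewrite mxE /= mcoeffZ.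
by move/colP/(_ j); rewrite !mxE.
Qed.

Context (x0 : I -> flat) (Hx0 : forall k, x0 k \in trip /\ k \in loc setT (x0 k)).

(** By formality D(A, m) is the kernel of the map from the sum of the local
    modules D(A_X) to the cokernel of iota.  Modulo the derivations killing
    all the forms through X, the module D(A_X) has a homogeneous basis of two
    elements; the cokernel of iota has the coordinates (X, k), X <> x0 k,
    measuring the difference from the component (x0 k, k). *)
Lemma psi_onto_free : essential_arr A -> triple_formal b1 b2 w1 w2 ->
  psi_onto m -> free_multi m.
Proof.
move=> ess formal onto.
pose Q X (B : ('rV[S]_l * 'rV[S]_l) * (nat * nat)) :=
  rank2_basis b1 b2 X m B.1.1 B.1.2 B.2.1 B.2.2.
have [X XT|BX HBX] := @choice_on _ _ (mem trip) ((0, 0), (0%N, 0%N)) Q.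
  have [t1 [t2 [d1 [d2 B]]]] := rank2_basis_exists Hb XT m.
  by exists ((t1, t2), (d1, d2)).
pose t X (e : bool) := if e then (BX X).1.2 else (BX X).1.1.
pose dg X (e : bool) := if e then (BX X).2.2 else (BX X).2.1.
have tan X e : X \in trip -> tangent X m (t X e).
  by move=> /HBX [[? ?] _ _ _]; case: e.
have bin X e k : X \in trip -> k \in loc setT X ->
    binary (form (b1 X)) (form (b2 X)) (dg X e) (ev (form k) (t X e)).
  by move=> /HBX [_ H _ _] /H []; case: e.
have quot (p : flat * bool * I) : exists u, p.1.1 \in trip -> p.2 \in loc setT p.1.1 ->
    ev (form p.2) (t p.1.1 p.1.2) = u * al p.2 ^+ m p.2.
  case: p => [[X e] k] /=; have [XT|_] := boolP (X \in trip); last by exists 0.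
  have [kX|_] := boolP (k \in loc setT X); last by exists 0.
  by have [u Eu] := tan X e XT k kX; exists u.
have [q qE] := choice_fun quot.
have Hq X e k : X \in trip -> k \in loc setT X ->
    ev (form k) (t X e) = q (X, e, k) * al k ^+ m k.
  by move=> XT kX; apply: (qE (X, e, k)).
have qhom X e k : X \in trip -> k \in loc setT X ->
    ghomog (dg X e) (m k) (q (X, e, k)).
  move=> XT kX; have := dhomog_quot (lfX_homog (form k) (m k)) (alX_neq0 k (m k))
    (d := dg X e) (p := q (X, e, k)).
  rewrite -Hq // => /(_ (binary_homog (bin X e k XT kX))).
  case: leqP => [le /dhomogP hq mu Hmu|_ /eqP ->]; last exact: ghomog0.
  by apply: etrans (subnK le); congr (_ + _)%N; apply: hq.
(* The matrix P of the map, in these bases, and the meaning of its product with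
   a row s of coordinates: sv s X k is the quotient at k of the derivation
   th s X with coordinates s. *)
pose RI : {set flat * bool} := [set p | p.1 \in trip].
pose CI := coord_set x0.
pose rX (i : 'I_#|RI|) := (enum_val i).1; pose re (i : 'I_#|RI|) := (enum_val i).2.
pose cX (j : 'I_#|CI|) := (enum_val j).1; pose ck (j : 'I_#|CI|) := (enum_val j).2.
have HrX i : rX i \in trip by have := enum_valP i; rewrite inE.
have Hc j : [/\ cX j \in trip, ck j \in loc setT (cX j) & cX j != x0 (ck j)].
  by have := enum_valP j; rewrite 2!inE => /andP[/andP[]].
pose P : 'M[S]_(#|RI|, #|CI|) := \matrix_(i, j)
  (if rX i == cX j then q (rX i, re i, ck j)
   else if rX i == x0 (ck j) then - q (rX i, re i, ck j) else 0).
pose th (s : 'rV[S]_#|RI|) (X : flat) := \sum_(i | rX i == X) s 0 i *: t X (re i).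
pose sv (s : 'rV[S]_#|RI|) X k := \sum_(i | rX i == X) s 0 i * q (X, re i, k).
have ev_th s X k : X \in trip -> k \in loc setT X ->
    ev (form k) (th s X) = sv s X k * al k ^+ m k.
  move=> XT kX; rewrite ev_sum mulr_suml; apply: eq_bigr => i _.
  by rewrite evZ Hq // mulrA.
have sP s j : (s *m P) 0 j = sv s (cX j) (ck j) - sv s (x0 (ck j)) (ck j).
  have [_ _ neq] := Hc j; rewrite mxE /sv [X in _ = X - _]big_mkcond [X in _ = _ - X]big_mkcond.
  rewrite -sumrB; apply: eq_bigr => i _; rewrite mxE.
  case: eqP => [->|_]; first by rewrite (negbTE neq) subr0.
  by case: eqP => [->|_]; rewrite ?subr0 ?sub0r ?mulrN ?mulr0 ?oppr0.
have rowI X e : X \in trip -> exists i, enum_val (A := RI) i = (X, e).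
  move=> XT; have inR : (X, e) \in RI by rewrite inE.
  by exists (enum_rank_in inR (X, e)); rewrite enum_rankK_in.
have th2 s X i0 i1 : enum_val i0 = (X, false) -> enum_val i1 = (X, true) ->
    th s X = s 0 i0 *: t X false + s 0 i1 *: t X true.
  move=> E0 E1; have n10 : i1 != i0 by apply/eqP => E; rewrite -E E1 in E0.
  rewrite /th (bigD1 i0) /rX ?E0 //= (bigD1 i1) /=; last by rewrite E1 eqxx n10.
  rewrite /re E0 E1 big1 ?addr0 // => i /andP[/andP[/eqP Ei ne0] ne1].
  case Ev: (enum_val i) Ei => [Y []] /= EY; rewrite EY in Ev.
    by case/negP: ne1; rewrite -(inj_eq enum_val_inj) Ev E1.
  by case/negP: ne0; rewrite -(inj_eq enum_val_inj) Ev E0.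
have th_sum (J : finType) (c : J -> S) (s : J -> 'rV[S]_#|RI|) (D : pred J) X :
    th (\sum_(i | D i) c i *: s i) X = \sum_(i | D i) c i *: th (s i) X.
  rewrite /th; under [RHS]eq_bigr => i _ do rewrite scaler_sumr.
  rewrite exchange_big; apply: eq_bigr => h _ /=.
  by rewrite summxE scaler_suml; apply: eq_bigr => i _; rewrite mxE scalerA.
have indep s : (forall X k, X \in trip -> k \in loc setT X -> ev (form k) (th s X) = 0) -> s = 0.
  move=> H; apply/rowP => i; rewrite mxE; have XT := HrX i.
  have [i0 E0] := rowI _ false XT; have [i1 E1] := rowI _ true XT.
  have [_ _ _ /(_ (s 0 i0) (s 0 i1))[k kX|H0 H1]] := HBX _ XT.
    by rewrite -!evZ -evD -(th2 s _ _ _ E0 E1); apply: H.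
  have Ei e j : enum_val j = (rX i, e) -> re i = e -> i = j.
    move=> Ej Ee; apply: enum_val_inj; rewrite Ej -Ee /rX /re.
    by case: (enum_val i).
  by case E: (re i); [rewrite (Ei _ _ E1 E) | rewrite (Ei _ _ E0 E)].
have coords (u : flat -> 'rV[S]_l) : (forall X, X \in trip -> tangent X m (u X)) ->
    exists s, forall X k, X \in trip -> k \in loc setT X ->
      ev (form k) (th s X) = ev (form k) (u X).
  move=> Hu.
  have Hs X : X \in trip -> exists s : 'rV[S]_#|RI|, forall X', X' \in trip ->
      forall k, k \in loc setT X' ->
      ev (form k) (th s X') = if X' == X then ev (form k) (u X) else 0.
    move=> XT; have [_ _ gen _] := HBX X XT.
    have [f1 [f2 E]] := gen (u X) (Hu X XT).
    exists (\row_i (if rX i == X then if re i then f2 else f1 else 0)) => X' X'T k kX'.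
    have [i0 E0] := rowI X' false X'T; have [i1 E1] := rowI X' true X'T.
    rewrite (th2 _ _ _ _ E0 E1) !mxE /rX /re E0 E1 /= evD !evZ.
    case: eqP => [EX|_]; last by rewrite !mul0r addr0.
    by rewrite EX in kX' *; rewrite (E k kX').
  have [s {}Hs] := choice_on (D := mem trip) 0 Hs.
  exists (\sum_(X in trip) 1 *: s X) => X k XT kX.
  rewrite th_sum ev_sum (bigD1 X) //= big1 ?addr0 => [|Y /andP[YT nYX]].
    by rewrite scale1r (Hs X XT X XT k kX) eqxx.
  by rewrite scale1r (Hs Y YT X XT k kX) eq_sym (negbTE nYX).
have [L LP] : exists L, L *m P = 1%:M.
  suff H j : exists s : 'rV[S]_#|RI|, row j 1%:M = s *m P.
    have [s Hs] := choice_fun H; exists (\matrix_j s j).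
    by apply/row_matrixP => j; rewrite row_mul rowK -Hs.
  have [X0T k0X neq] := Hc j.
  have [|g [u [Hg Hu]]] := onto (fun X k => if (X == cX j) && (k == ck j) then al k ^+ m k else 0).
    by move=> X k _ _; case: ifP => _; [exists 1; rewrite mul1r | apply: pdvd0].
  have [gq Egq] := choice_fun Hg.
  have [|s ths] := coords u.
    move=> X XT k kX; rewrite -[ev _ _](addKr (g k)) -(Hu X k XT kX) addrC.
    apply: pdvdB; last by exists (gq k).
    by case: ifP => _; [exists 1; rewrite mul1r | apply: pdvd0].
  have svs X k : X \in trip -> k \in loc setT X ->
      sv s X k = ((X == cX j) && (k == ck j))%:R - gq k.
    move=> XT kX; apply: (mulIf (alX_neq0 k (m k))); rewrite -ev_th // ths //.
    rewrite -[ev _ _](addKr (g k)) -(Hu X k XT kX) addrC mulrBl Egq.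
    by case: (_ && _); rewrite ?mul1r ?mul0r.
  exists s; apply/rowP => j'; rewrite sP !mxE; have [XT kX nX] := Hc j'.
  have [x0T kx0] := Hx0 (ck j'); rewrite !svs //.
  have -> : (x0 (ck j') == cX j) && (ck j' == ck j) = false.
    apply/negP => /andP[/eqP E /eqP E']; case/eqP: neq; rewrite -E'; apply/esym/E.
  have -> : (cX j' == cX j) && (ck j' == ck j) = (j == j').
    rewrite [RHS]eq_sym -[RHS](inj_eq enum_val_inj) /cX /ck.
    by case: (enum_val j) => a b; case: (enum_val j') => a' b'; rewrite xpair_eqE.
  by rewrite sub0r opprK subrK.
have [|n [b [b0 bgen bfree]]] := graded_kernel_free (d := fun i => dg (rX i) (re i))
    (e := fun j => m (ck j)) _ LP.
  move=> i j; rewrite mxE; have [XT kX _] := Hc j; have [x0T kx0] := Hx0 (ck j).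
  case: eqP => [->|_]; first exact: qhom.
  case: eqP => [->|_]; last exact: ghomog0.
  by apply/ghomogN/qhom.
(* Formality glues the local derivations given by an element of the kernel. *)
have glue (s : 'rV[S]_#|RI|) : s *m P = 0 -> exists u, forall X k, X \in trip -> k \in loc setT X ->
    ev (form k) u = ev (form k) (th s X).
  move=> s0; pose g k := ev (form k) (th s (x0 k)).
  have Hg X k : X \in trip -> k \in loc setT X -> g k = ev (form k) (th s X).
    move=> XT kX; have [x0T kx0] := Hx0 k; rewrite /g !ev_th //; congr (_ * _).
    have [->//|nX] := eqVneq X (x0 k).
    have in_ : (X, k) \in CI by rewrite 2!inE /= XT kX nX.
    pose j := enum_rank_in in_ (X, k).
    have Ej : enum_val j = (X, k) by rewrite enum_rankK_in.
    have := sP s j; rewrite s0 mxE /cX /ck Ej /= => /esym/eqP.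
    by rewrite subr_eq0 eq_sym => /eqP.
  have [|v Hv] := formal_extend (V := S) (g := g) ess formal.
    move=> p; have [XT kX _ _] := rel_indexP p.
    have [b1X b2X _ _] := Hb XT.
    by rewrite /frame_defect !(Hg _ _ XT) //; apply: (frame_defect_ev Hb).
  exists (\row_j v j) => X k XT kX; rewrite -Hg // Hv.
  by apply: eq_bigr => j _; rewrite mxE.
have [B HB] := choice_fun (fun i => glue (b i) (b0 i)).
exists n, B; split.
- move=> i k _; have [XT kX] := Hx0 k; exists (sv (b i) (x0 k) k).
  by rewrite der_app_lf (HB i _ _ XT kX) ev_th.
- move=> u Hu; have [|s ths] := coords (fun=> u).
    by move=> X _ k _; have [r Er] := Hu k (in_setT k); exists r; rewrite -der_app_lf.
  have [|c Ec] := bgen s.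
    apply/rowP => j; rewrite sP mxE; have [XT kX _] := Hc j; have [x0T kx0] := Hx0 (ck j).
    apply/eqP; rewrite subr_eq0; apply/eqP; apply: (mulIf (alX_neq0 (ck j) (m (ck j)))).
    by rewrite -(ev_th s _ _ XT kX) -(ev_th s _ _ x0T kx0) (ths _ _ XT kX) (ths _ _ x0T kx0).
  exists c => /=; apply: essential_ev => // k; have [XT kX] := Hx0 k.
  rewrite evB -(ths _ _ XT kX) Ec th_sum !ev_sum -sumrB big1 // => i _.
  by rewrite !evZ (HB i _ _ XT kX) subrr.
move=> c /= Hc0; apply: bfree; apply: indep => X k XT kX.
rewrite th_sum ev_sum -[RHS](ev0 (form k)) -Hc0 ev_sum; apply: eq_bigr => i _.
by rewrite !evZ (HB i _ _ XT kX).
Qed.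

End SurjectiveFree.

(** * Flats of rank at most one *)

Section Lattice.

Context {K : fieldType} {l : nat} (A : arrangement K l).
Notation S := {mpoly K[l]}.
Notation I := (ordinal (nhyp A)).
Notation form := (@Defs.form K l A).
Notation hyp := (@Defs.hyp K l A).
Notation al i := (lf (form (i : I))).
Notation flat := (Defs.flat A).
Notation loc := (@Defs.loc K l A).
Notation flats := (@Defs.flats K l A).

(** The whole space, the unique flat of rank zero. *)
Definition flatV : flat := flat_of set0.
Definition hflat (i : I) : flat := flat_of [set i].

Lemma val_flatV : val flatV = fullv.
Proof. by rewrite /flatV val_flat_of /center big_set0. Qed.

Lemma val_hflat i : val (hflat i) = hyp i.
Proof. by rewrite /hflat val_flat_of /center big_set1. Qed.

Lemma hflat_inj : injective hflat.
Proof. by move=> i j /(congr1 val); rewrite !val_hflat => /hyp_inj. Qed.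

Lemma mem_flats (B : {set I}) k (X : flat) :
  reflect (codim (val X) = k /\ exists2 C : {set I}, C \subset B & X = flat_of C) (X \in flats B k).
Proof.
rewrite inE; apply: (iffP andP) => [[/eqP cX /existsP[C /andP[sC /eqP E]]]|[cX [C sC E]]].
  by split=> //; exists C => //; apply: val_inj.
by split; [apply/eqP | apply/existsP; exists C; rewrite sC E val_flat_of eqxx].
Qed.

Lemma codim0 (X : flat) : codim (val X) = 0%N -> X = flatV.
Proof.
move=> H; apply: val_inj; rewrite val_flatV; apply/eqP; rewrite eqEdim subvf dimvf.
by rewrite /dim /= muln1; move/eqP: H; rewrite /codim subn_eq0.
Qed.

Lemma mem_flats0 (B : {set I}) (X : flat) : (X \in flats B 0) = (X == flatV).
Proof.
apply/mem_flats/eqP => [[/codim0 //]|->]; split; last by exists set0; rewrite ?sub0set.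
by rewrite val_flatV /codim dimvf /dim /= muln1 subnn.
Qed.

Lemma codim_hflat i : codim (val (hflat i)) = 1%N.
Proof. by rewrite val_hflat /codim; have := dim_hyp i; lia. Qed.

Lemma flats1P (B : {set I}) (X : flat) : reflect (exists2 i, i \in B & X = hflat i) (X \in flats B 1).
Proof.
apply: (iffP (mem_flats _ _ _)) => [[cX [C sC EX]]|[i iB ->]]; last first.
  by split; [exact: codim_hflat | exists [set i]; rewrite ?sub1set].
have [C0|[i iC]] := set_0Vmem C.
  by move: cX; rewrite EX C0 -/flatV val_flatV /codim dimvf /dim /= muln1 subnn.
exists i; first exact: (subsetP sC).
apply: val_inj; apply/eqP; rewrite eqEdim val_hflat EX val_flat_of center_sub //=.
move: cX; rewrite EX val_flat_of /codim; have := dim_hyp i; lia.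
Qed.

Lemma hflat_flats1 (B : {set I}) i : (hflat i \in flats B 1) = (i \in B).
Proof. by apply/flats1P/idP => [[j jB /hflat_inj ->]|] //; exists i. Qed.

Lemma loc_flatV (B : {set I}) : loc B flatV = set0.
Proof.
apply/setP => i; rewrite mem_loc in_set0 val_flatV; apply/negbTE; rewrite negb_and.
apply/orP; right; apply/negP => /dimvS; rewrite dimvf /dim /= muln1.
by have := dim_hyp i; lia.
Qed.

Lemma hyp_le i j : (hyp i <= hyp j)%VS -> i = j.
Proof.
move=> s; apply/(@hyp_inj K l A)/eqP; rewrite eqEdim s -ltnS !dim_hyp leqnn //.
Qed.

Lemma loc_hflat (B : {set I}) i : i \in B -> loc B (hflat i) = [set i].
Proof.
move=> iB; apply/setP => j; rewrite mem_loc in_set1 val_hflat.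
by apply/andP/eqP => [[_ /hyp_le]|->]; [move=> -> | rewrite subvv].
Qed.

Lemma le_flatV (X : flat) : flat_le flatV X.
Proof. by rewrite /flat_le val_flatV subvf. Qed.

Lemma le_hflat i (X : flat) : flat_le (hflat i) X = (i \in loc setT X).
Proof. by rewrite /flat_le val_hflat mem_locT. Qed.

Lemma flats_locT k (X Y : flat) :
  (Y \in flats (loc setT X) k) = (codim (val Y) == k) && flat_le Y X.
Proof.
apply/mem_flats/andP => [[cY [C sC EY]]|[/eqP cY le]].
  split; first exact/eqP.
  by rewrite /flat_le EY val_flat_of; apply: sub_center => i /(subsetP sC); rewrite mem_locT.
split=> //; have [C EY] := flat_ofP Y; exists C => //; apply/subsetP => i iC.
by rewrite mem_locT; apply: subv_trans le _; rewrite EY val_flat_of center_sub.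
Qed.

Lemma loc_loc (X Y : flat) : flat_le Y X -> loc (loc setT X) Y = loc setT Y.
Proof.
move=> le; apply/setP => i; rewrite mem_loc !mem_locT andb_idl //.
exact: subv_trans le.
Qed.

Lemma loc_top : loc setT (flat_of setT) = setT.
Proof. by apply/setP => i; rewrite mem_locT !inE val_flat_of center_sub. Qed.

(** * The relation spaces R_k *)

Context (w : I -> 'cV[K]_l) (Hw : forall i, (form i *m w i) 0 0 = 1).

Definition rproj {k} (x : rcarr A k.+1) (X : flat) : rcarr A k :=
  (x : {ffun flat -> rcarr A k}) X.

Lemma rproj0 k X : rproj (0 : rcarr A k.+1) X = 0.
Proof. by rewrite /rproj ffunE. Qed.

Lemma rproj_sum k X (J : Type) (r : seq J) (P : pred J) (F : J -> rcarr A k.+1) :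
  rproj (\sum_(j <- r | P j) F j) X = \sum_(j <- r | P j) rproj (F j) X.
Proof. by rewrite /rproj; apply: (big_morph (fun x : {ffun flat -> rcarr A k} => x X));
  [move=> x y; rewrite ffunE | rewrite ffunE]. Qed.

Lemma rproj_ext k (x y : rcarr A k.+1) : (forall X, rproj x X = rproj y X) -> x = y.
Proof. by move=> H; apply/ffunP => X; apply: H. Qed.

Lemma Rsp_den k (B : {set I}) (x : rcarr A k.+1) : sq_den (Rsp k.+1 B) x <-> x = 0.
Proof.
elim: k B x => [|k IH] B x.
  split=> [H|->]; last by move=> X; case: ifP => _; rewrite ffunE // => v _; rewrite mul0mx.
  apply: rproj_ext => X; rewrite rproj0; have := H X; rewrite mem_flats0.
  case: eqP => [->|_ //] /=; rewrite loc_flatV => H0.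
  apply/rowP => j; have v0 : (delta_mx j 0 : 'cV[K]_l) \in center (set0 : {set I}).
    by apply/mem_center => i; rewrite in_set0.
  have /matrixP/(_ 0 0) := H0 _ v0; rewrite !mxE (bigD1 j) //= big1 => [|i nij].
    by rewrite !mxE !eqxx mulr1 addr0.
  by rewrite mxE (negbTE nij) mulr0.
split=> [H|->].
  apply: rproj_ext => X; rewrite rproj0; have := H X; case: ifP => // _ /=.
  by move/(IH _ (rproj x X)).
by move=> X; case: ifP => _; rewrite ffunE //; apply/IH.
Qed.

(** Elements of R_2 are indexed by a hyperplane and then by the whole space; this
    one is the linear relation with coefficients c. *)
Definition relation_elt (c : I -> K) : rcarr A 2 :=
  [ffun Y : flat => [ffun Z : flat =>
     if Z == flatV then \sum_(i | Y == hflat i) c i *: form i else 0] : rcarr A 1].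

Lemma relation_eltE c Y Z : rproj (rproj (relation_elt c) Y) Z =
  if Z == flatV then \sum_(i | Y == hflat i) c i *: form i else 0.
Proof. by rewrite /rproj !ffunE. Qed.

Lemma relation_elt_hflat c i : rproj (rproj (relation_elt c) (hflat i)) flatV = c i *: form i.
Proof.
rewrite relation_eltE eqxx (big_pred1 i) // => j /=.
by rewrite (inj_eq hflat_inj) eq_sym.
Qed.

Lemma relation_elt_sum c : rproj (\sum_Y rproj (relation_elt c) Y) flatV = \sum_i c i *: form i.
Proof.
rewrite rproj_sum; under eq_bigr => Y _ do rewrite relation_eltE eqxx.
rewrite (exchange_big_dep xpredT) //=; apply: eq_bigr => i _.
by rewrite big_pred1_eq.
Qed.

Lemma Rsp1P (B : {set I}) (g : rcarr A 1) : sq_num (Rsp 1 B) g <->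
  (forall Z, Z != flatV -> rproj g Z = 0) /\ (forall v, v \in center B -> rproj g flatV *m v = 0).
Proof.
have E : (forall Z, Z != flatV -> rproj g Z = 0) -> rpi g = rproj g flatV.
  by move=> H; rewrite /rpi (bigD1 flatV) //= big1 ?addr0 // => Z /H.
split=> [[H1 H2]|[H1 H2]].
  have H0 Z : Z != flatV -> rproj g Z = 0.
    by move=> nZ; have := H1 Z; rewrite mem_flats0 (negbTE nZ).
  by split=> // v vB; rewrite -E //; apply: H2.
split; last by rewrite /= E.
by move=> Z; rewrite mem_flats0; case: eqP => // /eqP; apply: H1.
Qed.

Lemma Rsp2P (B : {set I}) (f : rcarr A 2) : sq_num (Rsp 2 B) f <->
  exists c : I -> K, [/\ forall i, i \notin B -> c i = 0,
    \sum_i c i *: form i = 0 & f = relation_elt c].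
Proof.
have rpiE (x : rcarr A 2) : rpi x = \sum_Y rproj x Y by [].
split=> [[H1 /Rsp_den H2]|[c [cB c0 ->]]].
  pose c i := (rproj (rproj f (hflat i)) flatV *m w i) 0 0.
  have fi i : i \in B -> rproj (rproj f (hflat i)) flatV = c i *: form i.
    move=> iB; have := H1 (hflat i); rewrite hflat_flats1 iB loc_hflat // => /Rsp1P[_ H].
    have [a Ea] : exists a, rproj (rproj f (hflat i)) flatV = a *: form i.
      exists (c i); apply/rowP => j.
      pose v : 'cV[K]_l := delta_mx j 0.
      have Ev (a : 'rV[K]_l) : a 0 j = (a *m v) 0 0 :> K.
        rewrite mxE (bigD1 j) //= big1 ?addr0 => [|h nhj]; first by rewrite mxE !eqxx mulr1.
        by rewrite mxE (negbTE nhj) mulr0.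
      have : v - (form i *m v) 0 0 *: w i \in center [set i].
        apply/mem_center => h; rewrite in_set1 => /eqP ->; apply/eqP.
        by rewrite mx11_eq0 mulmxBr -scalemxAr mxE [X in _ + X]mxE [X in _ - X]mxE Hw mulr1 subrr.
      move=> /H /eqP; rewrite mx11_eq0 mulmxBr -scalemxAr mxE [X in _ + X]mxE [X in _ - X]mxE.
      rewrite -/(c i) subr_eq0 => /eqP E; rewrite Ev E -Ev [RHS]mxE; exact: mulrC.
    by rewrite /c Ea -scalemxAl mxE Hw mulr1.
  have fN Y : Y \notin flats B 1 -> rproj f Y = 0.
    by move=> nY; have := H1 Y; rewrite (negbTE nY).
  have cB i : i \notin B -> c i = 0.
    by move=> iB; rewrite /c fN ?hflat_flats1 // rproj0 mul0mx mxE.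
  have Ef : f = relation_elt c.
    apply: rproj_ext => Y; apply: rproj_ext => Z; rewrite relation_eltE.
    have [YB|nYB] := boolP (Y \in flats B 1); last first.
      rewrite fN // rproj0; case: ifP => // _; rewrite big1 // => i /eqP EY.
      by rewrite cB ?scale0r // -hflat_flats1 -EY.
    have /flats1P[i iB EY] := YB; have := H1 Y; rewrite YB EY => /Rsp1P[HZ _].
    case: eqP => [->|/eqP nZ]; last exact: HZ.
    rewrite fi // (big_pred1 i) // => j /=.
    by rewrite (inj_eq hflat_inj) eq_sym.
  exists c; split=> //; rewrite -relation_elt_sum -Ef; have := congr1 (fun x => rproj x flatV) H2.
  by rewrite rproj0 rpiE.
split; last first.
  apply/Rsp_den; rewrite rpiE; apply: rproj_ext => Z; rewrite rproj0.
  have [->|nZ] := eqVneq Z flatV; first by rewrite relation_elt_sum.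
  by rewrite rproj_sum big1 // => Y _; rewrite relation_eltE (negbTE nZ).
move=> Y; case: ifP => [/flats1P[i iB ->]|/negbT nY].
  rewrite loc_hflat //; apply/Rsp1P; split=> [Z nZ|v /mem_center H].
    by rewrite -/(rproj _ _) relation_eltE (negbTE nZ).
  by rewrite -/(rproj (relation_elt c) (hflat i)) relation_elt_hflat -scalemxAl H ?set11 // scaler0.
apply: rproj_ext => Z; rewrite rproj0 -/(rproj _ _) relation_eltE; case: ifP => // _.
rewrite big1 // => i /eqP EY; rewrite cB ?scale0r //.
by rewrite -hflat_flats1 -EY.
Qed.

(** * The modules D_k and their coefficients *)

Context (m : I -> nat).

Definition cproj {k} (x : carr A k.+1) (X : flat) : carr A k :=
  (x : {ffun flat -> carr A k}) X.

Lemma cproj0 k X : cproj (0 : carr A k.+1) X = 0.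
Proof. by rewrite /cproj ffunE. Qed.
Lemma cprojD k X (x y : carr A k.+1) : cproj (x + y) X = cproj x X + cproj y X.
Proof. by rewrite /cproj ffunE. Qed.
Lemma cprojB k X (x y : carr A k.+1) : cproj (x - y) X = cproj x X - cproj y X.
Proof. by rewrite /cproj !ffunE. Qed.
Lemma cprojZ k X a (x : carr A k.+1) : cproj (a *: x) X = a *: cproj x X.
Proof. by rewrite /cproj ffunE. Qed.
Lemma cproj_sum k X (J : Type) (r : seq J) (P : pred J) (F : J -> carr A k.+1) :
  cproj (\sum_(j <- r | P j) F j) X = \sum_(j <- r | P j) cproj (F j) X.
Proof.
exact: (big_morph (fun x : carr A k.+1 => cproj x X) (cprojD X) (cproj0 k X)).
Qed.
Lemma cproj_ext k (x y : carr A k.+1) : (forall X, cproj x X = cproj y X) -> x = y.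
Proof. by move=> H; apply/ffunP => X; apply: H. Qed.

Lemma cproj_phi k Y X (x : carr A k.+1) :
  cproj (phi Y x) X = if flat_le X Y then cproj x X else 0.
Proof. by rewrite /cproj ffunE. Qed.

Lemma cproj_tau k (B : {set I}) Y (x : carr A k) :
  cproj (tau B x) Y = if Y \in flats B k then phi Y x else 0.
Proof. by rewrite /cproj ffunE. Qed.

Lemma Dmod1_num (B : {set I}) (y : carr A 1) :
  sq_num (Dmod m 1 B) y <-> forall Z, Z != flatV -> cproj y Z = 0.
Proof.
split=> H Z.
  by move=> nZ; have := H Z; rewrite mem_flats0 (negbTE nZ).
rewrite mem_flats0; case: eqP => [->|/eqP]; last exact: H.
by move=> i; rewrite loc_flatV in_set0.
Qed.

Lemma Dmod1_den (B : {set I}) (y : carr A 1) : sq_den (Dmod m 1 B) y <->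
  sq_num (Dmod m 1 B) y /\
  forall i, i \in B -> pdvd (al i ^+ m i) (ev (form i) (cproj y flatV)).
Proof.
split=> [[Hy [t Ht E]]|[Hy H]].
  split=> // i iB; have := E flatV; rewrite mem_flats0 eqxx => /= E0.
  have -> : cproj y flatV = t.
    by apply/subr0_eq; rewrite -[RHS]E0 -/(cproj (y - tau B t) flatV) cprojB cproj_tau mem_flats0 eqxx.
  by have [q Eq] := Ht i iB; exists q; rewrite -der_app_lf.
split=> //; exists (cproj y flatV).
  by move=> i iB; have [q Eq] := H i iB; exists q; rewrite der_app_lf.
move=> Z; rewrite mem_flats0 -/(cproj (y - tau B (cproj y flatV)) Z) cprojB cproj_tau mem_flats0.
case: eqP => [->|/eqP nZ] /=; first by rewrite subrr.
by rewrite subr0; move/Dmod1_num: Hy => ->.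
Qed.

Lemma DmodSS_num k (B : {set I}) (y : carr A k.+2) : sq_num (Dmod m k.+2 B) y <->
  (forall Y, Y \in flats B k.+1 -> sq_num (Dmod m k.+1 (loc B Y)) (cproj y Y)) /\
  (forall Y, Y \notin flats B k.+1 -> cproj y Y = 0).
Proof.
split=> [H|[H1 H2] Y]; last by case: ifP => [/H1|/negbT/H2].
by split=> Y YB; have := H Y; rewrite ?YB ?(negbTE YB).
Qed.

Lemma Dmod2_den (B : {set I}) (y : carr A 2) : sq_den (Dmod m 2 B) y <->
  sq_num (Dmod m 2 B) y /\ exists v, forall i, i \in B ->
    pdvd (al i ^+ m i) (ev (form i) (cproj (cproj y (hflat i)) flatV - v)).
Proof.
split=> [[Hy [x Hx E]]|[Hy [v Hv]]].
  split=> //; exists (cproj x flatV) => i iB; have := E (hflat i).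
  rewrite hflat_flats1 iB loc_hflat // => /Dmod1_den[_ /(_ i (set11 i))].
  by rewrite -/(cproj (y - tau B x) (hflat i)) !cprojB cproj_tau hflat_flats1 iB cproj_phi le_flatV.
pose x : carr A 1 := [ffun Z => if Z == flatV then v else 0].
have xE Z : cproj x Z = if Z == flatV then v else 0 by rewrite /cproj ffunE.
split=> //; exists x; first by apply/Dmod1_num => Z nZ; rewrite xE (negbTE nZ).
move=> Y; rewrite -/(cproj (y - tau B x) Y) cprojB cproj_tau.
case: (boolP (Y \in flats B 1)) => [YB|nY].
  have /flats1P[i iB EY] := YB; rewrite EY loc_hflat //; apply/Dmod1_den; split.
    apply/Dmod1_num => Z nZ; rewrite cprojB cproj_phi xE (negbTE nZ) if_same subr0.
    by move/DmodSS_num: Hy => [/(_ (hflat i))]; rewrite hflat_flats1 => /(_ iB) /Dmod1_num ->.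
  move=> j; rewrite in_set1 => /eqP ->; rewrite cprojB cproj_phi le_flatV xE eqxx.
  exact: Hv.
by rewrite subr0; move/DmodSS_num: Hy => [_ ->].
Qed.

(** The coefficient of a monomial in every entry. *)
Fixpoint kcoef (mu : 'X_{1..l}) (k : nat) : carr A k -> carr A k :=
  match k return carr A k -> carr A k with
  | 0 => vcoef mu
  | k'.+1 => fun x : {ffun flat -> carr A k'} => [ffun X => kcoef mu (x X)]
  end.

Lemma cproj_kcoef mu k X (x : carr A k.+1) : cproj (kcoef mu x) X = kcoef mu (cproj x X).
Proof. by rewrite /cproj ffunE. Qed.

Lemma vcoefB mu (x y : 'rV[S]_l) : vcoef mu (x - y) = vcoef mu x - vcoef mu y.
Proof. by apply/rowP => j; rewrite !mxE mcoeffB mpolyCB. Qed.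
Lemma vcoef0 mu : vcoef mu (0 : 'rV[S]_l) = 0.
Proof. by apply/rowP => j; rewrite !mxE mcoeff0 mpolyC0. Qed.

Lemma kcoef0 mu k : kcoef mu (0 : carr A k) = 0.
Proof.
elim: k => [|k IH]; first exact: vcoef0.
by apply: cproj_ext => X; rewrite cproj_kcoef !cproj0.
Qed.

Lemma kcoefB mu k (x y : carr A k) : kcoef mu (x - y) = kcoef mu x - kcoef mu y.
Proof.
elim: k x y => [|k IH] x y; first exact: vcoefB.
by apply: cproj_ext => X; rewrite cproj_kcoef !cprojB !cproj_kcoef.
Qed.

Lemma kcoef_phi mu k Y (x : carr A k) : kcoef mu (phi Y x) = phi Y (kcoef mu x).
Proof.
case: k x => [|k] x //; apply: cproj_ext => X.
by rewrite cproj_kcoef !cproj_phi cproj_kcoef; case: ifP => // _; rewrite kcoef0.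
Qed.

Lemma kcoef_tau mu k (B : {set I}) (x : carr A k) : kcoef mu (tau B x) = tau B (kcoef mu x).
Proof.
apply: cproj_ext => Y; rewrite cproj_kcoef !cproj_tau; case: ifP => _; last exact: kcoef0.
exact: kcoef_phi.
Qed.

Lemma kcoef_cdeg mu k (x : carr A k) : cdeg 0 (kcoef mu x).
Proof.
elim: k x => [|k IH] x /=; last by move=> X; rewrite -/(cproj _ _) cproj_kcoef; apply: IH.
move=> j; rewrite mxE -[_%:MP]mulr1 mul_mpolyC; apply: rpredZ; apply: dhomog1.
Qed.

Lemma kcoef_id k (x : carr A k) : cdeg 0 x -> kcoef 0%MM x = x.
Proof.
elim: k x => [|k IH] x /= H; last first.
  by apply: cproj_ext => X; rewrite cproj_kcoef IH //; apply: H.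
apply/rowP => j; rewrite mxE; apply/esym/msize1_polyC.
rewrite msizeE; apply/bigmax_leqP_seq => mu Hmu _; rewrite ltnS leqn0; apply/eqP.
by have /dhomogP := H j; apply.
Qed.

Lemma kcoef_expand k (x : carr A k) : exists d0, forall d, (d0 <= d)%N ->
  x = \sum_(mu : 'X_{1..l < d}) 'X_[mu] *: kcoef mu x.
Proof.
elim: k x => [|k IH] x.
  pose t : 'rV[S]_l := x; exists (\max_(j < l) msize (t 0%R j))%N => d Hd.
  apply/rowP => j; rewrite summxE.
  have Hj : (msize (t 0%R j) <= d)%N.
    by apply: leq_trans Hd; apply: (leq_bigmax (F := fun j => msize (t 0%R j))).
  rewrite -/t {1}(mpolywE Hj); apply: eq_bigr => mu _.
  by rewrite !mxE -mul_mpolyC mulrC.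
have [d0 Hd0] := choice_fun (fun X => IH (cproj x X)).
exists (\max_X d0 X)%N => d Hd; apply: cproj_ext => X; rewrite cproj_sum.
have HX : (d0 X <= d)%N by apply: leq_trans Hd; apply: (leq_bigmax (F := d0)).
rewrite {1}(Hd0 X d HX); apply: eq_bigr => mu _.
by rewrite cprojZ cproj_kcoef.
Qed.

(** An element is the sum of its coefficients, which have degree zero, times
    monomials. *)
Lemma kcoef_rspan k (P : carr A k -> Prop) (x : carr A k) :
  (forall mu, P (kcoef mu x)) -> rspan P x.
Proof.
move=> H; have [d /(_ d (leqnn d)) E] := kcoef_expand x.
pose e (i : 'I_#|{: 'X_{1..l < d}}|) : 'X_{1..l} := bmnm (enum_val i).
exists #|{: 'X_{1..l < d}}|, (fun i => 'X_[e i]), (fun i => kcoef (e i) x).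
split=> [i|]; first exact: H.
rewrite {1}E (reindex (@enum_val _ {: 'X_{1..l < d}})) /=.
  by [].
by exists enum_rank => mu _; [apply: enum_valK | apply: enum_rankK].
Qed.

End Lattice.

(** * Linear relations in a TF2 arrangement *)

Section TF2Consequences.

Context {K : fieldType} {l : nat} (A : arrangement K l).
Notation S := {mpoly K[l]}.
Notation I := (ordinal (nhyp A)).
Notation form := (@Defs.form K l A).
Notation al i := (lf (form (i : I))).
Notation flat := (Defs.flat A).
Notation loc := (@Defs.loc K l A).
Notation flats := (@Defs.flats K l A).
Notation trip := (L2trip A).
Notation flatV := (flatV A).

(** R_1 of a hyperplane is the line spanned by its form and R_2 the space of
    linear relations, so that R_3 consists of families of local relations with
    sum zero. *)
Lemma Rsp3P (B : {set I}) (f : rcarr A 3) : sq_num (Rsp 3 B) f <->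
  exists c : flat -> I -> K,
    [/\ forall Y i, ~~ ((Y \in flats B 2) && (i \in loc B Y)) -> c Y i = 0,
        forall Y, \sum_i c Y i *: form i = 0,
        forall i, \sum_Y c Y i = 0
      & forall Y, rproj f Y = relation_elt (c Y)].
Proof.
have [w Hw] := choice_fun (@form_dual _ _ A).
have relation_elt0 : relation_elt (fun=> 0) = 0 :> rcarr A 2.
  apply: rproj_ext => Y; apply: rproj_ext => Z; rewrite relation_eltE !rproj0.
  by case: ifP => // _; rewrite big1 // => i _; rewrite scale0r.
have sumP (c : flat -> I -> K) : (\sum_Y relation_elt (c Y) = 0 :> rcarr A 2) <->
    forall i, \sum_Y c Y i = 0.
  split=> H.
    move=> i; have := congr1 (fun x => rproj (rproj x (hflat i)) flatV) H.
    rewrite !rproj0 !rproj_sum; under eq_bigr => Y _ do rewrite relation_elt_hflat.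
    rewrite -scaler_suml => /eqP; rewrite scaler_eq0 (negbTE (form_neq0 i)) orbF.
    by move/eqP.
  apply: rproj_ext => Y; apply: rproj_ext => Z; rewrite !rproj_sum !rproj0.
  under eq_bigr => X _ do rewrite relation_eltE.
  case: (Z == flatV); last by rewrite big1.
  rewrite exchange_big big1 //= => i _.
  by rewrite -scaler_suml H scale0r.
split=> [[H1 /Rsp_den H2]|[c [cB c0 cs Ef]]]; last first.
  split; last first.
    apply/Rsp_den; apply: etrans (proj2 (sumP c) cs); apply: eq_bigr => Y _.
    exact: Ef.
  move=> Y; rewrite -/(rproj f Y) Ef; case: ifP => YB.
    by apply/(Rsp2P Hw); exists (c Y); split=> // i nY; apply: cB; rewrite YB.
  rewrite -relation_elt0; apply: rproj_ext => Z; apply: rproj_ext => Z'; rewrite !relation_eltE.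
  by case: ifP => // _; apply: eq_bigr => i _; rewrite cB ?YB.
have HY Y : exists c : I -> K,
    [/\ forall i, ~~ ((Y \in flats B 2) && (i \in loc B Y)) -> c i = 0,
        \sum_i c i *: form i = 0 & rproj f Y = relation_elt c].
  have := H1 Y; case: (boolP (Y \in flats B 2)) => YB /=.
    by move/(Rsp2P Hw) => [c [? ? ?]]; exists c.
  by move=> E; exists (fun=> 0); split; rewrite ?big1 ?relation_elt0 // => i _; rewrite scale0r.
have [c Hc] := choice_fun HY.
exists c; split; [| | |]; try by move=> Y; case: (Hc Y).
apply/sumP; apply: etrans H2; apply: eq_bigr => Y _; by case: (Hc Y).
Qed.

(** Pairing a family of relations in R_3(A_X) with the degree zero part of
    D_3(A_X): the pairing vanishes on the denominator of D_3(A_X), because the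
    relations are killed by vector fields and add up to zero.  Hence R_3(A_X)
    vanishes with S^3. *)
Lemma R3_local_zero (X : flat) (f : rcarr A 3) :
  sq_zero (Scx (fun _ : I => 1%N) 3) -> X \in flats setT 3 ->
  sq_num (Rsp 3 (loc setT X)) f -> f = 0.
Proof.
move=> S3 X3 /Rsp3P[c [cB c0 cs Ef]]; set B := loc setT X in cB.
pose Lam (y : carr A 3) : S :=
  \sum_Y \sum_i c Y i *: ev (form i) (cproj (cproj (cproj y Y) (hflat i)) flatV).
have LamD y z : Lam (y + z) = Lam y + Lam z.
  rewrite /Lam -big_split; apply: eq_bigr => Y _; rewrite -big_split; apply: eq_bigr => i _ /=.
  by rewrite !cprojD evD scalerDr.
have LamZ a y : Lam (a *: y) = a * Lam y.
  rewrite /Lam mulr_sumr; apply: eq_bigr => Y _; rewrite mulr_sumr; apply: eq_bigr => i _.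
  by rewrite !cprojZ evZ scalerAr.
have Lam0 : Lam 0 = 0 by rewrite -[X in Lam X](scale0r 0) LamZ mul0r.
have Lam_den y : sq_den (Dmod (fun _ : I => 1%N) 3 B) y -> cst (Lam y) = 0.
  move=> [_ [x _ E]].
  have Hx Y : exists v : 'rV[S]_l, forall i, (Y \in flats B 2) && (i \in loc B Y) ->
      pdvd (al i ^+ 1) (ev (form i)
        (cproj (cproj (cproj y Y) (hflat i)) flatV - cproj (cproj x (hflat i)) flatV - v)).
    have [YB|_] := boolP (Y \in flats B 2); last by exists 0.
    have := E Y; rewrite YB => /Dmod2_den[_ [v Hv]]; exists v => i /= iY.
    have := Hv i iY; rewrite -/(cproj (y - tau B x) Y) !cprojB cproj_tau YB cproj_phi.
    suff -> : flat_le (hflat i) Y by [].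
    by rewrite le_hflat mem_locT; move: iY; rewrite mem_loc => /andP[].
  have [v Hv] := choice_fun Hx.
  have EL : cst (Lam y) = \sum_Y \sum_i
      c Y i * cst (ev (form i) (cproj (cproj x (hflat i)) flatV) + ev (form i) (v Y)).
    rewrite /Lam cst_sum; apply: eq_bigr => Y _; rewrite cst_sum; apply: eq_bigr => i _.
    rewrite /cst mcoeffZ -/(cst _) -/(cst _).
    have [YB|nYB] := boolP ((Y \in flats B 2) && (i \in loc B Y)); last by rewrite cB ?mul0r.
    congr (_ * _); have := cst_dvd (ltn0Sn 0) (Hv Y i YB).
    by rewrite !evB !cstB cstD -addrA -opprD => /subr0_eq.
  rewrite EL; under eq_bigr => Y _ do under eq_bigr => i _ do rewrite cstD mulrDr.
  under eq_bigr => Y _ do rewrite big_split /=.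
  rewrite big_split /= [X in _ + X]big1 ?addr0 => [|Y _]; last first.
    rewrite -[LHS]/(\sum_i c Y i * (mcoeff 0%MM \o (ev^~ (v Y))) (form i)) /=.
    transitivity (cst (ev (\sum_i c Y i *: form i) (v Y))).
      rewrite ev_suml cst_sum; apply: eq_bigr => i _.
      by rewrite evZl /cst mcoeffZ.
    by rewrite c0 /ev big1 ?[cst 0]raddf0 // => j _; rewrite mxE scale0r.
  rewrite exchange_big big1 //= => i _.
  by rewrite -mulr_suml cs mul0r.
have [w Hw] := choice_fun (@form_dual _ _ A).
apply: rproj_ext => Y; rewrite Ef rproj0; apply: rproj_ext => Z; apply: rproj_ext => Z'.
rewrite relation_eltE !rproj0; case: ifP => // _; rewrite big1 // => i _.
suff -> : c Y i = 0 by rewrite scale0r.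
have [/andP[YB iY]|/cB //] := boolP ((Y \in flats B 2) && (i \in loc B Y)).
(* The family supported at (Y, i) where its value on the form of i is 1; its
   pairing with the relations is the coefficient c Y i. *)
pose y1 : carr A 1 := [ffun Z => if Z == flatV then vfield (w i) 1 else 0].
pose y2 : carr A 2 := [ffun Z => if Z == hflat i then y1 else 0].
pose y3 : carr A 3 := [ffun Z => if Z == Y then y2 else 0].
pose y4 : carr A 4 := [ffun Z => if Z == X then y3 else 0].
have y1E Z0 : cproj y1 Z0 = if Z0 == flatV then vfield (w i) 1 else 0 by rewrite /cproj ffunE.
have y2E Z0 : cproj y2 Z0 = if Z0 == hflat i then y1 else 0 by rewrite /cproj ffunE.
have y3E Z0 : cproj y3 Z0 = if Z0 == Y then y2 else 0 by rewrite /cproj ffunE.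
have y4E Z0 : cproj y4 Z0 = if Z0 == X then y3 else 0 by rewrite /cproj ffunE.
have y4num : sq_num (Dcx (fun _ : I => 1%N) 3) y4.
  move=> Z0; rewrite -/(cproj y4 Z0) y4E; case: (eqVneq Z0 X) => [->|_]; last first.
    case: ifP => // _; apply/DmodSS_num; split=> [Y' _|Y' _]; rewrite cproj0 //.
    apply/DmodSS_num; split=> [Y'' _|Y'' _]; rewrite cproj0 //.
    by apply/Dmod1_num => ? _; rewrite cproj0.
  rewrite X3; apply/DmodSS_num; split=> [Y' Y'B|Y' nY'].
    apply/DmodSS_num; split=> [Z1 Z1B|Z1 nZ1]; rewrite y3E;
      case: (eqVneq Y' Y) => [EY|_]; rewrite ?cproj0 //.
    - apply/Dmod1_num => Z2 nZ2; rewrite y2E; case: ifP => _; rewrite ?cproj0 //.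
      by rewrite y1E (negbTE nZ2).
    - by apply/Dmod1_num => Z2 _; rewrite cproj0.
    rewrite y2E; case: eqP => // EZ; case/negP: nZ1.
    by rewrite EZ EY hflat_flats1.
  by rewrite y3E; case: eqP => // EY; rewrite -EY (negbTE nY') in YB.
have y4deg : cdeg 0 y4.
  move=> Z0; rewrite -/(cproj y4 Z0) => Z1; rewrite -/(cproj _ _) => Z2; rewrite -/(cproj _ _) => Z3.
  rewrite -/(cproj _ _) y4E; case: ifP => _; rewrite ?y3E; do ?[case: ifP => _];
    rewrite ?cproj0 ?y2E; do ?[case: ifP => _]; rewrite ?cproj0 ?y1E; do ?[case: ifP => _] => j;
    rewrite mxE ?rpred0 //.
  by apply: rpredZ; apply: dhomog1.
have [|n [b [z [Hz Ey]]]] := S3 y4.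
  exists 1%N, (fun=> 1), (fun=> y4); split=> //.
  by rewrite big_ord1 scale1r.
have EL : Lam y3 = \sum_k b k * Lam (cproj (z k) X).
  have -> : y3 = \sum_k b k *: cproj (z k) X.
    have -> : y3 = cproj y4 X by rewrite y4E eqxx.
    by rewrite Ey cproj_sum; apply: eq_bigr => k _; rewrite cprojZ.
  by rewrite (big_morph _ LamD Lam0); apply: eq_bigr => k _; rewrite LamZ.
have Lz k : Lam (cproj (z k) X) = 0.
  have [Hden Hdeg] := Hz k; have := Hden X; rewrite X3 => /Lam_den.
  have : Lam (cproj (z k) X) \is 0.-homog.
    apply: rpred_sum => Y' _; apply: rpred_sum => h _; apply: rpredZ.
    apply: rpred_sum => j _; apply: rpredZ.
    exact: (Hdeg X Y' (hflat h) flatV j).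
  move=> /dhomogP Hh Hc; rewrite -[RHS](mpolyC0 l) -Hc; apply: msize1_polyC.
  rewrite msizeE; apply/bigmax_leqP_seq => mu Hmu _.
  by rewrite ltnS leqn0; apply/eqP/Hh.
move: EL; rewrite big1 => [|k _]; last by rewrite Lz mulr0.
rewrite /Lam (bigD1 Y) //= [X in _ + X]big1 ?addr0 => [|Y' nY]; last first.
  by rewrite big1 // => h _; rewrite y3E (negbTE nY) !cproj0 ev0 scaler0.
rewrite (bigD1 i) //= [X in _ + X]big1 ?addr0 => [|h nh]; last first.
  by rewrite y3E eqxx y2E (inj_eq (@hflat_inj _ _ A)) (negbTE nh) cproj0 ev0 scaler0.
rewrite y3E eqxx y2E eqxx y1E eqxx ev_vfield Hw scale1r => /(congr1 cst).
by rewrite /cst mcoeffZ mcoeff1 eqxx mulr1 mcoeff0.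
Qed.

Context (tf2 : TF2 A) (rank3 : (3 <= arr_rank [set: I])%N).

Lemma TF2_kformal : kformal 3 [set: I].
Proof.
have [tf _] := tf2; have := tf (flat_of setT) 3; rewrite loc_top; apply.
by rewrite rank3.
Qed.

Lemma TF2_R3_zero (f : rcarr A 3) : sq_num (Rsp 3 [set: I]) f -> f = 0.
Proof.
move=> Hf; have [x Hx /Rsp_den/subr0_eq ->] := TF2_kformal (j := 3%N) isT Hf.
rewrite /rpi big1 // => X _; have := Hx X; case: ifP => // X3.
by apply: R3_local_zero X3; apply: (tf2.2 3).
Qed.

Section Frame.
Context (b1 b2 : flat -> I) (w1 w2 : flat -> 'cV[K]_l).
Context (Hb : is_frame b1 b2 w1 w2).

(** Near a triple flat, a relation is orthogonal to every column killed by [relation_mx],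
    since such a column is linear there; two different hyperplanes carry no
    relation. *)
Lemma local_relation_sub (X : flat) (c : I -> K) : X \in flats setT 2 ->
  (forall i, i \notin loc setT X -> c i = 0) -> \sum_i c i *: form i = 0 ->
  (\row_i c i <= relation_mx b1 b2 w1 w2)%MS.
Proof.
move=> X2 cX c0; have [XT|nXT] := boolP (X \in trip).
  rewrite submxE; apply/eqP/rowP => j; rewrite [RHS]mxE.
  pose g i : K^o := cokermx (relation_mx b1 b2 w1 w2) i j.
  have Hg (p : 'I_#|rel_index b1 b2|) : frame_defect b1 b2 w1 w2 (enum_val p).1 (enum_val p).2 g = 0.
    rewrite -relation_mx_defect; have := mulmx_coker (relation_mx b1 b2 w1 w2).
    by move/matrixP/(_ p j); rewrite !mxE.
  have gE := frame_defect0_eq Hb XT (g := g) _.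
  have {}gE k : k \in loc setT X ->
      g k = (form k *m w1 X) 0 0 *: g (b1 X) + (form k *m w2 X) 0 0 *: g (b2 X).
    by apply: gE => p <-; apply: Hg.
  have lin (v : 'cV[K]_l) : \sum_i c i * (form i *m v) 0 0 = 0.
    have := congr1 (fun x : 'rV_l => (x *m v) 0 0) c0; rewrite mul0mx mulmx_suml summxE [RHS]mxE.
    by move=> E; rewrite -[RHS]E; apply: eq_bigr => i _; rewrite -scalemxAl [RHS]mxE.
  rewrite mxE.
  transitivity (\sum_i (c i * (form i *m w1 X) 0 0 * g (b1 X)
                      + c i * (form i *m w2 X) 0 0 * g (b2 X))).
    apply: eq_bigr => k _; rewrite mxE -/(g k).
    have [kX|/cX ->] := boolP (k \in loc setT X); last by rewrite !mul0r addr0.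
    by rewrite gE // mulrDr -!mulrA.
  by rewrite big_split /= -!mulr_suml !lin !mul0r addr0.
suff c00 i : c i = 0.
  by have -> : \row_i c i = 0 by [apply/rowP => i; rewrite !mxE]; apply: sub0mx.
have [iX|/cX //] := boolP (i \in loc setT X).
have cardX : (#|loc setT X| <= 2)%N.
  by move: X2 nXT; rewrite mem_flatsT mem_trip => ->; rewrite -ltnNge.
have [v [vi vo]] : exists v : 'cV[K]_l, (form i *m v) 0 0 = 1 /\
    forall h, h \in loc setT X -> h != i -> (form h *m v) 0 0 = 0.
  have [/existsP[h /andP[hX nhi]]|/existsPn none] :=
    boolP [exists h, (h \in loc setT X) && (h != i)].
    have [v [vi vh]] : exists v : 'cV[K]_l, (form i *m v) 0 0 = 1 /\ (form h *m v) 0 0 = 0.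
      by apply: dual_pair; rewrite eq_sym.
    exists v; split=> // h' h'X nh'; suff -> : h' = h by [].
    apply/eqP; apply: contraT => nhh; move: cardX.
    by rewrite (cardsD1 i) iX (cardsD1 h) in_setD1 nhi hX (cardsD1 h') !in_setD1 nhh nh' h'X.
  have [v vi] := form_dual i; exists v; split=> // h hX nh.
  by have := none h; rewrite hX nh.
have := congr1 (fun x : 'rV_l => (x *m v) 0 0) c0; rewrite mul0mx mulmx_suml summxE [RHS]mxE.
rewrite (bigD1 i) //= big1 => [|h nh]; first by rewrite -scalemxAl mxE vi mulr1 addr0.
rewrite -scalemxAl mxE; have [hX|/cX ->] := boolP (h \in loc setT X); last by rewrite mul0r.
by rewrite vo // mulr0.
Qed.

Lemma TF2_triple_formal : triple_formal b1 b2 w1 w2.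
Proof.
have [w Hw] := choice_fun (@form_dual _ _ A).
apply/row_subP => j; set c := row j _.
have c0 : \sum_i c 0 i *: form i = 0.
  by rewrite -rel_sum; apply/sub_kermxP; apply: row_sub.
have [|x Hx /Rsp_den/subr0_eq E] := TF2_kformal (j := 2%N) isT (y := relation_elt (fun i => c 0 i)).
  by apply/(Rsp2P Hw); exists (fun i => c 0 i); split=> // i; rewrite in_setT.
have Hd X : exists d : I -> K, [/\ X \in flats setT 2 -> forall i, i \notin loc setT X -> d i = 0,
    X \notin flats setT 2 -> forall i, d i = 0,
    \sum_i d i *: form i = 0 & rproj (x : rcarr A 3) X = relation_elt d].
  have := Hx X; case: (boolP (X \in flats setT 2)) => XT /=.
    by move=> /(Rsp2P Hw)[d [? ? ?]]; exists d.
  move=> E0; exists (fun=> 0); split=> //; first by rewrite big1 // => i _; rewrite scale0r.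
  have -> : rproj (x : rcarr A 3) X = 0 by exact: E0.
  apply: (@rproj_ext _ _ _ 1%N) => Y; apply: rproj_ext => Z; rewrite relation_eltE !rproj0.
  by case: ifP => // _; rewrite big1 // => i _; rewrite scale0r.
have [d Hdd] := choice_fun Hd.
have -> : c = \sum_X \row_i d X i.
  apply/rowP => i; rewrite summxE; have := congr1 (fun y => rproj (rproj y (hflat i)) flatV) E.
  rewrite relation_elt_hflat /rpi !rproj_sum => Ei; have /eqP : (c 0 i - \sum_X d X i) *: form i = 0.
    rewrite scalerBl Ei scaler_suml -sumrB big1 // => X _.
    have [_ _ _ EX] := Hdd X; rewrite -/(rproj (x : rcarr A 3) X) EX relation_elt_hflat subrr //.
  rewrite scaler_eq0 (negbTE (form_neq0 i)) orbF subr_eq0 => /eqP ->.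
  by apply: eq_bigr => X _; rewrite mxE.
apply: summx_sub => X _; have [d1 d2 d3 _] := Hdd X.
have [X2|X2] := boolP (X \in flats setT 2); first by apply: (local_relation_sub X2 (d1 X2)).
have -> : \row_i d X i = 0 by apply/rowP => i; rewrite !mxE d2.
exact: sub0mx.
Qed.

Lemma TF2_row_free : row_free (relation_mx b1 b2 w1 w2).
Proof.
rewrite -kermx_eq0; apply/eqP/row_matrixP => j; rewrite row0; set c := row j _.
have cR : c *m relation_mx b1 b2 w1 w2 = 0 by apply/sub_kermxP; apply: row_sub.
pose d X i := \sum_(p | (enum_val p).1 == X) c 0 p * relation_mx b1 b2 w1 w2 p i.
pose f : rcarr A 3 := [ffun X => relation_elt (d X)].
have fE X : rproj f X = relation_elt (d X) by rewrite /rproj ffunE.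
have Rm_supp p i : i \notin loc setT (enum_val p).1 -> relation_mx b1 b2 w1 w2 p i = 0.
  have [XT kX _ _] := rel_indexP p; have [b1X b2X _ _] := Hb XT => ni.
  have ne h : h \in loc setT (enum_val p).1 -> (i == h) = false.
    by move=> hX; apply: contraNF ni => /eqP ->.
  by rewrite mxE !ne // !mulr0n !subr0.
have f0 : f = 0.
  apply: TF2_R3_zero; apply/Rsp3P; exists d; split=> //.
  - move=> X i; rewrite negb_and => H; rewrite /d big1 // => p /eqP EX.
    have [XT _ _ _] := rel_indexP p; rewrite EX in XT; case/orP: H => [|ni].
      by move: XT; rewrite mem_trip mem_flatsT => /andP[-> _].
    by rewrite Rm_supp ?mulr0 // EX.
  - move=> X; under eq_bigr => i _ do rewrite /d scaler_suml.
    rewrite exchange_big big1 //= => p _.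
    under eq_bigr => i _ do rewrite -scalerA.
    rewrite -scaler_sumr; have [XT kX _ _] := rel_indexP p.
    by rewrite (@relation_mx_defect _ _ _ _ _ _ _ _ form) (frame_defect_form Hb) // scaler0.
  move=> i; rewrite /d (exchange_big_dep xpredT) //=.
  under eq_bigr => p _ do [under eq_bigl => X do rewrite eq_sym; rewrite big_pred1_eq].
  by move/rowP/(_ i): cR; rewrite !mxE.
apply/rowP => p; rewrite [RHS]mxE.
have := congr1 (fun y => rproj (rproj (rproj y (enum_val p).1) (hflat (enum_val p).2)) flatV) f0.
rewrite !rproj0 fE relation_elt_hflat => /eqP; rewrite scaler_eq0 (negbTE (form_neq0 _)) orbF.
have [XT kX n1 n2] := rel_indexP p.
have Rp : relation_mx b1 b2 w1 w2 p (enum_val p).2 = 1.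
  by rewrite mxE eqxx (negbTE n1) (negbTE n2) !mulr0n !subr0.
have Rq q : (enum_val q).1 = (enum_val p).1 -> q != p ->
    relation_mx b1 b2 w1 w2 q (enum_val p).2 = 0.
  move=> EX nqp; rewrite mxE EX (negbTE n1) (negbTE n2) !mulr0n !subr0.
  case: eqP => [E|//]; case/negP: nqp; rewrite -(inj_eq enum_val_inj).
  by rewrite [enum_val q]surjective_pairing [enum_val p]surjective_pairing EX E.
rewrite /d (bigD1 p) //= big1 => [|q /andP[/eqP EX nqp]]; last by rewrite Rq ?mulr0.
by rewrite Rp mulr1 addr0 => /eqP.
Qed.

End Frame.
End TF2Consequences.

(** * Irreducibility *)

Section Irreducible.

Context {K : fieldType} {l : nat} (A : arrangement K l).
Notation I := (ordinal (nhyp A)).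
Notation form := (@Defs.form K l A).
Notation hyp := (@Defs.hyp K l A).
Notation flat := (Defs.flat A).
Notation loc := (@Defs.loc K l A).
Notation trip := (L2trip A).

Lemma product_hyp (V1 V2 : {vspace 'cV[K]_l}) i :
  (V1 :&: V2 = 0)%VS -> (V1 + V2 = fullv)%VS -> (V1 <= hyp i)%VS ->
  exists H2 : {vspace 'cV[K]_l},
    [/\ (H2 <= V2)%VS, (\dim H2).+1 = \dim V2 & hyp i = (V1 + H2)%VS].
Proof.
move=> cap0 sumT sub; exists (V2 :&: hyp i)%VS.
have E : hyp i = (V1 + (V2 :&: hyp i))%VS by rewrite vspace_modl // sumT capfv.
split=> //; first exact: capvSl.
have d1 : (\dim V1 + \dim V2 = l)%N.
  by rewrite -dimv_disjoint_sum // sumT dimvf /dim /= muln1.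
have d2 : (\dim V1 + \dim (V2 :&: hyp i) = \dim (hyp i))%N.
  rewrite [in RHS]E dimv_disjoint_sum //; apply/eqP; rewrite -subv0 -cap0 capvA.
  exact: capvSl.
by have := dim_hyp i; move: d1 d2; lia.
Qed.

Context (irr : irreducible_arr A) (rank3 : (3 <= arr_rank [set: I])%N).

(** An arrangement with nonzero center T is the product of the empty
    arrangement in T with an arrangement in a complement. *)
Lemma irreducible_essential : essential_arr A.
Proof.
move=> v Hv; apply/eqP; apply: contraT => nv; case: irr.
exists (center [set: I]), (center [set: I])^C%VS; split.
- apply: contraNneq nv => E0; rewrite -memv0 -E0.
  by apply/mem_center => i _; apply: Hv.
- apply/eqP => E0; have := addv_complf (center [set: I]); rewrite E0 addv0 => E.
  by move: rank3; rewrite /arr_rank E /codim dimvf /dim /= muln1 subnn.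
- exact: capv_compl.
- exact: addv_complf.
move=> i; right; apply: product_hyp; [exact: capv_compl | exact: addv_complf |].
by apply: center_sub; rewrite in_setT.
Qed.

Lemma essential_center : essential_arr A -> center [set: I] = 0%VS.
Proof.
move=> ess; apply/eqP; rewrite -subv0; apply/subvP => v /mem_center Hv.
by rewrite memv0; apply/eqP/ess => i; apply: Hv; rewrite in_setT.
Qed.

Lemma essential_arr_rank : essential_arr A -> arr_rank [set: I] = l.
Proof. by move=> /essential_center E; rewrite /arr_rank E /codim dimv0 subn0. Qed.

Context (b1 b2 : flat -> I) (w1 w2 : flat -> 'cV[K]_l) (Hb : is_frame b1 b2 w1 w2).
Context (formal : triple_formal b1 b2 w1 w2).

(** By formality, a set of hyperplanes which is not met properly by any
    triple flat splits off as a factor. *)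
Lemma irreducible_block (B : {set I}) : B != set0 ->
  (forall X i j, X \in trip -> i \in loc setT X -> j \in loc setT X -> i \in B -> j \in B) ->
  B = setT.
Proof.
move=> B0 HB; have ess := irreducible_essential.
apply/eqP; apply: contraT => nBT; case: irr.
have [i0 i0B] := set0Pn _ B0.
have [j0 j0C] : exists j, j \in ~: B.
  by apply/set0Pn; rewrite -setCT (inj_eq (@setC_inj _)).
have cap0 : (center (~: B) :&: center B = 0)%VS.
  apply/eqP; rewrite -subv0; apply/subvP => v.
  rewrite memv_cap => /andP[/mem_center HC /mem_center HB'].
  rewrite memv0; apply/eqP/ess => i; have [/HB' //|nB] := boolP (i \in B).
  by apply: HC; rewrite in_setC.
have sumT : (center (~: B) + center B = fullv)%VS.
  apply/eqP; rewrite eqEsubv subvf /=; apply/subvP => v _.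
  have [|u Hu] := formal_extend (V := K^o)
    (g := fun i => if i \in B then (form i *m v) 0 0 else 0) ess formal.
    move=> p; have [XT kX _ _] := rel_indexP p; have [b1X b2X _ _] := Hb XT.
    have E i j : i \in loc setT (enum_val p).1 -> j \in loc setT (enum_val p).1 ->
        (i \in B) = (j \in B).
      by move=> iX jX; apply/idP/idP; apply: HB; eauto.
    rewrite /frame_defect -(E _ _ kX b1X) -(E _ _ kX b2X).
    case: (_ \in B); last by rewrite !scaler0 !subr0.
    rewrite {1}(frame_span Hb XT kX) mulmxDl -!scalemxAl.
    have -> (x y : K) (a b : 'M[K]_1) : (x *: a + y *: b) 0 0 = x * a 0 0 + y * b 0 0.
      by rewrite !mxE.
    by rewrite -addrA -opprD; apply: subrr.
  pose v1 : 'cV[K]_l := \col_j u j.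
  have Ev1 i : (form i *m v1) 0 0 = if i \in B then (form i *m v) 0 0 else 0.
    by rewrite Hu mxE; apply: eq_bigr => j _; rewrite mxE.
  rewrite -[v](subrK v1) addrC; apply: memv_add.
    apply/mem_center => i; rewrite in_setC => nB; apply/eqP.
    by rewrite mx11_eq0 Ev1 (negbTE nB).
  apply/mem_center => i iB; apply/eqP; rewrite mx11_eq0 mulmxBr mxE [X in _ + X]mxE.
  by rewrite Ev1 iB subrr.
have cap0' : (center B :&: center (~: B) = 0)%VS by rewrite capvC.
have sumT' : (center B + center (~: B) = fullv)%VS by rewrite addvC.
have ntop (D : {set I}) i : i \in D -> center D != fullv.
  move=> iD; apply/eqP => E; have := center_sub iD; rewrite E => /dimvS.
  by rewrite dimvf /dim /= muln1; have := dim_hyp i; lia.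
exists (center (~: B)), (center B); split=> //.
- by apply/eqP => E; case/eqP: (ntop _ _ i0B); rewrite -sumT E add0v.
- by apply/eqP => E; case/eqP: (ntop _ _ j0C); rewrite -sumT E addv0.
move=> i; have [iB|nB] := boolP (i \in B); [left|right].
  have [H1 [s d E]] := product_hyp cap0' sumT' (center_sub iB).
  by exists H1; split=> //; rewrite addvC.
by apply: product_hyp => //; apply: center_sub; rewrite in_setC.
Qed.

Lemma rank_le_nhyp : (l <= nhyp A)%N.
Proof.
by have := rank_leq_row (form_mx A); rewrite (essential_rank irreducible_essential).
Qed.

Lemma rank3_l : (3 <= l)%N.
Proof. by move: rank3; rewrite (essential_arr_rank irreducible_essential). Qed.

(** A hyperplane on no triple flat splits off by itself. *)
Lemma exists_trip (k : I) : exists X, X \in trip /\ k \in loc setT X.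
Proof.
apply: NNPP => none; have E : [set k] = [set: I].
  apply: irreducible_block; first by apply/set0Pn; exists k; rewrite set11.
  move=> X i j XT iX _; rewrite in_set1 => /eqP Ei; case: none; exists X.
  by rewrite -Ei.
have := cardsT I; rewrite -E cards1 card_ord => n1.
have := rank_le_nhyp; have := rank3_l; rewrite -n1; lia.
Qed.

(** In case of equality each hyperplane lies on one triple flat only, so the
    hyperplanes through one triple flat split off. *)
Lemma nhyp_lt_sum : (nhyp A < \sum_(X in trip) locn X)%N.
Proof.
have [x0 Hx0] := choice_fun exists_trip.
rewrite -card_trip_pairs; pose h k := (x0 k, k).
have hinj : injective h by move=> i j [].
have sub : h @: setT \subset trip_pairs A.
  apply/subsetP => _ /imsetP[k _ ->]; rewrite inE /=; have [-> ->] := Hx0 k; done.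
have := subset_leq_card sub; rewrite card_imset // cardsT card_ord leq_eqVlt.
case/predU1P => [E|//]; exfalso.
have {}sub : h @: setT = trip_pairs A.
  have EC : #|h @: [set: I]| = #|trip_pairs A| by rewrite card_imset // cardsT card_ord.
  by apply/eqP; rewrite eqEcard sub EC leqnn.
have x0E X k : X \in trip -> k \in loc setT X -> X = x0 k.
  move=> XT kX; have : (X, k) \in trip_pairs A by rewrite inE /= XT kX.
  by rewrite -sub => /imsetP[k' _ [-> ->]].
have n0 : (0 < nhyp A)%N by have := rank_le_nhyp; have := rank3_l; lia.
pose k0 := Ordinal n0; have [XT kX] := Hx0 k0.
have BT : loc setT (x0 k0) = setT.
  apply: irreducible_block; first by apply/set0Pn; exists k0.
  by move=> X i j XT' iX jX iB; rewrite (x0E _ _ XT iB) -(x0E _ _ XT' iX).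
have : (val (x0 k0) <= center [set: I])%VS.
  by apply: sub_center => i _; rewrite -mem_locT BT in_setT.
rewrite (essential_center irreducible_essential) subv0 => /eqP E0.
move: XT; rewrite mem_trip E0 /codim dimv0 subn0 => /andP[/eqP l2 _].
by have := rank3_l; rewrite l2.
Qed.

End Irreducible.

(** * The cokernel of iota *)

Section Cokernels.

Context {K : fieldType} {l : nat} (A : arrangement K l).
Notation S := {mpoly K[l]}.
Notation I := (ordinal (nhyp A)).
Notation form := (@Defs.form K l A).
Notation al i := (lf (form (i : I))).
Notation flat := (Defs.flat A).
Notation loc := (@Defs.loc K l A).
Notation trip := (L2trip A).
Context (m : I -> nat).

Definition xcomp (z : xcarr A) (X : flat) (i : I) : S :=
  ((z : {ffun flat -> hcarr A}) X : {ffun I -> S^o}) i.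

Lemma xcompD X i (y z : xcarr A) : xcomp (y + z) X i = xcomp y X i + xcomp z X i.
Proof. by rewrite /xcomp !ffunE. Qed.
Lemma xcompB X i (y z : xcarr A) : xcomp (y - z) X i = xcomp y X i - xcomp z X i.
Proof. by rewrite /xcomp !ffunE. Qed.
Lemma xcompZ X i a (z : xcarr A) : xcomp (a *: z) X i = a * xcomp z X i.
Proof. by rewrite /xcomp !ffunE. Qed.
Lemma xcomp0 X i : xcomp 0 X i = 0.
Proof. by rewrite /xcomp !ffunE. Qed.
Lemma xcomp_sum X i (J : Type) (r : seq J) (P : pred J) (F : J -> xcarr A) :
  xcomp (\sum_(j <- r | P j) F j) X i = \sum_(j <- r | P j) xcomp (F j) X i.
Proof. exact: (big_morph (fun z => xcomp z X i) (@xcompD X i) (xcomp0 X i)). Qed.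

Lemma xcomp_ext (y z : xcarr A) : (forall X i, xcomp y X i = xcomp z X i) -> y = z.
Proof. by move=> H; apply/ffunP => X; apply/ffunP => i; apply: H. Qed.

Lemma xcomp_in X i (g : S) Y j :
  xcomp (inXH X i g) Y j = if (Y == X) && (j == i) then g else 0.
Proof. by rewrite /xcomp !ffunE. Qed.

Lemma xcomp_sum_in (P : flat -> I -> S) Y j :
  xcomp (\sum_(X in trip) \sum_(i in loc setT X) inXH X i (P X i)) Y j =
  if (Y \in trip) && (j \in loc setT Y) then P Y j else 0.
Proof.
rewrite xcomp_sum; have [YT|nYT] /= := boolP (Y \in trip); last first.
  rewrite big1 // => X XT; rewrite xcomp_sum big1 // => i _; rewrite xcomp_in.
  by case: eqP => // E; rewrite E XT in nYT.
rewrite (bigD1 Y) //= [X in _ + X]big1 ?addr0 => [|X /andP[_ nX]]; last first.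
  rewrite xcomp_sum big1 // => i _; rewrite xcomp_in eq_sym (negbTE nX) //.
rewrite xcomp_sum; have [jY|njY] := boolP (j \in loc setT Y); last first.
  rewrite big1 // => i iY; rewrite xcomp_in eqxx /=.
  by case: eqP => // E; rewrite E iY in njY.
rewrite (bigD1 j) //= xcomp_in !eqxx big1 ?addr0 // => i /andP[_ ni].
by rewrite xcomp_in eqxx eq_sym (negbTE ni).
Qed.

Definition hcomp (g : hcarr A) (i : I) : S := (g : {ffun I -> S^o}) i.

Lemma xcomp_iota g Y j :
  xcomp (iota_J g) Y j = if (Y \in trip) && (j \in loc setT Y) then hcomp g j else 0.
Proof. exact: (xcomp_sum_in (fun _ i => hcomp g i)). Qed.

Lemma xcomp_psi (t : {ffun flat -> 'rV[S]_l}) Y j :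
  xcomp (sum_psi t) Y j =
  if (Y \in trip) && (j \in loc setT Y) then ev (form j) (t Y) else 0.
Proof.
rewrite -(der_app_lf (t Y)).
exact: (xcomp_sum_in (fun X i => der_app (t X) (formp i))).
Qed.

Lemma JXH_num z : sq_num (JXH m) z <->
  (forall X i, pdvd (al i ^+ m i) (xcomp z X i)) /\
  (forall X i, ~~ ((X \in trip) && (i \in loc setT X)) -> xcomp z X i = 0).
Proof.
split=> [H|[H1 H2] X].
  have Hout X i : ~~ ((X \in trip) && (i \in loc setT X)) -> xcomp z X i = 0.
    have := H X; case: (boolP (X \in trip)) => _ /= => [/(_ i)|HX _].
      by move=> Hi /negbTE ni; rewrite ni in Hi.
    by rewrite /xcomp HX ffunE.
  split=> // X i; have [/andP[XT iX]|/Hout ->] :=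
    boolP ((X \in trip) && (i \in loc setT X)); last exact: pdvd0.
  by have := H X; rewrite XT => /(_ i); rewrite iX.
case: ifP => XT.
  move=> i; case: ifP => iX; first exact: (H1 X i).
  by apply: (H2 X i); rewrite XT iX.
by apply/ffunP => i; rewrite ffunE; apply: (H2 X i); rewrite XT.
Qed.

Lemma JXH_den z : sq_den (JXH m) z <-> z = 0.
Proof.
split=> [H|-> X]; last first.
  by case: ifP => _; [move=> i; case: ifP => _; rewrite !ffunE | rewrite ffunE].
apply: xcomp_ext => X i; rewrite xcomp0; have := H X; case: ifP => [_ /(_ i)|_ E].
  by case: ifP.
by rewrite /xcomp E ffunE.
Qed.

Lemma JH_num g : sq_num (JH m) g <-> forall i, pdvd (al i ^+ m i) (hcomp g i).
Proof. by split=> H i; have := H i; rewrite in_setT. Qed.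

Lemma coker_iota_den z : sq_den (coker_iota m) z <->
  sq_num (JXH m) z /\ exists2 g, (forall i, pdvd (al i ^+ m i) (hcomp g i)) & z = iota_J g.
Proof.
split=> [[Hz [g /JH_num Hg /JXH_den/subr0_eq E]]|[Hz [g Hg E]]]; first by split=> //; exists g.
by split=> //; exists g; [apply/JH_num | apply/JXH_den; rewrite E subrr].
Qed.

Lemma DX_num (t : {ffun flat -> 'rV[S]_l}) : sq_num (DX m) t <->
  (forall X, X \in trip -> tangent X m (t X)) /\ (forall X, X \notin trip -> t X = 0).
Proof.
split=> [H|[H1 H2] X].
  split=> X XT; have := H X; rewrite ?XT ?(negbTE XT) // => HX i iX.
  by have [q Eq] := HX i iX; exists q; rewrite -der_app_lf.
case: ifP => [XT i iX|/negbT/H2 //].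
by have [q Eq] := H1 X XT i iX; exists q; rewrite der_app_lf.
Qed.

Lemma sq_surj_psi : sq_surj (DX m) (coker_iota m) (@sum_psi K l A) <-> psi_onto m.
Proof.
split=> [surj z Hz|onto z Hz].
  pose y : xcarr A := [ffun X => [ffun i =>
    if (X \in trip) && (i \in loc setT X) then (z X i : S^o) else 0] : hcarr A].
  have yE X i : xcomp y X i = if (X \in trip) && (i \in loc setT X) then z X i else 0.
    by rewrite /xcomp !ffunE.
  have [|t Ht /coker_iota_den[_ [g Hg E]]] := surj y.
    apply/JXH_num; split=> X i; rewrite yE; last by move/negbTE=> ->.
    by case: ifP => [/andP[XT iX]|_]; [apply: Hz | apply: pdvd0].
  exists (hcomp g), t; split=> // X k XT kX.
  have := congr1 (fun u => xcomp u X k) E; rewrite xcompB yE xcomp_psi xcomp_iota XT kX /=.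
  by move=> <-; rewrite subrK.
have /JXH_num[Hz1 Hz2] := Hz.
have [|g [t [Hg Ht]]] := onto (xcomp z); first by move=> X k _ _; apply: Hz1.
pose t' : {ffun flat -> 'rV[S]_l} := [ffun X => if X \in trip then t X else 0].
pose g' : hcarr A := [ffun i => (g i : S^o)].
have t'E X : t' X = if X \in trip then t X else 0 by rewrite ffunE.
have g'E i : hcomp g' i = g i by rewrite /hcomp ffunE.
have Ht' : sq_num (DX m) t'.
  apply/DX_num; split=> X XT; rewrite t'E; [rewrite XT => k kX | by rewrite (negbTE XT)].
  rewrite -[ev _ _](addKr (g k)) -(Ht X k XT kX) addrC.
  by apply: pdvdB; [apply: Hz1 | apply: Hg].
have E : z - sum_psi t' = iota_J g'.
  apply: xcomp_ext => X k; rewrite xcompB xcomp_psi xcomp_iota g'E t'E.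
  have [/andP[XT kX]|/Hz2 ->] := boolP ((X \in trip) && (k \in loc setT X)); last by rewrite subr0.
  by rewrite XT (Ht X k XT kX) addrK.
exists t' => //; apply/coker_iota_den; split; last by exists g' => // i; rewrite g'E.
rewrite E; apply/JXH_num; split=> X k; rewrite xcomp_iota; last by move/negbTE=> ->.
by case: ifP => _; [rewrite g'E | apply: pdvd0].
Qed.

Section Coordinates.
Context (x0 : I -> flat) (Hx0 : forall k, x0 k \in trip /\ k \in loc setT (x0 k)).

Lemma card_coord_set : #|coord_set x0| = (\sum_(X in trip) locn X - nhyp A)%N.
Proof.
rewrite -card_trip_pairs; pose h k := (x0 k, k).
have hinj : injective h by move=> i j [].
have -> : coord_set x0 = trip_pairs A :\: h @: setT.
  apply/setP => -[X k]; rewrite in_setD [LHS]inE andbC; congr (_ && _).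
  congr (~~ _); apply/eqP/imsetP => /= [->|[k' _ [-> ->]] //]; by exists k.
rewrite cardsDS ?card_imset // ?cardsT ?card_ord //.
apply/subsetP => _ /imsetP[k _ ->]; rewrite inE /=; have [-> ->] := Hx0 k; done.
Qed.

Notation kappa := (\sum_(X in trip) locn X - nhyp A)%N.

Definition coord (j : 'I_kappa) : flat * I :=
  enum_val (cast_ord (esym card_coord_set) j).

Lemma coordP j : [/\ (coord j).1 \in trip, (coord j).2 \in loc setT (coord j).1
  & (coord j).1 != x0 (coord j).2].
Proof.
have := enum_valP (cast_ord (esym card_coord_set) j).
by rewrite 2!inE -/(coord j) => /andP[/andP[]].
Qed.

Lemma coord_surj X k : X \in trip -> k \in loc setT X -> X != x0 k ->
  exists j, coord j = (X, k).
Proof.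
move=> XT kX nX; have Hin : (X, k) \in coord_set x0 by rewrite 2!inE /= XT kX nX.
exists (cast_ord card_coord_set (enum_rank_in Hin (X, k))).
by rewrite /coord cast_ordK enum_rankK_in.
Qed.

Lemma coord_inj : injective coord.
Proof. by move=> i j /enum_val_inj/cast_ord_inj. Qed.

(** Total division by a power of a form, meaningful on multiples of it. *)
Definition quo (k : I) (p : S) : S := epsilon (inhabits 0) (fun q => p = q * al k ^+ m k).

Lemma quoK k p : pdvd (al k ^+ m k) p -> quo k p * al k ^+ m k = p.
Proof. by move=> /(epsilon_spec (inhabits 0)) <-. Qed.

Lemma coker_iota_iso :
  sq_iso (@xdeg K l A) (shift_deg (fun j => m (coord j).2))
    (coker_iota m) (full_sq 'rV[S]_kappa).
Proof.
pose diff z j := xcomp z (coord j).1 (coord j).2 - xcomp z (x0 (coord j).2) (coord j).2.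
pose f z : 'rV[S]_kappa := \row_j quo (coord j).2 (diff z j); exists f.
have dvd z j : sq_num (JXH m) z -> pdvd (al (coord j).2 ^+ m (coord j).2) (diff z j).
  by move=> /JXH_num[H _]; apply: pdvdB; apply: H.
split=> //.
- move=> a y z Hy Hz; rewrite /=; apply/rowP => j; rewrite !mxE.
  apply/eqP; rewrite subr_eq0; apply/eqP.
  set k := (coord j).2; apply: (mulIf (alX_neq0 k (m k))).
  have [Dy Dz] := (dvd y j Hy, dvd z j Hz).
  have E : diff (a *: y + z) j = a * diff y j + diff z j.
    by rewrite /diff !xcompD !xcompZ; ring.
  rewrite E mulrDl -mulrA !quoK //; apply: pdvdD => //; exact: pdvdM.
- move=> z Hz; have /JXH_num[Hz1 Hz2] := Hz; split=> [E|/coker_iota_den[_ [g _ ->]]].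
    pose g : hcarr A := [ffun k => (xcomp z (x0 k) k : S^o)].
    have gE k : hcomp g k = xcomp z (x0 k) k by rewrite /hcomp ffunE.
    apply/coker_iota_den; split=> //; exists g => [k|]; first by rewrite gE; apply: Hz1.
    apply: xcomp_ext => X k; rewrite xcomp_iota gE.
    have [/andP[XT kX]|/Hz2 //] := boolP ((X \in trip) && (k \in loc setT X)).
    have [->//|nX] := eqVneq X (x0 k).
    have [j Ej] := coord_surj XT kX nX.
    move/rowP/(_ j): E; rewrite !mxE => E0; have := quoK (dvd z j Hz).
    by rewrite E0 mul0r /diff Ej /= => /esym/subr0_eq.
  rewrite /=; apply/rowP => j; rewrite !mxE; set k := (coord j).2.
  have D0 : diff (iota_J g) j = 0.
    rewrite /diff !xcomp_iota; have [-> -> _] := coordP j; have [-> ->] := Hx0 (coord j).2.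
    by rewrite subrr.
  apply: (mulIf (alX_neq0 k (m k))); rewrite mul0r quoK ?D0 //; exact: pdvd0.
- move=> y _.
  pose z := \sum_j inXH (coord j).1 (coord j).2 (y 0 j * al (coord j).2 ^+ m (coord j).2).
  have zE X k : xcomp z X k = \sum_j if (X, k) == coord j then y 0 j * al k ^+ m k else 0.
    rewrite xcomp_sum; apply: eq_bigr => j _; rewrite xcomp_in.
    rewrite [coord j in RHS]surjective_pairing xpair_eqE.
    by case: eqP => //= _; case: eqP => // ->.
  have z_out X k : (forall j, coord j != (X, k)) -> xcomp z X k = 0.
    by move=> H; rewrite zE big1 // => j _; rewrite eq_sym (negbTE (H j)).
  have z_in j : xcomp z (coord j).1 (coord j).2 = y 0 j * al (coord j).2 ^+ m (coord j).2.
    rewrite zE (bigD1 j) //= -surjective_pairing eqxx [X in _ + X]big1 ?addr0 // => h nh.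
    by rewrite (inj_eq coord_inj) eq_sym (negbTE nh).
  have Hz : sq_num (JXH m) z.
    apply/JXH_num; split=> X k.
      rewrite zE; apply: pdvd_sum => j _; case: ifP => _; last exact: pdvd0.
      by exists (y 0 j).
    move=> nX; apply: z_out => j; apply: contra nX => /eqP E.
    by have [+ + _] := coordP j; rewrite E /= => -> ->.
  exists z => //; rewrite /=; apply/rowP => j; rewrite !mxE; set k := (coord j).2.
  apply/eqP; rewrite subr_eq0; apply/eqP; apply: (mulIf (alX_neq0 k (m k))).
  rewrite quoK; last exact: dvd.
  rewrite /diff z_in z_out ?subr0 // => h; apply/eqP => E.
  by have [_ _] := coordP h; rewrite E eqxx.
move=> d z Hz degz; exists (f z); split; [by [] | | by rewrite /= subrr].
move=> j; rewrite mxE; set k := (coord j).2.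
apply: (dhomog_quot (lfX_homog (form k) (m k)) (alX_neq0 k (m k))).
by rewrite quoK; [apply: rpredB; apply: degz | apply: dvd].
Qed.

End Coordinates.

End Cokernels.

(** * The second cohomology of J *)

Section SecondCohomology.

Context {K : fieldType} {l : nat} (A : arrangement K l).
Notation S := {mpoly K[l]}.
Notation I := (ordinal (nhyp A)).
Notation form := (@Defs.form K l A).
Notation al i := (lf (form (i : I))).
Notation flat := (Defs.flat A).
Notation loc := (@Defs.loc K l A).
Notation flats := (@Defs.flats K l A).
Notation trip := (L2trip A).
Notation flatV := (flatV A).

Lemma Dcx_num (m : I -> nat) k x : sq_num (Dcx m k) x <->
  (forall X, X \in flats setT k -> sq_num (Dmod m k (loc setT X)) (cproj x X)) /\
  (forall X, X \notin flats setT k -> cproj x X = 0).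
Proof.
split=> [H|[H1 H2] X]; last by case: ifP => [/H1|/negbT/H2].
by split=> X XT; have := H X; rewrite ?XT ?(negbTE XT).
Qed.

Lemma Dcx_den (m : I -> nat) k x : sq_den (Dcx m k) x <->
  (forall X, X \in flats setT k -> sq_den (Dmod m k (loc setT X)) (cproj x X)) /\
  (forall X, X \notin flats setT k -> cproj x X = 0).
Proof.
split=> [H|[H1 H2] X]; last by case: ifP => [/H1|/negbT/H2].
by split=> X XT; have := H X; rewrite ?XT ?(negbTE XT).
Qed.

(** For positive multiplicities, a constant derivation is tangent to a
    hyperplane if and only if it kills its form. *)
Lemma kcoef_indep (m m' : I -> nat) k (B : {set I}) (z : carr A k) :
  multiplicity m ->
  (sq_num (Dmod m k B) z -> sq_num (Dmod m' k B) (kcoef 0%MM z)) /\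
  (sq_den (Dmod m k B) z -> sq_den (Dmod m' k B) (kcoef 0%MM z)).
Proof.
move=> m0; elim: k B z => [|k IH] B z.
  split=> [Hz i iB|->]; last exact: vcoef0.
  have [q Eq] := Hz i iB; exists 0; rewrite mul0r der_app_lf ev_vcoef.
  have -> : (ev (form i) z)@_0%MM = 0.
    by apply: (@cst_dvd _ _ (form i) _ _ (m0 i)); exists q; rewrite -der_app_lf.
  by rewrite mpolyC0.
have Hnum (y : carr A k.+1) : sq_num (Dmod m k.+1 B) y -> sq_num (Dmod m' k.+1 B) (kcoef 0%MM y).
  move=> Hy X; have := Hy X; rewrite -/(cproj (kcoef 0%MM y) X) cproj_kcoef -/(cproj y X).
  by case: ifP => _; [apply: (IH _ _).1 | move=> ->; rewrite kcoef0].
split=> [|[Hz [x Hx E]]]; first exact: Hnum.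
split; first exact: Hnum.
exists (kcoef 0%MM x); first exact: (IH _ _).1.
have E' : kcoef 0%MM (z - tau B x) = kcoef 0%MM z - tau B (kcoef 0%MM x) :> carr A k.+1.
  by rewrite kcoefB kcoef_tau.
move=> X; rewrite -/(cproj (kcoef 0%MM z - tau B (kcoef 0%MM x) : carr A k.+1) X) -E' cproj_kcoef.
have := E X; rewrite -/(cproj (z - tau B x : carr A k.+1) X).
case: ifP => _; last by move=> ->; rewrite kcoef0.
exact: (IH _ _).2.
Qed.

Lemma Dmod_num_kcoef (m m' : I -> nat) k (B : {set I}) mu (z : carr A k.+1) :
  sq_num (Dmod m k.+1 B) z -> sq_num (Dmod m' k.+1 B) (kcoef mu z).
Proof.
elim: k B z => [|k IH] B z.
  move/Dmod1_num => H; apply/Dmod1_num => Z nZ; rewrite cproj_kcoef H //; exact: kcoef0.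
move/DmodSS_num => [H1 H2]; apply/DmodSS_num; split=> Y YB; rewrite cproj_kcoef.
  exact/IH/H1.
by rewrite H2 // kcoef0.
Qed.

Lemma Dcx_num_kcoef (m m' : I -> nat) k mu (z : carr A k.+2) :
  sq_num (Dcx m k.+1) z -> sq_num (Dcx m' k.+1) (kcoef mu z).
Proof.
move/Dcx_num => [H1 H2]; apply/Dcx_num; split=> X X2; rewrite cproj_kcoef.
  exact/Dmod_num_kcoef/H1.
by rewrite H2 // kcoef0.
Qed.

Lemma Scx_num (m m' : I -> nat) k (z : carr A k.+2) :
  sq_num (Dcx m k.+1) z -> sq_num (Scx m' k.+1) z.
Proof.
move=> Hz; apply: kcoef_rspan => mu; split; last exact: kcoef_cdeg.
exact: Dcx_num_kcoef Hz.
Qed.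

(** The degree zero part of the denominators does not depend on the
    multiplicity. *)
Lemma Scx_den_indep (m m' : I -> nat) k (z : carr A k.+1) : multiplicity m ->
  sq_den (Scx m k) z -> sq_den (Scx m' k) z.
Proof.
move=> m0 [n [c [y [Hy E]]]]; exists n, c, y; split=> // i.
have [Hd deg] := Hy i; split=> //; move: Hd => /Dcx_den[H1 H2].
apply/Dcx_den; split=> // X X2.
have := (kcoef_indep m' (loc setT X) (cproj (y i) X) m0).2 (H1 X X2).
by rewrite kcoef_id //; apply: deg.
Qed.

Context (m : I -> nat) (m_gt0 : multiplicity m).

Definition xval (x : carr A 3) (X : flat) (i : I) : 'rV[S]_l :=
  cproj (cproj (cproj x X) (hflat i)) flatV.

Definition supp2 (x : carr A 3) : Prop := forall X Y Z,
  ~~ [&& X \in flats setT 2, Y \in flats (loc setT X) 1 & Z == flatV] ->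
  cproj (cproj (cproj x X) Y) Z = 0.

Lemma Dcx2_num x : sq_num (Dcx m 2) x <-> supp2 x.
Proof.
split=> [/Dcx_num[H1 H2] X Y Z|H].
  have [X2|/H2 ->] := boolP (X \in flats setT 2); last by rewrite !cproj0.
  have /DmodSS_num[H3 H4] := H1 X X2.
  have [Y1|/H4 ->] := boolP (Y \in flats (loc setT X) 1); last by rewrite !cproj0.
  by have /Dmod1_num H5 := H3 Y Y1; apply: H5.
apply/Dcx_num; split=> X X2; last first.
  by apply: cproj_ext => Y; apply: cproj_ext => Z; rewrite H ?(negbTE X2) // !cproj0.
apply/DmodSS_num; split=> Y Y1; last first.
  by apply: cproj_ext => Z; rewrite H ?(negbTE Y1) ?andbF // !cproj0.
by apply/Dmod1_num => Z nZ; apply: H; rewrite (negbTE nZ) !andbF.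
Qed.

Lemma Dcx2_den x : sq_den (Dcx m 2) x <-> supp2 x /\
  forall X, X \in flats setT 2 -> exists v, forall i, i \in loc setT X ->
    pdvd (al i ^+ m i) (ev (form i) (xval x X i) - ev (form i) v).
Proof.
split=> [/Dcx_den[H1 H2]|[Hs H]].
  split.
    by apply/Dcx2_num/Dcx_num; split=> // X /H1 /Dmod2_den[].
  by move=> X /H1 /Dmod2_den[_ [v Hv]]; exists v => i /Hv; rewrite evB.
have /Dcx2_num/Dcx_num[H1 H2] := Hs; apply/Dcx_den; split=> // X X2.
apply/Dmod2_den; split; first exact: H1.
by have [v Hv] := H X X2; exists v => i /Hv; rewrite evB.
Qed.

Lemma xval_kcoef mu x X i : xval (kcoef mu x) X i = vcoef mu (xval x X i).
Proof. by rewrite /xval !cproj_kcoef. Qed.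

Lemma xvalD x y X i : xval (x + y) X i = xval x X i + xval y X i.
Proof. by rewrite /xval !cprojD. Qed.
Lemma xvalB x y X i : xval (x - y) X i = xval x X i - xval y X i.
Proof. by rewrite /xval !cprojB. Qed.
Lemma xvalZ a x X i : xval (a *: x) X i = a *: xval x X i.
Proof. by rewrite /xval !cprojZ. Qed.

Lemma Scx2_den x : sq_den (Scx m 2) x <-> supp2 x /\
  forall X, X \in flats setT 2 -> exists v, forall i, i \in loc setT X ->
    ev (form i) (xval x X i) = ev (form i) v.
Proof.
split=> [[n [c [z [Hz ->]]]]|[Hs H]].
  have Hzk k := Hz k; split.
    move=> X Y Z nXYZ; rewrite !cproj_sum big1 // => k _; rewrite !cprojZ.
    by have [/Dcx2_den[Hs _] _] := Hzk k; rewrite Hs // scaler0.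
  move=> X X2; have Hv k : exists v, forall i, i \in loc setT X ->
      ev (form i) (xval (z k) X i) = ev (form i) v.
    have [/Dcx2_den[_ /(_ X X2)[v Hv]] deg] := Hzk k.
    exists (vcoef 0%MM v) => i iX.
    rewrite -(kcoef_id deg) xval_kcoef !ev_vcoef; congr (_%:MP).
    by apply/subr0_eq; rewrite -[RHS](cst_dvd (m_gt0 i) (Hv i iX)) cstB.
  have [v Ev] := choice_fun Hv; exists (\sum_k c k *: v k) => i iX; rewrite /xval !cproj_sum !ev_sum.
  apply: eq_bigr => k _; by rewrite !cprojZ !evZ -(Ev k i iX).
apply: kcoef_rspan => mu; split; last exact: kcoef_cdeg.
apply/Dcx2_den; split.
  by move=> X Y Z nXYZ; rewrite !cproj_kcoef Hs // kcoef0.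
move=> X X2; have [v Hv] := H X X2; exists (vcoef mu v) => i iX.
by rewrite xval_kcoef !ev_vcoef Hv // subrr; apply: pdvd0.
Qed.

Lemma dcx1_val (y : carr A 2) X Y Z : cproj (cproj (cproj (dcx y) X) Y) Z =
  if (X \in flats setT 2) && flat_le Y X then cproj (cproj y Y) Z else 0.
Proof.
rewrite /dcx cproj_tau; case: (X \in flats setT 2); last by rewrite !cproj0.
by rewrite cproj_phi; case: ifP => _; rewrite ?cproj0.
Qed.

Lemma xval_dcx (y : carr A 2) X i : X \in flats setT 2 -> i \in loc setT X ->
  xval (dcx y) X i = cproj (cproj y (hflat i)) flatV.
Proof. by move=> X2 iX; rewrite /xval dcx1_val X2 le_hflat iX. Qed.

Lemma dcx2_num x : supp2 x -> sq_num (Dcx m 3) (dcx x).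
Proof.
move=> /Dcx2_num/Dcx_num[H1 H2]; apply/Dcx_num; split=> X X3; last first.
  by rewrite /dcx cproj_tau (negbTE X3).
rewrite /dcx cproj_tau X3; apply/DmodSS_num; split=> Y; rewrite flats_locT cproj_phi => Y2.
  move: Y2 => /andP[cY le]; rewrite le loc_loc //; apply: H1.
  by rewrite mem_flatsT.
case: ifP => // le; apply: H2; rewrite mem_flatsT.
by move: Y2; rewrite le andbT.
Qed.

Context (S3 : sq_zero (Scx (fun _ : I => 1%N) 3)).

Lemma H2J_num x : sq_num (H2J m) x <-> sq_den (Dcx m 2) x.
Proof.
split=> [[[_ ?] _]//|H]; have [Hs _] := proj1 (Dcx2_den x) H.
split; first by split=> //; apply/(Scx_num (m := m))/Dcx2_num.
apply: (@Scx_den_indep (fun=> 1%N)) => //; apply: S3.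
exact/(Scx_num (m := m))/dcx2_num.
Qed.

Lemma H2J_den x : sq_den (H2J m) x <-> sq_num (H2J m) x /\
  exists g : I -> S, (forall i, pdvd (al i ^+ m i) (g i)) /\
  forall X, X \in flats setT 2 -> exists v, forall i, i \in loc setT X ->
    ev (form i) (xval x X i) = g i + ev (form i) v.
Proof.
split=> [[Hx [y [_ /Dcx_den[Hy _]] /Scx2_den[_ Hv]]]|[Hx [g [Hg H]]]].
  split=> //; exists (fun i => ev (form i) (cproj (cproj y (hflat i)) flatV)); split=> [i|X X2].
    have /Dmod1_den[_ Hi] : sq_den (Dmod m 1 (loc setT (hflat i))) (cproj y (hflat i)).
      by apply: Hy; rewrite hflat_flats1 in_setT.
    by apply: Hi; rewrite mem_locT val_hflat subvv.
  have [v E] := Hv X X2; exists v => i iX; rewrite -E // xvalB evB.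
  by rewrite xval_dcx // addrC subrK.
have [w Hw] := choice_fun (@form_dual _ _ A).
pose y : carr A 2 := [ffun Y => [ffun Z =>
  if Z == flatV then \sum_(i | Y == hflat i) vfield (w i) (g i) else 0] : carr A 1].
have yE Y Z : cproj (cproj y Y) Z =
    if Z == flatV then \sum_(i | Y == hflat i) vfield (w i) (g i) else 0.
  by rewrite /cproj !ffunE.
have y_hflat i : cproj (cproj y (hflat i)) flatV = vfield (w i) (g i).
  rewrite yE eqxx (big_pred1 i) // => j; rewrite (inj_eq (@hflat_inj _ _ A)) eq_sym //.
have y_out Y : Y \notin flats setT 1 -> cproj y Y = 0.
  move=> nY; apply: cproj_ext => Z; rewrite yE cproj0; case: ifP => // _.
  by rewrite big1 // => i /eqP E; rewrite E hflat_flats1 in_setT in nY.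
have ynum : sq_num (Dcx m 1) y.
  apply/Dcx_num; split=> // Y Y1; apply/Dmod1_num => Z nZ.
  by rewrite yE (negbTE nZ).
have yden : sq_den (Dcx m 1) y.
  have /Dcx_num[H1 _] := ynum.
  apply/Dcx_den; split=> // Y Y1; apply/Dmod1_den; split; first exact: H1.
  have /flats1P[i _ EY] := Y1; move=> j; rewrite EY loc_hflat ?in_setT // in_set1 => /eqP ->.
  by rewrite y_hflat ev_vfield Hw scale1r.
split=> //; exists y; first by split=> //; apply: (Scx_num (m := m)).
have /H2J_num/Dcx2_den[Hs _] := Hx; apply/Scx2_den; split.
  move=> X Y Z nXYZ; rewrite !cprojB dcx1_val Hs // sub0r; apply/eqP; rewrite oppr_eq0; apply/eqP.
  case: ifP => // /andP[X2 le].
  have [Y1|/y_out -> ] := boolP (Y \in flats setT 1); last by rewrite !cproj0.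
  have [EZ|nZ] := eqVneq Z flatV; last by rewrite yE (negbTE nZ).
  case/negP: nXYZ; rewrite X2 EZ eqxx flats_locT le !andbT /=.
  by move: Y1; rewrite mem_flatsT.
move=> X X2; have [v Hv] := H X X2; exists v => i iX.
rewrite xvalB evB Hv // xval_dcx // y_hflat ev_vfield Hw scale1r.
by rewrite addrAC subrr add0r.
Qed.

Lemma coker_psi_den z : sq_den (coker_psi m) z <-> sq_num (JXH m) z /\
  exists (t : flat -> 'rV[S]_l) (g : I -> S),
  [/\ forall X, X \in trip -> tangent X m (t X), forall i, pdvd (al i ^+ m i) (g i)
    & forall X i, X \in trip -> i \in loc setT X -> xcomp z X i = ev (form i) (t X) + g i].
Proof.
split=> [[Hz [t /DX_num[Ht _] /coker_iota_den[_ [g Hg E]]]]|[Hz [t [g [Ht Hg E]]]]].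
  split=> //; exists t, (hcomp g); split=> // X i XT iX.
  have := congr1 (fun u => xcomp u X i) E; rewrite xcompB xcomp_psi xcomp_iota XT iX /= => <-.
  by rewrite addrC subrK.
pose t' : {ffun flat -> 'rV[S]_l} := [ffun X => if X \in trip then t X else 0].
have t'E X : t' X = if X \in trip then t X else 0 by rewrite ffunE.
pose g' : hcarr A := [ffun i => (g i : S^o)].
have g'E i : hcomp g' i = g i by rewrite /hcomp ffunE.
split=> //; exists t'.
  by apply/DX_num; split=> X XT; rewrite t'E; [rewrite XT; apply: Ht | rewrite (negbTE XT)].
have E' : z - sum_psi t' = iota_J g'.
  have /JXH_num[_ Hz2] := Hz.
  apply: xcomp_ext => X k; rewrite xcompB xcomp_psi xcomp_iota g'E t'E.
  have [/andP[XT kX]|/Hz2 ->] := boolP ((X \in trip) && (k \in loc setT X)); last by rewrite subr0.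
  by rewrite XT E // addrAC subrr add0r.
apply/coker_iota_den; split; last by exists g' => // i; rewrite g'E.
rewrite E'; apply/JXH_num; split=> X k; rewrite xcomp_iota; last by move/negbTE=> ->.
by case: ifP => _; [rewrite g'E | apply: pdvd0].
Qed.

Lemma pdvd_pihomog i d (p : S) : pdvd (al i ^+ m i) p ->
  pdvd (al i ^+ m i) (pihomog mdeg d p).
Proof.
move=> [q ->]; rewrite (pihomogM _ _ (lfX_homog (form i) (m i))).
by case: ifP => _; [eexists | apply: pdvd0].
Qed.

Lemma trip_flats2 X : X \in trip -> X \in flats setT 2.
Proof. by rewrite mem_trip mem_flatsT => /andP[]. Qed.

(** An element of J^2 is a family x_(X, i) of vector fields which for each X
    agrees with some vector field v_X up to elements of the ideals J(H).
    Subtracting v_X yields a family in these ideals; the choice of v_X changes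
    it by the image of D(A_X), and the differential from J^1 by the image of
    iota. *)
Lemma H2J_iso :
  sq_iso (@cdeg K l A 3) (@xdeg K l A) (H2J m) (coker_psi m).
Proof.
pose good x X v := forall i, i \in loc setT X ->
  pdvd (al i ^+ m i) (ev (form i) (xval x X i) - ev (form i) v).
pose vx x X := epsilon (inhabits (0 : 'rV[S]_l)) (good x X).
have Hvx x X : sq_num (H2J m) x -> X \in trip -> good x X (vx x X).
  move=> /H2J_num/Dcx2_den[_ H] /trip_flats2 /H [v Hv].
  by apply: (epsilon_spec (inhabits (0 : 'rV[S]_l)) (good x X)); exists v.
pose f x : xcarr A := [ffun X => [ffun i => if (X \in trip) && (i \in loc setT X)
  then (ev (form i) (xval x X i) - ev (form i) (vx x X) : S^o) else 0] : hcarr A].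
have fE x X i : xcomp (f x) X i = if (X \in trip) && (i \in loc setT X)
    then ev (form i) (xval x X i) - ev (form i) (vx x X) else 0.
  by rewrite /xcomp !ffunE.
have fin x X i : X \in trip -> i \in loc setT X ->
    xcomp (f x) X i = ev (form i) (xval x X i) - ev (form i) (vx x X).
  by move=> XT iX; rewrite fE XT iX.
have fnum x : sq_num (H2J m) x -> sq_num (JXH m) (f x).
  move=> Hx; apply/JXH_num; split=> X i; rewrite fE; last by move/negbTE->.
  by case: ifP => [/andP[XT iX]|_]; [apply: Hvx | apply: pdvd0].
have JB y z : sq_num (JXH m) y -> sq_num (JXH m) z -> sq_num (JXH m) (y - z).
  move=> /JXH_num[H1 H2] /JXH_num[G1 G2]; apply/JXH_num; split=> X i; rewrite xcompB.
    by apply: pdvdB; [apply: H1 | apply: G1].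
  by move=> n; rewrite H2 ?G2 ?subrr.
have JD a y z : sq_num (JXH m) y -> sq_num (JXH m) z -> sq_num (JXH m) (a *: y + z).
  move=> /JXH_num[H1 H2] /JXH_num[G1 G2]; apply/JXH_num; split=> X i; rewrite xcompD xcompZ.
    by apply: pdvdD; [apply/pdvdM/H1 | apply: G1].
  by move=> n; rewrite H2 ?G2 // mulr0 addr0.
exists f; split; first exact: fnum.
- move=> a x y Hx Hy.
  have Hxy : sq_num (H2J m) (a *: x + y).
    apply/H2J_num/Dcx2_den; move: Hx Hy => /H2J_num/Dcx2_den[Hs Hx] /H2J_num/Dcx2_den[Gs Hy].
    split=> [X Y Z n|X X2]; first by rewrite !cprojD !cprojZ Hs ?Gs // scaler0 addr0.
    have [v Hv] := Hx X X2; have [u Hu] := Hy X X2; exists (a *: v + u) => i iX.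
    rewrite xvalD xvalZ !evD !evZ opprD addrACA -mulrBr.
    by apply: pdvdD; [apply/pdvdM/Hv | apply: Hu].
  apply/coker_psi_den; split; first by apply: JB; [apply: fnum | apply: JD; apply: fnum].
  exists (fun X => a *: vx x X + vx y X - vx (a *: x + y) X), (fun=> 0); split.
  + move=> X XT i iX; rewrite evB evD evZ.
    have -> : a * ev (form i) (vx x X) + ev (form i) (vx y X) - ev (form i) (vx (a *: x + y) X) =
      (ev (form i) (xval (a *: x + y) X i) - ev (form i) (vx (a *: x + y) X))
      - (a * (ev (form i) (xval x X i) - ev (form i) (vx x X))
         + (ev (form i) (xval y X i) - ev (form i) (vx y X))).
      by rewrite xvalD xvalZ evD evZ; ring.
    apply: pdvdB; first exact: Hvx.
    by apply: pdvdD; [apply/pdvdM; apply: Hvx | apply: Hvx].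
  + by move=> i; apply: pdvd0.
  move=> X i XT iX; rewrite addr0 xcompB xcompD xcompZ !fin // evB evD evZ xvalD xvalZ evD evZ.
  by ring.
- move=> x Hx; rewrite H2J_den coker_psi_den; split=> [[_ [t [g [Ht Hg E]]]]|[_ [g [Hg H]]]].
    split=> //; exists g; split=> // X X2.
    have [XT|nXT] := boolP (X \in trip).
      exists (vx x X + t X) => i iX; have := E X i XT iX; rewrite fin // evD => E'.
      by rewrite -[LHS](subrK (ev (form i) (vx x X))) E'; ring.
    have [|v Hv] := @small_flat_field _ _ A X (fun i => ev (form i) (xval x X i) - g i).
      by move: nXT; rewrite mem_trip -mem_flatsT X2 /= -leqNgt.
    by exists v => i iX; rewrite Hv // addrC subrK.
  split; first exact: fnum.
  have [v Hv] := choice_on (D := mem trip) 0 (fun X XT => H X (trip_flats2 XT)).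
  exists (fun X => v X - vx x X), g; split=> //.
    move=> X XT i iX; have -> : ev (form i) (v X - vx x X) =
       (ev (form i) (xval x X i) - ev (form i) (vx x X)) - g i.
      by rewrite (Hv X XT i iX) evB; ring.
    by apply: pdvdB; [apply: Hvx | apply: Hg].
  by move=> X i XT iX; rewrite fin // (Hv X XT i iX) evB; ring.
- move=> z Hz; have /JXH_num[Hz1 Hz2] := Hz; have [w Hw] := choice_fun (@form_dual _ _ A).
  pose x : carr A 3 := [ffun X => [ffun Y => [ffun Z =>
    if Z == flatV then \sum_(i | Y == hflat i) vfield (w i) (xcomp z X i) else 0]
      : carr A 1] : carr A 2].
  have xE X Y Z : cproj (cproj (cproj x X) Y) Z =
      if Z == flatV then \sum_(i | Y == hflat i) vfield (w i) (xcomp z X i) else 0.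
    by rewrite /cproj !ffunE.
  have xvE X i : ev (form i) (xval x X i) = xcomp z X i.
    rewrite /xval xE eqxx (big_pred1 i) => [|j]; first by rewrite ev_vfield Hw scale1r.
    by rewrite (inj_eq (@hflat_inj _ _ A)) eq_sym.
  have vf0 u : vfield u 0 = 0 :> 'rV[S]_l.
    by apply/rowP => j; rewrite !mxE scaler0.
  have Hx : sq_num (H2J m) x.
    apply/H2J_num/Dcx2_den; split=> [X Y Z n|X X2]; last first.
      by exists 0 => i iX; rewrite xvE ev0 subr0.
    rewrite xE; case: eqP => // EZ; rewrite big1 // => i /eqP EY.
    rewrite Hz2 ?vf0 //; apply: contra n => /andP[XT iX].
    by rewrite EZ eqxx trip_flats2 // EY hflat_flats1 iX.
  exists x => //; apply/coker_psi_den; split; first by apply: JB => //; apply: fnum.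
  exists (vx x), (fun=> 0); split=> [X XT i iX|i|X i XT iX].
  + have -> : ev (form i) (vx x X) = xcomp z X i - (ev (form i) (xval x X i) - ev (form i) (vx x X)).
      by rewrite xvE; ring.
    by apply: pdvdB; [apply: Hz1 | apply: Hvx].
  + exact: pdvd0.
  by rewrite xcompB fin // xvE; ring.
move=> d x Hx degx.
pose y : xcarr A := [ffun X => [ffun i => (pihomog mdeg d (xcomp (f x) X i) : S^o)] : hcarr A].
have yE X i : xcomp y X i = pihomog mdeg d (xcomp (f x) X i) by rewrite {1}/xcomp !ffunE.
have yJ : sq_num (JXH m) y.
  have /JXH_num[H1 H2] := fnum x Hx; apply/JXH_num; split=> X i; rewrite yE.
    exact/pdvd_pihomog/H1.
  by move/H2 => ->; rewrite pihomog0.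
exists y; split=> //; first by move=> X i; have := pihomogP mdeg d (xcomp (f x) X i); rewrite -yE.
apply/coker_psi_den; split; first by apply: JB => //; apply: fnum.
have evx X i : pihomog mdeg d (ev (form i) (xval x X i)) = ev (form i) (xval x X i).
  apply: pihomog_dE; apply: rpred_sum => j _; apply: rpredZ.
  exact: (degx X (hflat i) flatV j).
exists (fun X => vhom d (vx x X) - vx x X), (fun=> 0); split.
+ move=> X XT i iX; have -> : ev (form i) (vhom d (vx x X) - vx x X) =
     (ev (form i) (xval x X i) - ev (form i) (vx x X))
     - pihomog mdeg d (ev (form i) (xval x X i) - ev (form i) (vx x X)).
    by rewrite evB ev_vhom pihomogB evx; ring.
  by apply: pdvdB; [|apply: pdvd_pihomog]; apply: Hvx.
+ by move=> i; apply: pdvd0.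
move=> X i XT iX; rewrite xcompB yE fin // evB ev_vhom pihomogB evx; ring.
Qed.

End SecondCohomology.

(** * Invariance under isomorphism of lattices *)

Section LatticeInvariance.

Context {K : fieldType} {l : nat}.

Lemma codim_lt (A : arrangement K l) (X Y : flat A) : flat_le X Y -> X != Y ->
  (codim (val X) < codim (val Y))%N.
Proof.
move=> le neq; have lt : (\dim (val Y) < \dim (val X))%N.
  rewrite ltn_neqAle dimvS // andbT; apply: contra neq => /eqP E.
  by apply/eqP/val_inj/esym/eqP; rewrite eqEdim E leqnn andbT.
have := dimvS (subvf (val X)); rewrite dimvf /dim /= muln1 => dX.
by rewrite /codim; apply: ltn_sub2l => //; apply: leq_trans dX.
Qed.

(** Drop hyperplanes from a description of X until the intersection grows; it
    then grows by one dimension. *)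
Lemma flat_below (A : arrangement K l) (X : flat A) c : codim (val X) = c.+1 ->
  exists Y, [/\ flat_le Y X, Y != X & codim (val Y) = c].
Proof.
have [C ->] := flat_ofP X; move E: #|C| => n; elim: n C E => [|n IH] C cardC cC.
  move/eqP: cardC cC; rewrite cards_eq0 => /eqP ->.
  by rewrite -/(flatV A) val_flatV /codim dimvf /dim /= muln1 subnn.
have [i iC] : exists i, i \in C by apply/set0Pn; rewrite -cards_eq0 cardC.
have EC : center C = (hyp i :&: center (C :\ i))%VS.
  by rewrite /center (big_setD1 i).
have le : flat_le (flat_of (C :\ i)) (flat_of C).
  by rewrite /flat_le !val_flat_of EC capvSr.
have [E|neq] := eqVneq (flat_of (C :\ i)) (flat_of C).
  have [||Y] := IH (C :\ i); last by rewrite E; exists Y.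
    by move: cardC; rewrite (cardsD1 i) iC => -[].
  by rewrite E.
exists (flat_of (C :\ i)); split=> //.
have := codim_lt le neq; rewrite cC ltnS => upper; apply/eqP; rewrite eqn_leq upper /=.
have := dimv_sum_cap (hyp i) (center (C :\ i)); rewrite -EC.
have := dimvS (subvf (hyp i + center (C :\ i))%VS); rewrite dimvf /dim /= muln1.
have := dim_hyp i; move: cC; rewrite /codim !val_flat_of; lia.
Qed.

(** The codimension bounds the length of chains of flats below X, and by
    [flat_below] some chain attains it. *)
Lemma iso_codim_le (A A' : arrangement K l) (f : flat A -> flat A') :
  injective f -> (forall X Y, flat_le (f X) (f Y) = flat_le X Y) ->
  forall X, (codim (val X) <= codim (val (f X)))%N.
Proof.
move=> finj fle X; move E: (codim (val X)) => c; elim: c X E => [//|c IH] X E.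
have [Y [le neq cY]] := flat_below E.
apply: leq_ltn_trans (IH Y cY) _; apply: codim_lt; first by rewrite fle.
by rewrite (inj_eq finj).
Qed.

Section Iso.
Context (A A' : arrangement K l) (f : flat A -> flat A').
Context (fbij : bijective f) (fle : forall X Y, flat_le (f X) (f Y) = flat_le X Y).

Lemma iso_codim X : codim (val (f X)) = codim (val X).
Proof.
have [g fg gf] := fbij; apply/eqP; rewrite eqn_leq; apply/andP; split.
  rewrite -{2}(fg X); apply: iso_codim_le; first exact: can_inj gf.
  by move=> Y Z; rewrite -fle !gf.
by apply: iso_codim_le => //; apply: can_inj fg.
Qed.

Lemma loc_flats (B : arrangement K l) (X : flat B) :
  locn X = #|[set Y | (codim (val Y) == 1%N) && flat_le Y X]|.
Proof.
rewrite /locn -(card_imset _ (@hflat_inj K l B)); apply: eq_card => Y.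
rewrite [RHS]inE; apply/imsetP/andP => [[i iX ->]|[/eqP cY le]].
  by rewrite codim_hflat le_hflat.
have /flats1P[i _ EY] : Y \in flats setT 1 by rewrite mem_flatsT cY.
by exists i => //; rewrite -le_hflat -EY.
Qed.

Lemma iso_locn X : locn (f X) = locn X.
Proof.
rewrite !loc_flats -(card_imset _ (bij_inj fbij)).
apply: eq_card => Y; rewrite inE; have [g fg gf] := fbij.
rewrite -[Y]gf (mem_imset _ _ (bij_inj fbij)) inE.
by rewrite iso_codim fle.
Qed.

Lemma iso_trip X : (f X \in L2trip A') = (X \in L2trip A).
Proof. by rewrite !mem_trip iso_codim -!/(locn _) iso_locn. Qed.

Lemma nhyp_flats (B : arrangement K l) :
  nhyp B = #|[set Y : flat B | codim (val Y) == 1%N]|.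
Proof.
rewrite -[LHS]card_ord -cardsT -(card_imset _ (@hflat_inj K l B)); apply: eq_card => Y.
rewrite [RHS]inE -mem_flatsT; apply/imsetP/flats1P => [[i _ ->]|[i _ ->]]; by exists i.
Qed.

Lemma iso_nhyp : nhyp A' = nhyp A.
Proof.
rewrite [LHS]nhyp_flats [RHS]nhyp_flats -[RHS](card_imset _ (bij_inj fbij)).
apply: eq_card => Y; rewrite inE; have [g fg gf] := fbij.
by rewrite -[Y]gf (mem_imset _ _ (bij_inj fbij)) inE iso_codim.
Qed.

Lemma iso_sum_trip (F : nat -> nat) :
  (\sum_(X in L2trip A') F (locn X) = \sum_(X in L2trip A) F (locn X))%N.
Proof.
rewrite (reindex f) /=; last by case: fbij => g fg gf; exists g => ? _.
by apply: eq_big => [X|X _]; rewrite ?iso_trip ?iso_locn.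
Qed.

Lemma iso_card_trip : #|L2trip A'| = #|L2trip A|.
Proof. by rewrite -!sum1_card; apply: (iso_sum_trip (fun=> 1%N)). Qed.

Lemma iso_essential : (0 < l)%N -> essential_arr A -> essential_arr A'.
Proof.
move=> l0 ess v Hv.
have := iso_codim (flat_of setT); rewrite val_flat_of (essential_center ess) /codim dimv0 subn0.
move=> cl; have d0 : \dim (val (f (flat_of setT))) = 0%N by move: cl l0; lia.
have : v \in val (f (flat_of setT)).
  have [C ->] := flat_ofP (f (flat_of setT)); rewrite val_flat_of.
  by apply/mem_center => i _; apply: Hv.
by move/eqP: d0; rewrite dimv_eq0 => /eqP ->; rewrite memv0 => /eqP.
Qed.

End Iso.

(** For a free multiplicity the sum of the psi_X would be onto, but its source
    is too small at the origin. *)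
Lemma nonfree_count (A : arrangement K l) : essential_arr A -> (0 < nhyp A)%N ->
  (\sum_(X in L2trip A) locn X + l = nhyp A + 2 * #|L2trip A|)%N ->
  (l < #|L2trip A|)%N -> totally_nonfree A.
Proof.
move=> ess n0 count lt m m0 free.
have [b1 [b2 [w1 [w2 Hb]]]] := frame_exists n0.
have cardN := card_rel_index Hb.
have onto : psi_onto m by apply: (free_psi_onto m0 Hb) => //; lia.
by have := psi_onto_bound m0 onto; lia.
Qed.

End LatticeInvariance.

End Multiarrangements.

Theorem proposition6p2 (K : fieldType) (l : nat) (A : arrangement K l)
    (m : 'I_(nhyp A) -> nat) :
  irreducible_arr A -> TF2 A -> 3 <= arr_rank [set: 'I_(nhyp A)] -> multiplicity m ->
  let kappa := (\sum_(X in L2trip A) locn X) - nhyp A in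
  (exists e : 'I_kappa -> nat,
     sq_iso (@xdeg K l A) (shift_deg e)
       (coker_iota m) (full_sq 'rV[{mpoly K[l]}]_kappa))
  /\ sq_iso (@cdeg K l A 3) (@xdeg K l A) (H2J m) (coker_psi m)
  /\ (free_multi m <-> sq_surj (DX m) (coker_iota m) (@sum_psi K l A))
  /\ nhyp A < \sum_(X in L2trip A) locn X
  /\ (nhyp A < \sum_(X in L2trip A) (locn X - 1)
        <-> arr_rank [set: 'I_(nhyp A)] < #|L2trip A|)
  /\ (nhyp A < \sum_(X in L2trip A) (locn X - 1) ->
        totally_nonfree A
        /\ forall A' : arrangement K l,
             lattice_iso A A' -> totally_nonfree A').
Proof.
move=> irr tf2 rank3 m0 kappa.
have ess := irreducible_essential irr rank3.
have rank_l := essential_arr_rank ess.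
have l3 : 3 <= l by rewrite -rank_l.
have n0 : 0 < nhyp A by have := rank_le_nhyp irr rank3; lia.
have [b1 [b2 [w1 [w2 Hb]]]] := frame_exists n0.
have formal := TF2_triple_formal tf2 rank3 Hb.
have countN := formal_count Hb ess formal (TF2_row_free tf2 rank3 Hb).
have count : \sum_(X in L2trip A) locn X + l = nhyp A + 2 * #|L2trip A|.
  by have := card_rel_index Hb; lia.
have [x0 Hx0] := choice_fun (exists_trip irr rank3 Hb formal).
have sum1 : \sum_(X in L2trip A) (locn X - 1) + #|L2trip A| = \sum_(X in L2trip A) locn X.
  rewrite -sum1_card -big_split; apply: eq_bigr => X.
  rewrite mem_trip => /andP[_ c3]; apply: subnK; exact: leq_trans c3.
have equiv : nhyp A < \sum_(X in L2trip A) (locn X - 1) <-> l < #|L2trip A|.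
  by split; lia.
split; first by eexists; apply: (coker_iota_iso m Hx0).
split; first by apply: H2J_iso => //; apply: tf2.2.
split.
  rewrite sq_surj_psi; split; first exact: (free_psi_onto m0 Hb ess countN).
  exact: (psi_onto_free Hb Hx0 ess formal).
split; first exact: (nhyp_lt_sum irr rank3 Hb formal).
split; first by rewrite rank_l.
move=> /equiv lt; split; first exact: nonfree_count.
move=> A' [f [fbij fle]]; apply: nonfree_count.
- by apply: (iso_essential fbij fle) => //; apply: leq_trans l3.
- by rewrite (iso_nhyp fbij fle).
- rewrite (iso_nhyp fbij fle) (iso_card_trip fbij fle).
  by rewrite (iso_sum_trip fbij fle id).
by rewrite (iso_card_trip fbij fle).
Qed.
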